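(* For every $\alpha\geqslant\frac{2}{\pi}\big(1+\frac{1}{3\sqrt\pi}\big)$ there exists a non-negative function $\zeta\in L^2$ satisfying $\zeta=\varPhi(\zeta)$ (a.e. on $(0,\pi/2)$). Moreover this $\zeta$ satisfies $$0\leqslant\sigma+\tfrac13(H\zeta)(\sigma)\leqslant\pi\ \text{ for almost all }\sigma\in(0,\pi/2),\qquad \|\zeta\|\leqslant\frac{9\sqrt\pi}{2}.$$
   Context: $L^2$ denotes $L^2(0,\pi/2)$ with norm $\|f\|=\big(\int_0^{\pi/2}|f(\sigma)|^2\,d\sigma\big)^{1/2}$. The kernel is $K(s,\sigma)=\log\Big|\frac{\sin(s+\sigma)}{\sin(s-\sigma)}\Big|$ for $s,\sigma\in(0,\pi/2)$, $s\neq\sigma$, and for $w\in L^2$ the operator $H$ is $(Hw)(\sigma)=\frac1\pi\int_0^{\pi/2}K(s,\sigma)\,w(s)\,ds$, $\sigma\in[0,\pi/2]$. For a parameter $\alpha>0$ (the reduced Froude number) the nonlinear operator $\varPhi$ is defined for $\zeta\in L^2$ by $$\varPhi(\zeta)(\sigma)=\frac{3}{\alpha\pi}\,\frac{\sin\big(\sigma+\frac13(H\zeta)(\sigma)\big)\cot\sigma}{\exp\int_0^\sigma\zeta(s)\,ds},\qquad\sigma\in(0,\pi/2].$$ *)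

(* Defs.v *)
(* classical reals.  On a bounded interval:
   - f is Lebesgue integrable  <->  f and |f| are both HK-integrable,
     and then the two integrals coincide;
   - hence f in L^2(0,pi/2) <-> f, |f|, f^2 are HK-integrable on [0,pi/2]. *)
From Stdlib Require Import Reals Lra List ClassicalEpsilon.
Open Scope R_scope.

Fixpoint tagged_div (a b : R) (l : list (R * R * R)) : Prop :=
  match l with
  | nil => a = b
  | (u, v, t) :: l' => u = a /\ u < v /\ u <= t <= v /\ tagged_div v b l'
  end.

Definition delta_fine (delta : R -> R) (l : list (R * R * R)) : Prop :=
  Forall (fun p => match p with (u, v, t) =>
            t - delta t < u /\ v < t + delta t end) l.

Definition riemann_sum (f : R -> R) (l : list (R * R * R)) : R :=
  fold_right (fun p acc => match p with (u, v, t) => f t * (v - u) + acc end) 0 l.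

Definition HK (f : R -> R) (a b I : R) : Prop :=
  a <= b /\
  forall eps, 0 < eps ->
    exists delta : R -> R,
      (forall x, a <= x <= b -> 0 < delta x) /\
      forall l, tagged_div a b l -> delta_fine delta l ->
        Rabs (riemann_sum f l - I) < eps.

Definition HK_integrable (f : R -> R) (a b : R) : Prop := exists I, HK f a b I.

(* the value of the integral (meaningful when integrable; unique then) *)
Definition HKint (f : R -> R) (a b : R) : R :=
  epsilon (inhabits 0) (fun I => HK f a b I).

Definition L1_on (f : R -> R) (a b : R) : Prop :=
  HK_integrable f a b /\ HK_integrable (fun x => Rabs (f x)) a b.

Definition L2 (f : R -> R) : Prop :=
  L1_on f 0 (PI / 2) /\ HK_integrable (fun x => f x ^ 2) 0 (PI / 2).

Definition L2norm (f : R -> R) : R := sqrt (HKint (fun x => f x ^ 2) 0 (PI / 2)).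

Definition null_set (N : R -> Prop) : Prop :=
  forall eps, 0 < eps ->
    exists lo hi : nat -> R,
      (forall n, lo n <= hi n) /\
      (forall x, N x -> exists n, lo n < x < hi n) /\
      (forall n, sum_f_R0 (fun i => hi i - lo i) n <= eps).

Definition ae_on (a b : R) (P : R -> Prop) : Prop :=
  exists N, null_set N /\ forall x, a < x < b -> ~ N x -> P x.

(* kernel K(s,sigma) = log |sin(s+sigma)/sin(s-sigma)| (value 0 on the
   diagonal s = sigma, a null set) *)
Definition Kker (s sigma : R) : R :=
  if Req_EM_T s sigma then 0
  else ln (Rabs (sin (s + sigma) / sin (s - sigma))).

Definition Hop (w : R -> R) (sigma : R) : R :=
  / PI * HKint (fun s => Kker s sigma * w s) 0 (PI / 2).

Definition Phi (alpha : R) (zeta : R -> R) (sigma : R) : R :=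
  3 / (alpha * PI) * (sin (sigma + / 3 * Hop zeta sigma) * (cos sigma / sin sigma))
  / exp (HKint zeta 0 sigma).

(* Main.v *)
Require Import Defs.
From Stdlib Require Import Reals Lra Lia List Classical ClassicalEpsilon Cantor.
From Coquelicot Require Import Coquelicot.
From mathcomp Require all_boot zify.
Open Scope R_scope.

(** Truncate the sine to [0, PI] (extended by [0]) and cap it by [(4 tan s)^(9/16)].  The resulting map
    [h |-> Hop (zeta_h)] sends functions with a fixed Hoelder-1/8 modulus to functions with the same
    modulus and is continuous in the supremum norm, so it has a fixed point by Schauder's theorem; the
    finite-dimensional approximate fixed points come from Scarf's combinatorial lemma.

    The cap is inactive: in the variable [x = tan s] the operator [PI Hop] is dominated by the integral
    operator with kernel [ln |(x + y) / (x - y)|], which maps [y^(-7/16)] to at most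
    [7 PI / 3 x^(9/16)].  As [3 / (alpha PI) <= 9/7], this gives [s + h/3 <= (4 x)^(9/16)] for
    [x <= 1/4], the linear term [s] being absorbed by the saturation of the cap at [1].  The truncation
    of the sine is inactive too: where the angle exceeds [PI] the solution vanishes, and the kernel
    is convex in its second variable off the diagonal, so the angle lies below its chord.  Finally the
    cap bounds the squared norm by [36 (3 / (alpha PI))^2 <= 81 PI / 4]. *)

(** * Scarf's lemma and approximate fixed points of maps of a cube *)

(** The unknown is [h = Hop zeta], not [zeta]. If [E] is the exponential of the primitive of [zeta]
    and [c = 3 / (alpha PI)], the equation reads [E' = c sin (s + h/3) cot s], so [zeta = E' / E] is
    explicit in [h], and the logarithmic kernel gives the equicontinuity. The obstacle is the
    cotangent: a general [h] of the class need not vanish at [0], and then [sin (s + h/3) cot s] is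
    not integrable. The cap restores integrability, and removing it is where the size of [alpha]
    enters: [sqrt PI <= 2] gives [alpha PI >= 7/3], and [(9/7) (7 PI / 3) / (3 PI) = 1], so the
    bound of [h/3] reproduces the cap with nothing to spare. The exact constant for [y^(-7/16)] is
    [(16 PI / 9) tan (9 PI / 32)], about [2.17 PI]; the larger [7 PI / 3] comes from interpolating
    the exponent [9/16] between [1/2] and [3/4], for which the integrals are elementary. Each
    singular integrand is dominated by an explicit function with a continuous primitive, so all
    integrals come from the fundamental theorem and no convergence theorem is used. *)

Module Scarf.
Import all_boot zify.
Set Implicit Arguments. Unset Strict Implicit. Unset Printing Implicit Defensive.
Local Open Scope nat_scope.

Section Scarf.
Variables (T I : finType) (rk : I -> T -> nat).
Hypothesis rk_inj : forall i, injective (rk i).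

(** The dominating pairs of Scarf's lemma: for nonempty [S], no [y] lies strictly above the minimum
    of [S] in all rankings of [C] at once. *)
Definition dom (S : {set T}) (C : {set I}) :=
  [forall y, exists i in C, forall x in S, rk i y <= rk i x].

Lemma domP (S : {set T}) (C : {set I}) :
  reflect (forall y, exists2 i, i \in C & forall x, x \in S -> rk i y <= rk i x)
          (dom S C).
Proof.
apply: (iffP forallP) => H y.
  by have /existsP[i /andP[iC /forall_inP Hi]] := H y; exists i.
have [i iC Hi] := H y; apply/existsP; exists i; rewrite iC /=.
exact/forall_inP.
Qed.

Lemma dom_sub (S S' : {set T}) (C C' : {set I}) : S' \subset S -> C \subset C' -> dom S C -> dom S' C'.
Proof.
move=> sS sC /domP H; apply/domP => y; have [i iC Hi] := H y.
by exists i; [apply: (subsetP sC) | move=> x xS; apply: Hi; apply: (subsetP sS)].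
Qed.

Definition ismin (S : {set T}) (i : I) (z : T) :=
  (z \in S) && [forall w in S, rk i z <= rk i w].

Lemma ismin_ex S i : S != set0 -> exists z, ismin S i z.
Proof.
case/set0Pn=> x0 x0S; exists [arg min_(z < x0 in S) rk i z].
case: arg_minnP => // z zS Hz; rewrite /ismin zS /=; exact/forall_inP.
Qed.

Lemma ismin_uniq S i z w : ismin S i z -> ismin S i w -> z = w.
Proof.
case/andP=> zS /forall_inP Hz /andP[wS /forall_inP Hw].
by apply: (@rk_inj i); apply/eqP; rewrite eqn_leq Hz // Hw.
Qed.

Lemma dom_ismin S C z : dom S C -> z \in S -> exists2 i, i \in C & ismin S i z.
Proof.
move=> /domP H zS; have [i iC Hi] := H z; exists i => //.
by rewrite /ismin zS /=; apply/forall_inP.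
Qed.

Definition mn (x0 : T) (S : {set T}) (i : I) := odflt x0 [pick z | ismin S i z].

Lemma mnP x0 S i : S != set0 -> ismin S i (mn x0 S i).
Proof.
move=> S0; rewrite /mn; case: pickP => //= H.
by have [z] := ismin_ex i S0; rewrite H.
Qed.

Lemma mn_imset x0 (S : {set T}) (C : {set I}) : S != set0 ->
  (forall z, z \in S -> exists2 i, i \in C & ismin S i z) -> mn x0 S @: C = S.
Proof.
move=> S0 H; apply/setP => z; apply/imsetP/idP => [[i iC ->]|zS].
  by case/andP: (mnP x0 i S0).
have [i iC Hi] := H z zS; exists i => //.
exact: ismin_uniq Hi (mnP x0 i S0).
Qed.

(** Rooms have as many indices as elements, doors one index more. A door leads into a room by
    gaining an element or by losing an index. *)
Definition room (r : {set T} * {set I}) := dom r.1 r.2 && (#|r.1| == #|r.2|).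
Definition door (d : {set T} * {set I}) := dom d.1 d.2 && (#|d.2| == #|d.1|.+1).
Definition inc (d r : {set T} * {set I}) :=
  ((r.2 == d.2) && (d.1 \subset r.1)) || ((r.1 == d.1) && (r.2 \subset d.2)).

Lemma incP d r : door d -> room r -> inc d r ->
  (exists2 x, x \notin d.1 & r = (x |: d.1, d.2)) \/
  (exists2 k, k \in d.2 & r = (d.1, d.2 :\ k)).
Proof.
case: d r => S C [S' C'] /andP[/= _ /eqP cd] /andP[/= _ /eqP cr].
rewrite /inc /= => /orP[/andP[/eqP e sS]|/andP[/eqP e sC]]; subst.
  left; have /cards1P[x ex] : #|S' :\: S| == 1.
    by rewrite cardsD (setIidPr sS) cr cd subSnn.
  exists x; first by have := set11 x; rewrite -ex inE => /andP[].
  by congr pair; rewrite -{1}(setID S' S) (setIidPr sS) setUC -ex.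
right; have /cards1P[k ek] : #|C :\: C'| == 1.
  by rewrite cardsD (setIidPr sC) -cr cd subSnn.
exists k; first by have := set11 k; rewrite -ek inE => /andP[].
by congr pair; rewrite -ek setDDr setDv set0U (setIidPr sC).
Qed.

(** * The two rooms adjacent to a door *)

Section Door.
Variables (S : {set T}) (C : {set I}).
Hypothesis dSC : door (S, C).

Definition above k y := [forall i in C :\ k, exists z in S, rk i z < rk i y].
Definition topab k x := above k x && [forall y, above k y ==> (rk k y <= rk k x)].
(** The room entered by releasing [k]. Among the elements above the minimum of [S] in all other
    rankings, the best one for [k] joins [S]; if there is none, the pair dominates without [k],
    which leaves [C]. *)
Definition nxt k : {set T} * {set I} :=
  if [pick x | topab k x] is Some x then (x |: S, C) else (S, C :\ k).
(** The indices that may be released: every element of [S] remains the minimum for some other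
    index. *)
Definition free k := (k \in C) /\
  (forall z, z \in S -> exists2 i, i \in C :\ k & ismin S i z).

Let domSC : dom S C. Proof. by case/andP: dSC. Qed.
Let cardSC : #|C| = #|S|.+1. Proof. by case/andP: dSC => _ /eqP. Qed.

Lemma not_above_all x : ~ (forall i, i \in C -> exists2 z, z \in S & rk i z < rk i x).
Proof.
move=> H; have /domP/(_ x)[i iC Hi] := domSC.
by have [z zS lt] := H i iC; have := Hi z zS; rewrite leqNgt lt.
Qed.

Lemma aboveP k y :
  reflect (forall i, i \in C :\ k -> exists2 z, z \in S & rk i z < rk i y) (above k y).
Proof.
by apply: (iffP forall_inP) => H i iC; [have /exists_inP := H i iC | apply/exists_inP; apply: H].
Qed.

Lemma free_top_notin k x : free k -> above k x -> x \notin S.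
Proof.
case=> kC H /aboveP Hx; apply/negP => xS.
have [i iC /andP[_ /forall_inP Hi]] := H x xS.
by have [z zS] := Hx i iC; rewrite ltnNge Hi.
Qed.

Lemma topab_ex k y : above k y -> exists x, topab k x.
Proof.
move=> Hy; exists [arg max_(x > y | above k x) rk k x].
case: arg_maxnP => // x Hx H; rewrite /topab Hx /=.
by apply/forallP => w; apply/implyP; apply: H.
Qed.

Lemma topab_uniq k x y : topab k x -> topab k y -> x = y.
Proof.
case/andP=> Ax /forallP Hx /andP[Ay /forallP Hy]; apply: (@rk_inj k); apply/eqP.
by rewrite eqn_leq (implyP (Hx y) Ay) (implyP (Hy x) Ax).
Qed.

Lemma not_above k y : ~~ above k y ->
  exists2 i, i \in C :\ k & forall z, z \in S -> rk i y <= rk i z.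
Proof.
rewrite negb_forall => /existsP[i]; rewrite negb_imply => /andP[iC].
rewrite negb_exists => /forallP H; exists i => // z zS.
by have := H z; rewrite zS /= -leqNgt.
Qed.

Lemma nxt_room k : free k -> room (nxt k) && inc (S, C) (nxt k).
Proof.
move=> fk; have [kC H] := fk; rewrite /nxt; case: pickP => [x|no].
  move=> tx; have [Ax /forallP mx] := andP tx.
  have xS := free_top_notin fk Ax.
  rewrite /room /inc /= eqxx subsetUr /= andbT cardsU1 xS cardSC add1n eqxx andbT.
  apply/domP => y; case: (boolP (above k y)) => Hy.
    exists k => // z; rewrite in_setU1 => /orP[/eqP->|zS]; first exact: implyP (mx y) Hy.
    have /domP/(_ y)[i iC Hi] := domSC.
    case: (eqVneq i k) => [<-|ik]; first exact: Hi.
    have /aboveP/(_ i) [|w wS lt] := Hy; first by rewrite !inE ik.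
    by have := Hi w wS; rewrite leqNgt lt.
  have [i iC Hi] := not_above Hy; exists i; first by case/setD1P: iC.
  move=> z; rewrite in_setU1 => /orP[/eqP->|]; last exact: Hi.
  by have /aboveP/(_ i iC)[w wS /ltnW lt] := Ax; apply: leq_trans (Hi w wS) lt.
rewrite /room /inc /= eqxx subD1set orbT andbT; apply/andP; split; last first.
  by have := cardSC; rewrite (cardsD1 k C) kC add1n => -[->].
apply/domP => y; case: (boolP (above k y)) => Hy; last by have := not_above Hy.
by have [x] := topab_ex Hy; rewrite no.
Qed.

(** If both releases added the same [x], it would lie above the minimum of [S] in every ranking of
    [C], against domination. Rooms of different shapes, or without different indices, are
    distinct. *)
Lemma nxt_inj k l : free k -> free l -> k != l -> nxt k != nxt l.
Proof.
move=> fk fl kl; have [kC _] := fk; have [lC _] := fl; apply/negP => /eqP.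
rewrite /nxt; case: pickP => [x tx|_]; case: pickP => [y ty|_] [].
- move=> e; have [Ax _] := andP tx; have [Ay _] := andP ty.
  have xS := free_top_notin fk Ax.
  have : x \in y |: S by rewrite -e setU11.
  rewrite in_setU1 (negPf xS) orbF => /eqP exy; rewrite -exy in Ay.
  apply: (@not_above_all x) => i iC; case: (eqVneq i k) => [ik|ik].
    by have /aboveP/(_ i) := Ay; apply; rewrite !inE ik kl ?kC.
  by have /aboveP/(_ i) := Ax; apply; rewrite !inE ik.
- by move=> _ e; move: lC; rewrite e !inE eqxx.
- by move=> _ e; move: kC; rewrite -e !inE eqxx.
- move=> e; have : k \in C :\ l by rewrite !inE kl.
  by rewrite -e !inE eqxx.
Qed.

(** If the room has gained [x], the released index is the one for which [x] is minimal. The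
    cardinalities make the map from indices to minimizers a bijection, so for every other index the
    minimum lies in [S], strictly below [x]. *)
Lemma room_nxt r : room r -> inc (S, C) r -> exists2 k, free k & r = nxt k.
Proof.
move=> Rr ir; have [[/= x xS er]|[/= k kC er]] := incP dSC Rr ir; subst r.
  case/andP: Rr => /= dR _.
  have [k kC mk] := dom_ismin dR (setU11 x S).
  have Ax : above k x.
    apply/aboveP => i iC.
    have SxC : #|x |: S| = #|C| by rewrite cardsU1 xS add1n cardSC.
    have S0 : x |: S != set0 by apply/set0Pn; exists x; rewrite setU11.
    have e := mn_imset x S0 (fun z => @dom_ismin _ _ z dR).
    have inj : {in C &, injective (mn x (x |: S))} by apply/imset_injP; rewrite e SxC.
    have ek : mn x (x |: S) k = x by apply: ismin_uniq (mnP x k S0) mk.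
    have /setD1P[ik iC'] := iC.
    have /andP[] := mnP x i S0; set w := mn _ _ i => wS /forall_inP Hw.
    have wx : w != x.
      apply/negP => /eqP ewx; move/negP: ik; apply; apply/eqP.
      by apply: inj => //; rewrite -/w ewx ek.
    exists w; first by move: wS; rewrite in_setU1 (negPf wx).
    rewrite ltn_neqAle Hw ?setU11 // andbT; apply/negP => /eqP /rk_inj ewx.
    by rewrite ewx eqxx in wx.
  have tx : topab k x.
    rewrite /topab Ax; apply/forallP => y; apply/implyP => Ay.
    have /domP/(_ y)[i iC Hi] := dR.
    case: (eqVneq i k) => [<-|ik]; first by apply: Hi; rewrite setU11.
    have /aboveP/(_ i)[|z zS lt] := Ay; first by rewrite !inE ik.
    by have := Hi z; rewrite in_setU1 zS orbT leqNgt lt => /(_ isT).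
  exists k; last first.
    by rewrite /nxt; case: pickP => [y ty|/(_ x)]; [rewrite (topab_uniq ty tx) | rewrite tx].
  split=> // z zS.
  have [i iC mi] := dom_ismin dR (setU1r x zS).
  exists i.
    rewrite !inE iC andbT; apply/negP => /eqP eik; rewrite eik in mi.
    by rewrite -(ismin_uniq mi mk) zS in xS.
  case/andP: mi => _ /forall_inP Hi; rewrite /ismin zS; apply/forall_inP => w wS.
  by apply: Hi; rewrite in_setU1 wS orbT.
case/andP: Rr => /= dR _; exists k; last first.
  rewrite /nxt; case: pickP => // x /andP[/aboveP Ax _].
  have /domP/(_ x)[i iC Hi] := dR.
  by have [z zS lt] := Ax i iC; have := Hi z zS; rewrite leqNgt lt.
by split=> // z zS; apply: dom_ismin.
Qed.

(** Sending an index to the minimizer of its ranking maps [C] onto [S], and [C] has one element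
    more. Hence exactly one value is taken twice, and the two colliding indices are the free
    ones. *)
Lemma free_pair : S != set0 ->
  exists a b, [/\ a != b, free a, free b & forall k, free k -> k = a \/ k = b].
Proof.
move=> S0; have /set0Pn[x0 _] := S0.
have e := mn_imset x0 S0 (fun z => @dom_ismin _ _ z domSC).
have : ~~ [forall a in C, forall b in C, (mn x0 S a == mn x0 S b) ==> (a == b)].
  apply/negP => /forall_inP H.
  have inj : {in C &, injective (mn x0 S)}.
    move=> a b aC bC eab; have /forall_inP/(_ b bC) := H a aC.
    by rewrite eab eqxx => /eqP.
  by have := card_in_imset inj; rewrite e cardSC => /eqP; rewrite ltn_eqF.
rewrite negb_forall => /existsP[a]; rewrite negb_imply => /andP[aC].
rewrite negb_forall => /existsP[b]; rewrite !negb_imply => /and3P[bC /eqP eab ab].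
have fr k l : k \in C -> l \in C -> k != l -> mn x0 S k = mn x0 S l -> free k.
  move=> kC lC kl ekl; split=> // z; rewrite -{1}e => /imsetP[i iC ->].
  case: (eqVneq i k) => [->|ik]; last first.
    by exists i; [rewrite !inE ik | apply: mnP].
  by exists l; [rewrite !inE eq_sym kl | rewrite ekl; apply: mnP].
exists a, b; split=> //; [exact: fr aC bC ab eab | by apply: (fr b a); rewrite // eq_sym |].
move=> k [kC Hk]; case: (eqVneq k a) => [|ka]; [by left | right].
apply/eqP/negPn/negP => kb.
have ek := mn_imset x0 S0 Hk.
have inj : {in C :\ k &, injective (mn x0 S)}.
  apply/imset_injP; rewrite ek.
  by have := cardSC; rewrite (cardsD1 k C) kC add1n => -[->].
by move/negP: ab; apply; apply/eqP/inj; rewrite // !inE eq_sym ?ka ?kb.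
Qed.

Lemma card_rooms : S != set0 -> #|[set r | room r & inc (S, C) r]| = 2.
Proof.
case/free_pair=> a [b [ab fa fb H]].
suff -> : [set r | room r & inc (S, C) r] = [set nxt a; nxt b].
  by rewrite cards2 (nxt_inj fa fb ab).
apply/setP => r; rewrite !inE; apply/idP/idP => [/andP[Rr ir]|/orP[]/eqP->].
- by have [k fk ->] := room_nxt Rr ir; case: (H k fk) => ->; rewrite eqxx ?orbT.
- exact: nxt_room.
- exact: nxt_room.
Qed.
End Door.

(** * Coloured doors and the parity count *)

Variables (c : T -> I) (i0 : I) (t0 : T).

Definition typed (d : {set T} * {set I}) :=
  [&& door d, i0 \in d.2 & c @: d.1 == d.2 :\ i0].

Lemma card_rooms0 : #|[set r | room r & inc (set0, [set i0]) r]| = 1.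
Proof.
pose m := [arg max_(x > t0) rk i0 x].
have Hm y : rk i0 y <= rk i0 m by rewrite /m; case: arg_maxnP => // x _; apply.
have d0 : door (set0, [set i0]).
  rewrite /door /= cards0 cards1 eqxx andbT; apply/domP => y.
  by exists i0; [rewrite set11 | move=> x; rewrite inE].
suff -> : [set r | room r & inc (set0, [set i0]) r] = [set ([set m], [set i0])].
  by rewrite cards1.
apply/setP => r; rewrite !inE; apply/idP/eqP => [/andP[Rr ir]|->].
  have [[/= x _ er]|[/= k]] := incP d0 Rr ir.
    rewrite setU0 in er; subst r; congr ([set _], _).
    case/andP: Rr => /= /domP/(_ m)[i]; rewrite inE => /eqP-> H _.
    by apply: (@rk_inj i0); apply/eqP; rewrite eqn_leq Hm H ?set11.
  rewrite inE => /eqP-> er; subst r; case/andP: Rr => /= /domP/(_ t0)[i].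
  by rewrite setDv inE.
rewrite /room /inc /= !cards1 !eqxx sub0set !andbT /=.
by apply/domP => y; exists i0; rewrite ?set11 // => x; rewrite inE => /eqP->.
Qed.

Lemma typed_card d : typed d -> #|d.2| = #|d.1|.+1 /\ {in d.1 &, injective c}.
Proof.
case/and3P=> /andP[_ /eqP cd] i0d /eqP ec; split=> //; apply/imset_injP; rewrite ec.
by rewrite (cardsD1 i0) i0d add1n in cd; case: cd => ->.
Qed.

(** Either no door is typed, or exactly two are. In the second case some [x] can be removed so that
    the other elements carry each colour of [C] except [i0] once. If [c x] is in [C], another [x']
    has the same colour and the doors omit [x] or [x']; otherwise one door omits [x] and the other
    adds the index [c x]. *)
Lemma card_typed r : room r -> c @: r.1 != r.2 ->
  ~~ odd #|[set d | typed d & inc d r]|.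
Proof.
case: r => S C Rr /= nc; have /andP[/= dSC /eqP cSC] := Rr.
have remdoor x : x \in S -> door (S :\ x, C).
  move=> xS; rewrite /door /= (dom_sub (subD1set S x) (subxx C) dSC) /=.
  by rewrite -cSC (cardsD1 x S) xS.
have adddoor j : j \notin C -> door (S, j |: C).
  move=> jC; rewrite /door /= (dom_sub (subxx S) (subsetUr [set j] C) dSC) /=.
  by rewrite cardsU1 jC cSC.
have shape d : typed d -> inc d (S, C) ->
   (exists2 x, x \in S & d = (S :\ x, C)) \/ (exists2 j, j \notin C & d = (S, j |: C)).
  move=> td id; case/and3P: (td) => dd _ _.
  case: (incP dd Rr id) => [[x xd [eS eC]]|[k kd [eS eC]]].
    left; exists x; first by rewrite eS setU11.
    by case: d xd eS eC {td id dd} => /= S' C' xd -> ->; rewrite setU1K.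
  right; exists k; first by rewrite eC !inE eqxx.
  by case: d kd eS eC {td id dd} => /= S' C' kd -> ->; rewrite setD1K.
have incr x : inc (S :\ x, C) (S, C) by rewrite /inc /= eqxx subD1set.
have inca j : inc (S, j |: C) (S, C) by rewrite /inc /= eqxx subsetUr orbT.
case: (boolP [exists d, typed d && inc d (S, C)]) => [/existsP[d0 /andP[td0 id0]]|no]; last first.
  rewrite (_ : [set d | _] = set0) ?cards0 //; apply/setP => d; rewrite !inE.
  by apply/negP => H; case/negP: no; apply/existsP; exists d.
(* Both shapes of a typed door reduce to this normal form: for a door with an added index [j],
   remove an element of colour [j]. *)
have [x [xS tx i0C eCx ix]] : exists x, [/\ x \in S, typed (S :\ x, C), i0 \in C,
     c @: (S :\ x) = C :\ i0 & c x != i0].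
  have fin x : x \in S -> typed (S :\ x, C) -> exists x, [/\ x \in S, typed (S :\ x, C), i0 \in C,
     c @: (S :\ x) = C :\ i0 & c x != i0].
    move=> xS tx; case/and3P: (tx) => /= _ i0C /eqP e; exists x; split=> //.
    apply/negP => /eqP ex; move/negP: nc; apply.
    by rewrite -(setD1K xS) imsetU1 e ex setD1K.
  case: (shape _ td0 id0) => [[x xS ed]|[j jC ed]]; subst d0; first exact: (fin x).
  case/and3P: td0 => /= _; rewrite !inE => i0C /eqP e.
  have ij : i0 != j.
    by apply/negP => /eqP eij; move/negP: nc; apply; rewrite e eij setU1K.
  have i0C' : i0 \in C by case/orP: i0C => // /eqP /esym E; rewrite E eqxx in ij.
  have : j \in c @: S by rewrite e !inE eq_sym ij eqxx.
  case/imsetP=> x xS ex; apply: (fin x xS); apply/and3P; split=> //=; first exact: remdoor.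
  have inj : {in S &, injective c}.
    apply/imset_injP; rewrite e cSC.
    have -> : #|C| = #|C :\ i0|.+1 by rewrite (cardsD1 i0 C) i0C'.
    rewrite (_ : (j |: C) :\ i0 = j |: (C :\ i0)); first by rewrite cardsU1 !inE (negPf jC) andbF.
    by apply/setP=> z; rewrite !inE; case: (eqVneq z j) => [->|]; rewrite ?andbT //= eq_sym ij.
  apply/eqP/setP => z; rewrite !inE; apply/imsetP/idP => [[y]|/andP[zi zC]].
    rewrite !inE => /andP[yx yS] ez.
    have : z \in c @: S by rewrite ez imset_f.
    rewrite e !inE => /andP[-> /orP[/eqP ezj|//]].
    by move/negP: yx; case; apply/eqP/inj; rewrite // -ex -ez ezj.
  have : z \in c @: S by rewrite e !inE zi zC orbT.
  case/imsetP=> y yS ez; exists y => //; rewrite !inE yS andbT.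
  by apply/negP => /eqP eyx; rewrite ez eyx -ex (negPf jC) in zC.
have [_ injx] := typed_card tx; rewrite /= in injx.
case: (boolP (c x \in C)) => cxC.
  have : c x \in c @: (S :\ x) by rewrite eCx !inE ix.
  case/imsetP=> x' x'S ex'; have /setD1P[x'x x'S'] := x'S.
  have tx' : typed (S :\ x', C).
    apply/and3P; split=> //=; first exact: remdoor.
    rewrite -eCx; apply/eqP/setP => z; apply/imsetP/imsetP => [[y]|[y]].
      rewrite !inE => /andP[yx' yS] ->; case: (eqVneq y x) => [->|yx]; first by exists x'.
      by exists y; rewrite // !inE yx.
    rewrite !inE => /andP[yx yS] ->; case: (eqVneq y x') => [->|yx'].
      by exists x; rewrite // !inE eq_sym x'x.
    by exists y; rewrite // !inE yx'.
  rewrite (_ : [set d | _] = [set (S :\ x, C); (S :\ x', C)]).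
    rewrite cards2; case: eqP => // -[] /setP/(_ x).
    by rewrite !inE eqxx xS eq_sym x'x.
  apply/setP => d; rewrite !inE; apply/idP/idP => [/andP[td id]|/orP[]/eqP->]; last first.
  - by rewrite tx' incr.
  - by rewrite tx incr.
  case: (shape _ td id) => [[y yS ed]|[j jC ed]]; subst d.
    case: (eqVneq y x) => [->|yx]; first by rewrite eqxx.
    case: (eqVneq y x') => [->|yx']; first by rewrite eqxx orbT.
    have [_ injy] := typed_card td; rewrite /= in injy.
    case/eqP: x'x; apply: injy; rewrite ?inE ?[x' == _]eq_sym ?[x == _]eq_sym ?yx ?yx' //.
  case/and3P: td => /= _ _ /eqP e.
  have : j \in c @: S.
    rewrite e !inE eqxx andbT; apply/negP => /eqP ej; by rewrite ej i0C in jC.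
  case/imsetP=> y yS ej; move: jC; rewrite ej.
  case: (eqVneq y x) => [->|yx]; first by rewrite cxC.
  have : c y \in C :\ i0 by rewrite -eCx imset_f // !inE yx.
  by case/setD1P=> _ ->.
have ta : typed (S, c x |: C).
  apply/and3P; split=> /=; [exact: adddoor | by rewrite !inE i0C orbT |].
  rewrite -(setD1K xS) imsetU1 eCx; apply/eqP/setP => z; rewrite !inE.
  by case: (eqVneq z (c x)) => [->|] //=; rewrite ix.
rewrite (_ : [set d | _] = [set (S :\ x, C); (S, c x |: C)]).
  rewrite cards2; case: eqP => // -[] /setP/(_ x).
  by rewrite !inE eqxx xS.
apply/setP => d; rewrite !inE; apply/idP/idP => [/andP[td id]|/orP[]/eqP->]; last first.
- by rewrite ta inca.
- by rewrite tx incr.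
case: (shape _ td id) => [[y yS ed]|[j jC ed]]; subst d.
  case: (eqVneq y x) => [->|yx]; first by rewrite eqxx.
  case/and3P: td => /= _ _ /eqP e.
  have : c x \in C :\ i0 by rewrite -e imset_f // !inE eq_sym yx.
  by rewrite inE (negPf cxC) andbF.
case: (eqVneq j (c x)) => [->|jx]; first by rewrite eqxx orbT.
case/and3P: td => /= _ _ /eqP e.
have : j \in c @: S.
  rewrite e !inE eqxx andbT; apply/negP => /eqP ej; by rewrite ej i0C in jC.
case/imsetP=> y yS ej.
have yx : y != x by apply/negP => /eqP eyx; rewrite ej eyx eqxx in jx.
have : c y \in C :\ i0 by rewrite -eCx imset_f // !inE yx.
by rewrite -ej inE (negPf jC) andbF.
Qed.

Lemma odd_sum (A : finType) (P : pred A) (F : A -> nat) :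
  (forall a, P a -> ~~ odd (F a)) -> ~~ odd (\sum_(a | P a) F a).
Proof.
by move=> H; elim/big_rec: _ => // a n Pa; rewrite oddD (negPf (H a Pa)).
Qed.

(* Double counting of incidences: a typed door lies in exactly two rooms, except
   [(set0, [set i0])] which lies in one, while a room that is not colourful has
   an even number of typed doors. *)
Theorem scarf : exists S C, dom S C /\ c @: S = C.
Proof.
pose cf := [exists r, room r && (c @: r.1 == r.2)].
case: (boolP cf) => [/existsP[[S C] /andP[/andP[/= d _] /eqP e]]|no].
  by exists S, C.
exfalso.
have eqs : \sum_(d | typed d) #|[set r | room r & inc d r]| =
           \sum_(r | room r) #|[set d | typed d & inc d r]|.
  under eq_bigr => d _ do rewrite -sum1dep_card big_mkcondr.
  rewrite exchange_big /=; apply: eq_bigr => r _.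
  by rewrite -big_mkcondr sum1dep_card.
have ev : ~~ odd (\sum_(r | room r) #|[set d | typed d & inc d r]|).
  apply: odd_sum => r Rr; apply: card_typed => //; apply/negP => e.
  by case/negP: no; apply/existsP; exists r; rewrite Rr.
case/negP: ev; rewrite -eqs.
have t0d : typed (set0, [set i0]).
  rewrite /typed /door /= cards0 cards1 set11 imset0 setDv !eqxx !andbT.
  by apply/domP => y; exists i0; [rewrite set11 | move=> x; rewrite inE].
rewrite (bigD1 (set0, [set i0])) //= card_rooms0 oddD /=.
apply: odd_sum => -[S C] /andP[td nd]; case/and3P: (td) => dd i0C /eqP /= e.
rewrite card_rooms //; apply/negP => /eqP eS; case/negP: nd.
rewrite /= in i0C; rewrite eS imset0 in e *.
by rewrite xpair_eqE eqxx /= -(setD1K i0C) -e setU0.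
Qed.
End Scarf.

(** * Colourings of the grid points of a simplex *)

Section Grid.
Variables n m : nat.
Definition grid := {x : {ffun 'I_n.+1 -> 'I_m.+1} | \sum_i x i == m}.

Lemma grid_mk (y : 'I_n.+1 -> nat) : \sum_i y i = m ->
  exists x : grid, forall i, sval x i = y i :> nat.
Proof.
move=> sy; have ly i : y i < m.+1 by rewrite ltnS -sy (bigD1 i) //= leq_addr.
have H : \sum_i [ffun i => Ordinal (ly i)] i == m.
  by rewrite -[X in _ == X]sy; apply/eqP/eq_bigr => i _; rewrite ffunE.
by exists (exist (fun x : {ffun 'I_n.+1 -> 'I_m.+1} => is_true (\sum_i x i == m)) _ H) => i; rewrite /= ffunE.
Qed.

(** Grid points are ranked by each coordinate, ties being broken by an enumeration. The set given by
    Scarf's lemma is clustered: its coordinate minima over [C] add up to at least [m - n], which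
    leaves at most [n] for the deviations and for the coordinates outside [C]. *)
Lemma grid_colouring (c : grid -> 'I_n.+1) :
  exists (C : {set 'I_n.+1}) (b : grid),
    (forall i, i \in C -> exists x : grid, c x = i /\
       forall j, sval x j <= sval b j + n /\ sval b j <= sval x j + n) /\
    (forall i, i \notin C -> sval b i <= n).
Proof.
have [t0 _] : exists x : grid, forall i, sval x i = (if i == ord0 then m else 0) :> nat.
  apply: grid_mk; rewrite (bigD1 ord0) //= big1 ?addn0 // => i /negPf-> //.
pose rk (i : 'I_n.+1) (x : grid) := sval x i * #|{: grid}| + enum_rank x.
have rk_inj i : injective (rk i).
  move=> x y; rewrite /rk => e; apply: enum_rank_inj; apply: val_inj.
  have := congr1 (modn^~ #|{: grid}|) e.
  by rewrite !modnMDl !modn_small.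
have rk_le i (x y : grid) : rk i x <= rk i y -> sval x i <= sval y i.
  rewrite leqNgt; apply: contraR; rewrite -ltnNge => lt; rewrite /rk.
  apply: (@leq_trans ((sval y i).+1 * #|{: grid}|)).
    by rewrite mulSn addnC ltn_add2r ltn_ord.
  by apply: leq_trans (leq_addr _ _); rewrite leq_mul2r lt orbT.
have [S [C [dSC eC]]] := @scarf _ _ rk rk_inj c ord0 t0.
have [k kC _] := elimT (domP _ _ _) dSC t0.
have [b bS _] : exists2 b, b \in S & k = c b by apply/imsetP; rewrite eC.
have S0 : S != set0 by apply/set0Pn; exists b.
pose mi i := nat_of_ord (sval (mn rk t0 S i) i).
have miP i x : x \in S -> mi i <= sval x i.
  move=> xS; apply: rk_le; have /andP[_ /forall_inP] := mnP rk t0 i S0; exact.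
(* Otherwise the minima over [C] can all be raised by one, the remainder being placed on the
   coordinate [k]; the resulting grid point contradicts domination. *)
have big : m < \sum_(i in C) (mi i).+1.
  rewrite ltnNge; apply/negP => le.
  have [y Hy] : exists y : grid, forall i, sval y i =
     (if i \in C then (mi i).+1 else 0) + (if i == k then m - \sum_(i in C) (mi i).+1 else 0) :> nat.
    apply: grid_mk; rewrite big_split /= -big_mkcond /= -big_mkcond /= big_pred1_eq.
    exact: subnKC.
  have [i iC Hi] := elimT (domP _ _ _) dSC y.
  have mS : mn rk t0 S i \in S by case/andP: (mnP rk t0 i S0).
  have := rk_le i _ _ (Hi _ mS); rewrite Hy iC -/(mi i); lia.
have cC : #|C| <= n.+1 by have := max_card (mem C); rewrite card_ord.
have big' : m <= \sum_(i in C) mi i + n.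
  move: big; under eq_bigr => i _ do rewrite -addn1.
  rewrite big_split /= sum1_card; lia.
have sx (x : grid) : \sum_(i in C) sval x i + \sum_(i | i \notin C) sval x i = m.
  by have /eqP := svalP x; rewrite (bigID (mem C)).
have ar1 a d A B s : A <= B -> m <= a + A + n -> d + B + s = m -> d <= a + n by lia.
have ar2 d A B s : m <= A + n -> A <= B -> B + (d + s) = m -> d <= n by lia.
have ar3 w u v : w <= u -> w <= v -> u <= w + n -> v <= w + n -> u <= v + n /\ v <= u + n.
  by lia.
have inC x i : x \in S -> i \in C -> sval x i <= mi i + n.
  move=> xS iC; have := sx x; move: big'.
  rewrite [X in m <= X + n -> _](bigD1 i) //= [X in _ -> X + _ = m -> _](bigD1 i) //=.
  have : \sum_(j in C | j != i) mi j <= \sum_(j in C | j != i) sval x j.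
    by apply: leq_sum => j _; apply: miP.
  by apply: ar1.
have outC x i : x \in S -> i \notin C -> sval x i <= n.
  move=> xS iC; have := sx x; rewrite [X in _ + X = m -> _](bigD1 i) //=.
  have : \sum_(j in C) mi j <= \sum_(j in C) sval x j.
    by apply: leq_sum => j _; apply: miP.
  by move: big'; apply: ar2.
exists C, b; split=> [i iC|i iC]; last exact: outC.
have [x xS ex] : exists2 x, x \in S & i = c x by apply/imsetP; rewrite eC.
exists x; split=> // j; case: (boolP (j \in C)) => jC.
  exact: ar3 (miP j _ xS) (miP j _ bS) (inC _ _ xS jC) (inC _ _ bS jC).
exact: (ar3 0 _ _ _ _ (outC _ _ xS jC) (outC _ _ bS jC)).
Qed.
End Grid.

Local Open Scope R_scope.

(** * Approximate fixed points on the simplex and on the cube *)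

Lemma sum_f_R0_bigop (g : nat -> nat) n :
  INR (\sum_(i < n.+1) g i) = sum_f_R0 (fun i => INR (g i)) n.
Proof.
elim: n => [|n IH]; first by rewrite big_ord_recl big_ord0 addn0.
by rewrite big_ord_recr /= -plusE plus_INR IH.
Qed.

Lemma sum_f_R0_opp (D : nat -> R) n : sum_f_R0 (fun i => - D i) n = - sum_f_R0 D n.
Proof. by elim: n => //= n ->; ring. Qed.

Lemma sum_f_R0_ge (D : nat -> R) (e : R) n :
  (forall i, (i <= n)%coq_nat -> - e <= D i) -> - (INR n + 1) * e <= sum_f_R0 D n.
Proof.
elim: n => [|n IH] H; first by have := H 0%N (Nat.le_refl _); simpl; lra.
have h1 := H n.+1 (Nat.le_refl _).
have h2 : - (INR n + 1) * e <= sum_f_R0 D n by apply: IH => i Hi; apply: H; lia.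
rewrite S_INR; simpl; lra.
Qed.

Lemma sum_f_R0_term_le (D : nat -> R) (e : R) n :
  (forall i, (i <= n)%coq_nat -> - e <= D i) ->
  forall i, (i <= n)%coq_nat -> D i <= sum_f_R0 D n + INR n * e.
Proof.
elim: n => [|n IH] H i Hi.
  by have -> : i = 0%N; [lia | simpl; lra].
have h1 := H n.+1 (Nat.le_refl _).
have H' : forall i, (i <= n)%coq_nat -> - e <= D i by move=> j Hj; apply: H; lia.
rewrite S_INR; case: (Nat.eq_dec i n.+1) => [->|ni].
  have := sum_f_R0_ge H'; simpl; lra.
have : D i <= sum_f_R0 D n + INR n * e by apply: IH => //; lia.
simpl; lra.
Qed.

Lemma sum_f_R0_dist (u v : nat -> R) (e : R) n :
  (forall i, (i <= n)%coq_nat -> Rabs (u i - v i) <= e) ->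
  Rabs (sum_f_R0 u n - sum_f_R0 v n) <= (INR n + 1) * e.
Proof.
elim: n => [|n IH] H; first by have := H 0%N (Nat.le_refl _); simpl; lra.
have h1 := H n.+1 (Nat.le_refl _).
have h2 : Rabs (sum_f_R0 u n - sum_f_R0 v n) <= (INR n + 1) * e.
  by apply: IH => i Hi; apply: H; lia.
rewrite S_INR [sum_f_R0 u _]/= [sum_f_R0 v _]/=.
have -> : sum_f_R0 u n + u n.+1 - (sum_f_R0 v n + v n.+1)
        = (sum_f_R0 u n - sum_f_R0 v n) + (u n.+1 - v n.+1) by ring.
have := Rabs_triang (sum_f_R0 u n - sum_f_R0 v n) (u n.+1 - v n.+1); lra.
Qed.

(* [F] is a self-map of the standard simplex, evaluated at the grid points [x / m]. *)
Lemma simplex_approx_fixed_point (n m : nat) (F : (nat -> R) -> nat -> R) (e : R) :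
  (0 < m)%coq_nat -> 0 < e ->
  (forall v i, (i <= n)%coq_nat -> 0 <= F v i) ->
  (forall v, sum_f_R0 (F v) n = 1) ->
  (forall v w, (forall i, (i <= n)%coq_nat -> Rabs (v i - w i) <= INR n / INR m) ->
     forall i, (i <= n)%coq_nat -> Rabs (F v i - F w i) <= e) ->
  exists v, (forall i, (i <= n)%coq_nat -> 0 <= v i) /\
    forall i, (i <= n)%coq_nat -> Rabs (F v i - v i) <= (INR n + 1) * (INR n / INR m + e).
Proof.
move=> m0 e0 F0 F1 Fc.
have m0' : 0 < INR m by apply: lt_0_INR.
pose pt (x : grid n m) (i : nat) : R := INR (sval x (inord i)) / INR m.
have pt0 x i : 0 <= pt x i by apply: Rdiv_le_0_compat => //; apply: pos_INR.
have pt1 x : sum_f_R0 (pt x) n = 1.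
  have : INR (\sum_(i < n.+1) sval x (inord i)) = INR m.
    by congr INR; have /eqP := svalP x; under eq_bigr => i _ do rewrite -{1}[i]inord_val.
  rewrite (sum_f_R0_bigop (fun i => nat_of_ord (sval x (inord i)))) => E.
  have -> : sum_f_R0 (pt x) n = / INR m * sum_f_R0 (fun i => INR (sval x (inord i))) n.
    by rewrite scal_sum.
  rewrite E; field; lra.
have zero x : sum_f_R0 (fun i => F (pt x) i - pt x i) n = 0.
  by rewrite minus_sum F1 pt1; ring.
(* A point is coloured by a coordinate that [F] does not decrease. One exists because [F (pt x)] and
   [pt x] have the same coordinate sum. *)
have ex x : exists i : 'I_n.+1, pt x i <= F (pt x) i.
  apply: NNPP => no.
  have H i : (i <= n)%coq_nat -> F (pt x) i < pt x i.
    move=> Hi; apply: Rnot_le_lt => le; apply: no; exists (inord i).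
    by rewrite inordK //; apply/leP; lia.
  have E : sum_f_R0 (fun i => pt x i - F (pt x) i) n = 0.
    have := zero x; rewrite !minus_sum; lra.
  have := @sum_f_R0_term_le (fun i => pt x i - F (pt x) i) 0 n.
  rewrite E => /(_ _ 0%N (Nat.le_0_l n)) h.
  have := H 0%N (Nat.le_0_l n).
  have : pt x 0%N - F (pt x) 0%N <= 0 + INR n * 0.
    by apply: h => i /H; lra.
  lra.
pose c x := proj1_sig (constructive_indefinite_description _ (ex x)).
have cP x : pt x (c x) <= F (pt x) (c x) by rewrite /c; case: constructive_indefinite_description.
have [C [b [HC HnC]]] := grid_colouring c.
(* For [i] in [C] the bound is carried over from a nearby point of colour [i]; otherwise [pt b i]
   itself is small. As the increments add up to zero, these lower bounds also yield the upper
   bounds. *)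
have low i : (i <= n)%coq_nat -> - (INR n / INR m + e) <= F (pt b) i - pt b i.
  move=> Hi; have Hi' : (i < n.+1)%N by apply/leP; lia.
  case: (boolP (inord i \in C)) => iC.
    have [x [cx Hx]] := HC _ iC.
    have dist j : Rabs (pt x j - pt b j) <= INR n / INR m.
      have [/leP h1 /leP h2] := Hx (inord j).
      rewrite /pt -RIneq.Rdiv_minus_distr Rabs_div; last lra.
      rewrite [Rabs (INR m)]Rabs_pos_eq; last lra.
      apply: Rmult_le_compat_r; first by apply: Rlt_le; apply: Rinv_0_lt_compat.
      move: (le_INR _ _ h1) (le_INR _ _ h2); rewrite !(plus_INR _ n) => k1 k2.
      by apply: Rabs_le; lra.
    have := Fc _ _ (fun j _ => dist j) i Hi; have := cP x; rewrite cx inordK //.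
    have := dist i; move=> /Rabs_le_between d1 d2 /Rabs_le_between d3; lra.
  have /leP/le_INR h := HnC _ iC.
  have : pt b i <= INR n / INR m.
    by apply: Rmult_le_compat_r => //; apply: Rlt_le; apply: Rinv_0_lt_compat.
  have := F0 (pt b) i Hi; lra.
exists (pt b); split=> // i Hi.
have := sum_f_R0_term_le low Hi; rewrite zero => h1; have h2 := low i Hi.
have : 0 <= INR n / INR m by apply: Rdiv_le_0_compat => //; apply: pos_INR.
have := pos_INR n => h3 h4.
apply: Rabs_le; nra.
Qed.

(** The cube shrunk by its dimension lies in the simplex, with one more coordinate taking up the
    slack, and [P] rescales and retracts onto the unit cube. As [G] takes its values in the unit
    cube, the 1-Lipschitz retraction preserves the approximate fixed point. *)
Lemma cube_approx_fixed_point (n : nat) (G : (nat -> R) -> nat -> R) :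
  (forall v i, (i < n)%coq_nat -> 0 <= G v i <= 1) ->
  (forall eps, 0 < eps -> exists2 del, 0 < del & forall v w,
     (forall i, (i < n)%coq_nat -> Rabs (v i - w i) <= del) ->
     forall i, (i < n)%coq_nat -> Rabs (G v i - G w i) <= eps) ->
  forall eta, 0 < eta -> exists v, (forall i, (i < n)%coq_nat -> 0 <= v i <= 1) /\
     forall i, (i < n)%coq_nat -> Rabs (G v i - v i) <= eta.
Proof.
case: n => [|n] G01 Gc eta eta0; first by exists (fun=> 0); split=> i; lia.
have N0 : 0 < INR n.+1 by apply: lt_0_INR; lia.
(* Rescaling costs a factor [INR n.+1], the simplex bound a factor [INR n.+1 + 1], and the two error
   terms there are at most [e] each. *)
pose e := eta / (INR n.+1 * (INR n.+1 + 1)) / 2.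
have e0 : 0 < e by rewrite /e; apply: Rdiv_lt_0_compat; [apply: Rdiv_lt_0_compat => //; nra | lra].
have [del del0 Hdel] := Gc (e / (INR n.+1)) (Rdiv_lt_0_compat _ _ e0 N0).
pose clamp (t : R) := Rmin 1 (Rmax 0 t).
have clamp_dist s t : Rabs (clamp s - clamp t) <= Rabs (s - t).
  unfold clamp, Rmin, Rmax, Rabs.
  by repeat destruct Rle_dec; repeat destruct Rcase_abs; lra.
pose P (v : nat -> R) (i : nat) := clamp (INR n.+1 * v i).
pose F v i := if (i < n.+1)%N then G (P v) i / INR n.+1
              else 1 - sum_f_R0 (fun j => G (P v) j / INR n.+1) n.
have bnd v i : (i <= n)%coq_nat -> 0 <= G (P v) i / INR n.+1 <= / INR n.+1.
  move=> Hi; have [h1 h2] : 0 <= G (P v) i <= 1 by apply: G01; lia.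
  have := Rinv_0_lt_compat _ N0; rewrite /Rdiv; nra.
have Flo v i : (i <= n)%coq_nat -> F v i = G (P v) i / INR n.+1.
  by move=> Hi; rewrite /F; have -> : (i < n.+1)%N by apply/leP; lia.
have Fhi v : F v n.+1 = 1 - sum_f_R0 (fun j => G (P v) j / INR n.+1) n by rewrite /F ltnn.
have [m m1 m2] : exists2 m, (0 < m)%coq_nat & INR n.+1 * (INR n.+1 / INR m) <= del /\ INR n.+1 / INR m <= e.
  have M0 : 0 < Rmin (del / INR n.+1) e by apply: Rmin_glb_lt => //; apply: Rdiv_lt_0_compat.
  have [m [h1 h2]] := archimed_cor1 (Rmin (del / INR n.+1) e / INR n.+1) (Rdiv_lt_0_compat _ _ M0 N0).
  exists m => //; have : INR n.+1 / INR m <= Rmin (del / INR n.+1) e.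
    have : INR n.+1 * / INR m < INR n.+1 * (Rmin (del / INR n.+1) e / INR n.+1) by apply: Rmult_lt_compat_l.
    move=> h; apply: Rlt_le; apply: Rlt_le_trans h _; right; field; lra.
  move=> h; have := Rmin_l (del / INR n.+1) e; have := Rmin_r (del / INR n.+1) e; split; last lra.
  apply: Rle_trans (Rmult_le_compat_l _ _ (del / INR n.+1) _ _) _; [lra|lra|right; field; lra].
have [v [v0 vF]] : exists v, (forall i, (i <= n.+1)%coq_nat -> 0 <= v i) /\
    forall i, (i <= n.+1)%coq_nat -> Rabs (F v i - v i) <= (INR n.+1 + 1) * (INR n.+1 / INR m + e).
  apply: simplex_approx_fixed_point => //.
  - move=> v i Hi; case: (Nat.eq_dec i n.+1) => [->|ni].
      rewrite Fhi; have := @sum_f_R0_ge (fun j => - (G (P v) j / INR n.+1)) (/ INR n.+1) n.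
      have -> : sum_f_R0 (fun j => - (G (P v) j / INR n.+1)) n = - sum_f_R0 (fun j => G (P v) j / INR n.+1) n.
        exact: sum_f_R0_opp.
      rewrite -S_INR => h; have : - INR n.+1 * / INR n.+1 <= - sum_f_R0 (fun j : nat => G (P v) j / INR n.+1) n.
        by apply: h => j Hj; have := bnd v j Hj; lra.
      have -> : - INR n.+1 * / INR n.+1 = -1 by field; lra.
      lra.
    by rewrite Flo; [apply: (proj1 (bnd v i _)); lia | lia].
  - move=> v; rewrite [sum_f_R0 _ _]/= Fhi.
    rewrite (PartSum.sum_eq (F v) (fun j => G (P v) j / INR n.+1)); first ring.
    exact: Flo.
  - move=> v w Hvw.
    have d j : (j <= n)%coq_nat -> Rabs (G (P v) j / INR n.+1 - G (P w) j / INR n.+1) <= e / INR n.+1.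
      move=> Hj; rewrite -RIneq.Rdiv_minus_distr Rabs_div; last lra.
      rewrite [Rabs (INR _)]Rabs_pos_eq; last lra.
      apply: Rmult_le_compat_r; first by apply: Rlt_le; apply: Rinv_0_lt_compat.
      apply: Rle_trans (Hdel _ _ _ j _) _; [|lia|].
        move=> i Hi; apply: Rle_trans (clamp_dist _ _) _.
        rewrite -Rmult_minus_distr_l Rabs_mult Rabs_pos_eq; last lra.
        apply: Rle_trans (Rmult_le_compat_l _ _ _ _ (Hvw i _)) (proj1 m2); [lra | lia].
      rewrite -[X in _ <= X]Rmult_1_r; apply: Rmult_le_compat_l; first lra.
      rewrite -Rinv_1; apply: Rinv_le_contravar; first lra.
      by rewrite S_INR; have := pos_INR n; lra.
    have one : 1 <= INR n.+1 by rewrite S_INR; have := pos_INR n; lra.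
    move=> i Hi; case: (Nat.eq_dec i n.+1) => [->|ni].
      rewrite !Fhi; have := sum_f_R0_dist d; rewrite -S_INR.
      have -> : INR n.+1 * (e / INR n.+1) = e by field; lra.
      rewrite Rabs_minus_sym; congr (Rabs _ <= _); ring.
    rewrite !Flo; try lia.
    apply: Rle_trans (d i _) _; first lia.
    rewrite -[X in _ <= X]Rmult_1_r; apply: Rmult_le_compat_l; first lra.
    by rewrite -Rinv_1; apply: Rinv_le_contravar; lra.
exists (P v); split=> i Hi.
  rewrite /P /clamp; split; last exact: Rmin_l.
  by apply: Rmin_glb; [lra | exact: Rmax_l].
have [Hi1 Hi2] : (i <= n)%coq_nat /\ (i <= n.+1)%coq_nat by lia.
have : Rabs (G (P v) i - INR n.+1 * v i) <= eta.
  have := vF i Hi2; rewrite Flo // => h.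
  have -> : G (P v) i - INR n.+1 * v i = INR n.+1 * (G (P v) i / INR n.+1 - v i) by field; lra.
  rewrite Rabs_mult Rabs_pos_eq; last lra.
  apply: Rle_trans (Rmult_le_compat_l _ _ _ _ h) _; first lra.
  apply: Rle_trans (Rmult_le_compat_l _ _ _ _ (Rmult_le_compat_l _ _ (e + e) _ _)) _; try lra.
  by right; rewrite /e; field; lra.
have [g0 g1] := G01 (P v) i Hi.
rewrite {3}/P.
have -> : G (P v) i = clamp (G (P v) i).
  by rewrite /clamp Rmax_right // Rmin_right.
move=> h; apply: Rle_trans (clamp_dist _ _) _.
by rewrite {1}/clamp Rmax_right // Rmin_right // in h *.
Qed.

End Scarf.

(** * A Schauder fixed point theorem for moduli of continuity *)

Fixpoint max_upto (f : nat -> R) (n : nat) : R :=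
  match n with O => f O | S n' => Rmax (max_upto f n') (f (S n')) end.

Lemma max_upto_ge f n i : (i <= n)%nat -> f i <= max_upto f n.
Proof.
  induction n as [|n IH]; intros Hi; simpl.
  - replace i with 0%nat by lia. lra.
  - destruct (Nat.eq_dec i (S n)) as [->|ne].
    + apply Rmax_r.
    + eapply Rle_trans; [apply IH; lia | apply Rmax_l].
Qed.

Lemma max_upto_le f n M : (forall i, (i <= n)%nat -> f i <= M) -> max_upto f n <= M.
Proof.
  induction n as [|n IH]; intros H; simpl.
  - apply H; lia.
  - apply Rmax_lub; [apply IH; intros; apply H; lia | apply H; lia].
Qed.

Lemma max_upto_dist f g n e : (forall i, (i <= n)%nat -> Rabs (f i - g i) <= e) ->
  Rabs (max_upto f n - max_upto g n) <= e.
Proof.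
  intros H. apply Rabs_le. split.
  - cut (max_upto g n <= max_upto f n + e); [lra|].
    apply max_upto_le. intros i Hi. specialize (H i Hi).
    apply Rabs_le_between in H. pose proof (max_upto_ge f n i Hi). lra.
  - cut (max_upto f n <= max_upto g n + e); [lra|].
    apply max_upto_le. intros i Hi. specialize (H i Hi).
    apply Rabs_le_between in H. pose proof (max_upto_ge g n i Hi). lra.
Qed.

(* A diagonal argument: one limit value at a time, keeping simultaneous
   clustering of the values already chosen. *)
Lemma simultaneous_cluster (u : nat -> nat -> R) (B : R) :
  (forall n i, Rabs (u n i) <= B) ->
  exists l : nat -> R, forall J N eps, 0 < eps ->
    exists n, (N <= n)%nat /\ forall i, (i < J)%nat -> Rabs (u n i - l i) < eps.
Proof.
  intros HB.
  pose (Q := fun (l : nat -> R) J => forall N eps, 0 < eps ->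
    exists n, (N <= n)%nat /\ forall i, (i < J)%nat -> Rabs (u n i - l i) < eps).
  pose (upd := fun (l : nat -> R) J x i => if Nat.eq_dec i J then x else l i).
  assert (step : forall l J, exists x, Q l J -> Q (upd l J x) (S J)).
  { intros l J. destruct (classic (Q l J)) as [HQ|]; [|exists 0; tauto].
    assert (pick : forall m : nat, exists n, (m <= n)%nat /\
              forall i, (i < J)%nat -> Rabs (u n i - l i) < / (INR m + 1)).
    { intros m. apply HQ. apply Rinv_0_lt_compat. pose proof (pos_INR m). lra. }
    pose (s := fun m => proj1_sig (constructive_indefinite_description _ (pick m))).
    assert (sP : forall m, (m <= s m)%nat /\
              forall i, (i < J)%nat -> Rabs (u (s m) i - l i) < / (INR m + 1)).
    { intros m. unfold s. destruct constructive_indefinite_description; auto. }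
    destruct (Bolzano_Weierstrass (fun m => u (s m) J) (fun c => - B <= c <= B))
      as [x Hx].
    { apply compact_P3. }
    { intros m. apply Rabs_le_between. apply HB. }
    exists x. intros _ N eps Heps.
    destruct (archimed_cor1 eps Heps) as [M [HM HM0]].
    destruct (Hx (disc x (mkposreal eps Heps)) (Nat.max N M)) as [m [Hm Hd]].
    { exists (mkposreal eps Heps). intros y Hy. exact Hy. }
    destruct (sP m) as [h1 h2]. exists (s m). split; [lia|].
    intros i Hi. unfold upd. destruct (Nat.eq_dec i J) as [->|ne].
    - exact Hd.
    - eapply Rlt_trans; [apply h2; lia|]. eapply Rle_lt_trans; [|exact HM].
      apply Rinv_le_contravar; [apply lt_0_INR; lia|].
      assert (INR M <= INR m) by (apply le_INR; lia). lra. }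
  pose (x := fun l J => proj1_sig (constructive_indefinite_description _ (step l J))).
  assert (xP : forall l J, Q l J -> Q (upd l J (x l J)) (S J)).
  { intros l J. unfold x. destruct constructive_indefinite_description; auto. }
  pose (L := fix L J := match J with O => fun _ => 0 | S J' => upd (L J') J' (x (L J') J') end).
  assert (LQ : forall J, Q (L J) J).
  { induction J as [|J IH].
    - intros N eps _. exists N. split; [lia|]. intros; lia.
    - apply xP. exact IH. }
  assert (Lst : forall J i, (i < J)%nat -> L J i = L (S i) i).
  { induction J as [|J IH]; intros i Hi; [lia|].
    destruct (Nat.eq_dec i J) as [->|ne]; [reflexivity|].
    rewrite <- IH by lia. simpl. unfold upd at 1. destruct (Nat.eq_dec i J); [lia|reflexivity]. }
  exists (fun i => L (S i) i). intros J N eps Heps.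
  destruct (LQ J N eps Heps) as [n [h1 h2]]. exists n. split; [exact h1|].
  intros i Hi. rewrite <- (Lst J i Hi). apply h2. exact Hi.
Qed.

Section Schauder.
Variables (a b A : R) (om : R -> R) (Psi : (R -> R) -> R -> R).
Hypothesis ab : a < b.
Hypothesis A0 : 0 < A.
Hypothesis om_ge0 : forall t, 0 <= t -> 0 <= om t.
Hypothesis om_mono : forall s t, 0 <= s <= t -> om s <= om t.
Hypothesis om_add : forall s t, 0 <= s -> 0 <= t -> om (s + t) <= om s + om t.
Hypothesis om_lim : forall eps, 0 < eps -> exists del, 0 < del /\ om del <= eps.

(** Imposed on the whole line although [Psi] is only controlled on [[a, b]]: maxima of cones satisfy
    it everywhere, and the fixed point is then continuous from both sides at [a] and [b]. *)
Definition modulus (h : R -> R) := forall x y, Rabs (h x - h y) <= om (Rabs (x - y)).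

Hypothesis Psi_bound : forall h, modulus h -> forall x, a <= x <= b -> 0 <= Psi h x <= A.
Hypothesis Psi_mod : forall h, modulus h -> forall x y, a <= x <= b -> a <= y <= b ->
  Rabs (Psi h x - Psi h y) <= om (Rabs (x - y)).
Hypothesis Psi_cont : forall eps, 0 < eps -> exists del, 0 < del /\
  forall h k, modulus h -> modulus k ->
    (forall x, a <= x <= b -> Rabs (h x - k x) <= del) ->
    forall x, a <= x <= b -> Rabs (Psi h x - Psi k x) <= eps.

Lemma om_zero : om 0 = 0.
Proof.
  apply Rle_antisym; [|apply om_ge0; lra].
  apply le_epsilon. intros eps Heps. destruct (om_lim eps Heps) as [d [d0 Hd]].
  pose proof (om_mono 0 d ltac:(lra)). lra.
Qed.

Lemma om_shift p x y : om (Rabs (x - p)) <= om (Rabs (y - p)) + om (Rabs (x - y)).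
Proof.
  eapply Rle_trans; [|apply om_add; apply Rabs_pos].
  apply om_mono. split; [apply Rabs_pos|].
  replace (x - p) with ((y - p) + (x - y)) by ring. apply Rabs_triang.
Qed.

Lemma cone_dist p v x y :
  Rabs ((v - om (Rabs (x - p))) - (v - om (Rabs (y - p)))) <= om (Rabs (x - y)).
Proof.
  pose proof (om_shift p x y). pose proof (om_shift p y x).
  rewrite (Rabs_minus_sym y x) in *. apply Rabs_le. lra.
Qed.

Definition node (N i : nat) := a + INR i * ((b - a) / INR N).

Lemma node_in N i : (0 < N)%nat -> (i <= N)%nat -> a <= node N i <= b.
Proof.
  intros HN Hi. apply lt_INR in HN. apply le_INR in Hi. simpl in HN. unfold node.
  assert (0 <= INR i) by apply pos_INR.
  replace (INR i * ((b - a) / INR N)) with ((b - a) * (INR i / INR N)) by (field; lra).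
  assert (0 <= INR i / INR N <= 1).
  { split; [apply Rdiv_le_0_compat; lra|]. apply Rmult_le_reg_r with (INR N); [lra|].
    unfold Rdiv. rewrite Rmult_assoc, Rinv_l; lra. }
  nra.
Qed.

Lemma node_near N x : (0 < N)%nat -> a <= x <= b ->
  exists i, (i <= N)%nat /\ Rabs (x - node N i) <= (b - a) / INR N.
Proof.
  intros HN Hx. apply lt_INR in HN. simpl in HN.
  assert (d0 : 0 < (b - a) / INR N) by (apply Rdiv_lt_0_compat; lra).
  destruct (nfloor_ex ((x - a) / ((b - a) / INR N))) as [i [h1 h2]].
  { apply Rdiv_le_0_compat; lra. }
  assert (k1 : INR i * ((b - a) / INR N) <= x - a).
  { apply Rmult_le_compat_r with (r := (b - a) / INR N) in h1; [|lra].
    eapply Rle_trans; [exact h1|]. right. field. lra. }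
  assert (k2 : x - a < (INR i + 1) * ((b - a) / INR N)).
  { apply Rmult_lt_compat_r with (r := (b - a) / INR N) in h2; [|lra].
    eapply Rle_lt_trans; [|exact h2]. right. field. lra. }
  exists i. split.
  - apply INR_le. apply Rmult_le_reg_r with ((b - a) / INR N); [lra|].
    replace (INR N * ((b - a) / INR N)) with (b - a) by (field; lra). lra.
  - unfold node. apply Rabs_le. lra.
Qed.

(** A maximum of cones of shape [om] has modulus [om] whatever the heights [A * v i], so [v] ranges
    freely over a cube. It need not take the value [A * v i] at a node; but at an approximate fixed
    point these heights are close to values of [Psi (hv v)], which has modulus [om], and this makes
    [hv v] close to [Psi (hv v)] everywhere. *)
Lemma Schauder_approx eps : 0 < eps -> exists h, modulus h /\
  (forall x, a <= x <= b -> Rabs (Psi h x - h x) <= eps).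
Proof.
  intros Heps.
  destruct (om_lim (eps / 4) ltac:(lra)) as [d [d0 Hd]].
  destruct (archimed_cor1 (d / (b - a))) as [N [HN HN0]].
  { apply Rdiv_lt_0_compat; lra. }
  assert (HNR : 0 < INR N) by (apply lt_0_INR; lia).
  assert (mesh : (b - a) / INR N <= d).
  { apply Rmult_lt_compat_l with (r := b - a) in HN; [|lra].
    apply Rlt_le. eapply Rlt_le_trans; [exact HN|]. right. field. lra. }
  pose (hv := fun (v : nat -> R) x => max_upto (fun i => A * v i - om (Rabs (x - node N i))) N).
  assert (hv_mod : forall v, modulus (hv v)).
  { intros v x y. apply max_upto_dist. intros i _. apply cone_dist. }
  destruct (@Scarf.cube_approx_fixed_point (S N) (fun v i => Psi (hv v) (node N i) / A))
    with (eta := eps / 2 / A) as [v [v01 vP]].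
  - intros v i Hi. destruct (Psi_bound (hv v) (hv_mod v) (node N i)) as [h1 h2].
    { apply node_in; lia. }
    split; [apply Rdiv_le_0_compat; lra|].
    apply Rmult_le_reg_r with A; [lra|]. unfold Rdiv. rewrite Rmult_assoc, Rinv_l; lra.
  - intros e He. destruct (Psi_cont (e * A)) as [del [del0 Hdel]]; [nra|].
    exists (del / A); [apply Rdiv_lt_0_compat; lra|].
    intros v w Hvw i Hi.
    replace (Psi (hv v) (node N i) / A - Psi (hv w) (node N i) / A)
      with ((Psi (hv v) (node N i) - Psi (hv w) (node N i)) / A) by (field; lra).
    rewrite Rabs_div by lra. rewrite (Rabs_pos_eq A) by lra.
    apply Rmult_le_reg_r with A; [lra|]. unfold Rdiv at 1. rewrite Rmult_assoc, Rinv_l, Rmult_1_r by lra.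
    apply Hdel; auto; [|apply node_in; lia].
    intros x _. apply max_upto_dist. intros j Hj.
    replace (A * v j - om (Rabs (x - node N j)) - (A * w j - om (Rabs (x - node N j))))
      with (A * (v j - w j)) by ring.
    rewrite Rabs_mult, (Rabs_pos_eq A) by lra.
    specialize (Hvw j ltac:(lia)).
    apply Rmult_le_compat_l with (r := A) in Hvw; [|lra].
    eapply Rle_trans; [exact Hvw|]. right. field. lra.
  - apply Rdiv_lt_0_compat; lra.
  - exists (hv v). split; [apply hv_mod|]. intros x Hx.
    assert (near : forall i, (i <= N)%nat -> Rabs (Psi (hv v) (node N i) - A * v i) <= eps / 2).
    { intros i Hi. specialize (vP i ltac:(lia)).
      replace (Psi (hv v) (node N i) - A * v i) with (A * (Psi (hv v) (node N i) / A - v i)) by (field; lra).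
      rewrite Rabs_mult, (Rabs_pos_eq A) by lra.
      apply Rmult_le_compat_l with (r := A) in vP; [|lra].
      eapply Rle_trans; [exact vP|]. right. field. lra. }
    assert (up : hv v x <= Psi (hv v) x + eps / 2).
    { apply max_upto_le. intros i Hi.
      pose proof (near i Hi) as h1. apply Rabs_le_between in h1.
      pose proof (Psi_mod (hv v) (hv_mod v) x (node N i) Hx ltac:(apply node_in; lia)) as h2.
      apply Rabs_le_between in h2. lra. }
    destruct (node_near N x HN0 Hx) as [i [Hi Hn]].
    pose proof (near i Hi) as h1. apply Rabs_le_between in h1.
    pose proof (Psi_mod (hv v) (hv_mod v) x (node N i) Hx ltac:(apply node_in; lia)) as h2.
    apply Rabs_le_between in h2.
    pose proof (max_upto_ge (fun i => A * v i - om (Rabs (x - node N i))) N i Hi) as h3.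
    cbv beta in h3. fold (hv v x) in h3.
    assert (om (Rabs (x - node N i)) <= eps / 4).
    { eapply Rle_trans; [|exact Hd]. apply om_mono. split; [apply Rabs_pos|lra]. }
    apply Rabs_le. lra.
Qed.

(** All nodes of all meshes in one sequence; the minimum with [b] handles the indices beyond the
    last node of a mesh. *)
Definition dense_pt (j : nat) := let (i, q) := Cantor.of_nat j in Rmin b (node (S q) i).

Lemma dense_pt_in j : a <= dense_pt j <= b.
Proof.
  unfold dense_pt. destruct (Cantor.of_nat j) as [i q]. split; [|apply Rmin_l].
  apply Rmin_glb; [lra|]. unfold node.
  assert (0 <= (b - a) / INR (S q)).
  { apply Rdiv_le_0_compat; [lra|]. apply lt_0_INR; lia. }
  pose proof (pos_INR i). nra.
Qed.

Lemma dense_pt_net eps : 0 < eps -> exists J, forall x, a <= x <= b ->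
  exists j, (j < J)%nat /\ Rabs (x - dense_pt j) <= eps.
Proof.
  intros Heps. destruct (archimed_cor1 (eps / (b - a))) as [N [HN HN0]].
  { apply Rdiv_lt_0_compat; lra. }
  assert (HNR : 0 < INR N) by (apply lt_0_INR; lia).
  assert (mesh : (b - a) / INR N <= eps).
  { apply Rmult_lt_compat_l with (r := b - a) in HN; [|lra].
    apply Rlt_le. eapply Rlt_le_trans; [exact HN|]. right. field. lra. }
  destruct N as [|q]; [lia|].
  assert (ex : forall n, exists J, forall i, (i <= n)%nat -> (Cantor.to_nat (i, q) < J)%nat).
  { induction n as [|n [J HJ]].
    - exists (S (Cantor.to_nat (0%nat, q))). intros i Hi. replace i with 0%nat by lia. lia.
    - exists (Nat.max J (S (Cantor.to_nat (S n, q)))). intros i Hi.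
      destruct (Nat.eq_dec i (S n)) as [->|ne]; [lia|].
      specialize (HJ i ltac:(lia)). lia. }
  destruct (ex (S q)) as [J HJ]. exists J. intros x Hx.
  destruct (node_near (S q) x ltac:(lia) Hx) as [i [Hi Hn]].
  exists (Cantor.to_nat (i, q)). split; [auto|].
  unfold dense_pt. rewrite Cantor.cancel_of_to.
  rewrite Rmin_right; [lra|]. apply node_in; lia.
Qed.

(** The cluster values on the dense set are extended by a supremum of cones. With a common modulus,
    closeness on a finite net is uniform closeness, so at each precision a single approximate fixed
    point suffices and no convergent subsequence has to be extracted. *)
Theorem Schauder_fixed_point :
  exists h, modulus h /\ forall x, a <= x <= b -> h x = Psi h x.
Proof.
  assert (ex : forall n : nat, exists h, modulus h /\
            forall x, a <= x <= b -> Rabs (Psi h x - h x) <= / (INR n + 1)).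
  { intros n. apply Schauder_approx. apply Rinv_0_lt_compat. pose proof (pos_INR n). lra. }
  pose (hs := fun n => proj1_sig (constructive_indefinite_description _ (ex n))).
  assert (hsP : forall n, modulus (hs n) /\
            forall x, a <= x <= b -> Rabs (Psi (hs n) x - hs n x) <= / (INR n + 1)).
  { intros n. unfold hs. destruct constructive_indefinite_description; auto. }
  assert (hsB : forall n i, Rabs (hs n (dense_pt i)) <= A + 1).
  { intros n i. destruct (hsP n) as [hm he]. pose proof (dense_pt_in i) as Hi.
    pose proof (Psi_bound _ hm _ Hi). specialize (he _ Hi).
    assert (/ (INR n + 1) <= 1).
    { rewrite <- Rinv_1 at 2. apply Rinv_le_contravar; [lra|]. pose proof (pos_INR n). lra. }
    apply Rabs_le_between in he. apply Rabs_le. lra. }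
  destruct (simultaneous_cluster (fun n i => hs n (dense_pt i)) (A + 1) hsB) as [l Hl].
  assert (lB : forall i, l i <= A + 2).
  { intros i. destruct (Hl (S i) 0%nat 1 Rlt_0_1) as [n [_ Hn]].
    specialize (Hn i ltac:(lia)). specialize (hsB n i).
    apply Rabs_def2 in Hn. apply Rabs_le_between in hsB. lra. }
  assert (lmod : forall i j, Rabs (l i - l j) <= om (Rabs (dense_pt i - dense_pt j))).
  { intros i j. apply le_epsilon. intros e He.
    destruct (Hl (S (Nat.max i j)) 0%nat (e / 2) ltac:(lra)) as [n [_ Hn]].
    pose proof (Hn i ltac:(lia)) as h1. pose proof (Hn j ltac:(lia)) as h2.
    apply Rabs_def2 in h1. apply Rabs_def2 in h2.
    destruct (hsP n) as [hm _]. specialize (hm (dense_pt i) (dense_pt j)).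
    apply Rabs_le_between in hm. apply Rabs_le. lra. }
  assert (sup : forall x, exists s, is_lub (fun y => exists i, y = l i - om (Rabs (x - dense_pt i))) s).
  { intros x. destruct (completeness (fun y => exists i, y = l i - om (Rabs (x - dense_pt i)))) as [s Hs].
    - exists (A + 2). intros y [i ->]. pose proof (lB i). pose proof (om_ge0 _ (Rabs_pos (x - dense_pt i))). lra.
    - exists (l 0%nat - om (Rabs (x - dense_pt 0%nat))). exists 0%nat. reflexivity.
    - exists s. exact Hs. }
  pose (h := fun x => proj1_sig (constructive_indefinite_description _ (sup x))).
  assert (hP : forall x, is_lub (fun y => exists i, y = l i - om (Rabs (x - dense_pt i))) (h x)).
  { intros x. unfold h. destruct constructive_indefinite_description; auto. }
  assert (half : forall x y, h x <= h y + om (Rabs (x - y))).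
  { intros x y. apply (hP x). intros z [i ->].
    assert (l i - om (Rabs (y - dense_pt i)) <= h y) by (apply (hP y); exists i; reflexivity).
    pose proof (cone_dist (dense_pt i) (l i) x y) as h1. apply Rabs_le_between in h1. lra. }
  assert (hm : modulus h).
  { intros x y. pose proof (half x y). pose proof (half y x).
    rewrite (Rabs_minus_sym y x) in *. apply Rabs_le. lra. }
  assert (hl : forall i, h (dense_pt i) = l i).
  { intros i. apply Rle_antisym.
    - apply (hP (dense_pt i)). intros z [j ->]. pose proof (lmod j i) as h1.
      apply Rabs_le_between in h1. rewrite (Rabs_minus_sym (dense_pt i)). lra.
    - apply (hP (dense_pt i)). exists i. rewrite Rminus_diag, Rabs_R0, om_zero. ring. }
  exists h. split; [exact hm|]. intros x Hx.
  apply cond_eq. intros eps Heps.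
  destruct (Psi_cont (eps / 4) ltac:(lra)) as [del [del0 Hdel]].
  set (m := Rmin del (eps / 4)).
  assert (m0 : 0 < m) by (apply Rmin_glb_lt; lra).
  destruct (om_lim (m / 4) ltac:(lra)) as [t [t0 Ht]].
  destruct (dense_pt_net t t0) as [J HJ].
  destruct (archimed_cor1 (eps / 4) ltac:(lra)) as [M [HM HM0]].
  destruct (Hl J M (m / 4) ltac:(lra)) as [n [Hn Hc]].
  destruct (hsP n) as [hsm hse].
  assert (close : forall y, a <= y <= b -> Rabs (h y - hs n y) <= m).
  { intros y Hy. destruct (HJ y Hy) as [j [Hj Hd]].
    specialize (Hc j Hj). apply Rabs_def2 in Hc. rewrite <- hl in Hc.
    pose proof (hm y (dense_pt j)) as h1. pose proof (hsm y (dense_pt j)) as h2.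
    assert (om (Rabs (y - dense_pt j)) <= m / 4).
    { eapply Rle_trans; [|exact Ht]. apply om_mono. split; [apply Rabs_pos|lra]. }
    apply Rabs_le_between in h1. apply Rabs_le_between in h2. apply Rabs_le. lra. }
  assert (m1 : m <= del) by apply Rmin_l. assert (m2 : m <= eps / 4) by apply Rmin_r.
  pose proof (Hdel h (hs n) hm hsm (fun y Hy => Rle_trans _ _ _ (close y Hy) m1) x Hx) as k1.
  pose proof (hse x Hx) as k2. pose proof (close x Hx) as k3.
  assert (/ (INR n + 1) <= eps / 4).
  { apply Rlt_le. eapply Rle_lt_trans; [|exact HM].
    apply Rinv_le_contravar; [apply lt_0_INR; lia|].
    assert (INR M <= INR n) by (apply le_INR; lia). lra. }
  apply Rabs_le_between in k1. apply Rabs_le_between in k2. apply Rabs_le_between in k3.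
  apply Rabs_def1; lra.
Qed.
End Schauder.

(** * Gauge integrals *)

Lemma tagged_div_le a b l : tagged_div a b l -> a <= b.
Proof.
  revert a. induction l as [|[[u v] t] l IH]; simpl; intros a H; [lra|].
  destruct H as (-> & h1 & h2 & h3). apply IH in h3. lra.
Qed.

Lemma tagged_div_app a b c l l' :
  tagged_div a b l -> tagged_div b c l' -> tagged_div a c (l ++ l').
Proof.
  revert a. induction l as [|[[u v] t] l IH]; simpl; intros a H H'.
  - subst. exact H'.
  - destruct H as (-> & h1 & h2 & h3). repeat split; try tauto. apply IH; assumption.
Qed.

Lemma Cousin (delta : R -> R) a b : a <= b -> (forall x, a <= x <= b -> 0 < delta x) ->
  exists l, tagged_div a b l /\ delta_fine delta l.
Proof.
  intros ab Hd.
  pose (E := fun x => a <= x <= b /\ exists l, tagged_div a x l /\ delta_fine delta l).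
  assert (Ea : E a) by (split; [lra|]; exists nil; split; [reflexivity|constructor]).
  destruct (completeness E) as [m [Hub Hlub]].
  { exists b. intros x [Hx _]. lra. }
  { exists a. exact Ea. }
  assert (am : a <= m) by (apply Hub; exact Ea).
  assert (mb : m <= b) by (apply Hlub; intros x [Hx _]; lra).
  pose proof (Hd m ltac:(lra)) as dm.
  assert (ext : forall x y, E x -> m - delta m < x -> x < y -> x <= m <= y ->
                 y < m + delta m -> y <= b -> E y).
  { intros x y [Hx [l [Hl Fl]]] h1 h2 h3 h4 h5. split; [lra|].
    exists (l ++ (x, y, m) :: nil). split.
    - apply tagged_div_app with x; [assumption|]. simpl. repeat split; lra.
    - apply Forall_app. split; [assumption|]. constructor; [lra|constructor]. }
  assert (Em : E m).
  { destruct (classic (exists x, E x /\ m - delta m < x)) as [[x [Ex Hx]]|no].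
    - destruct (Rle_lt_or_eq_dec x m (Hub x Ex)) as [lt|<-]; [|assumption].
      apply (ext x m); auto; lra.
    - exfalso. assert (m <= m - delta m); [|lra].
      apply Hlub. intros x Ex. apply Rnot_lt_le. intros lt. apply no. exists x. split; assumption. }
  destruct (Rle_lt_or_eq_dec m b mb) as [lt|<-]; [|exact (proj2 Em)].
  exfalso. set (y := Rmin b (m + delta m / 2)).
  assert (y <= b) by apply Rmin_l. assert (y <= m + delta m / 2) by apply Rmin_r.
  assert (m < y) by (apply Rmin_glb_lt; lra).
  assert (Ey : E y) by (apply (ext m y); auto; lra).
  apply Hub in Ey. lra.
Qed.

Lemma delta_fine_min d d' l :
  delta_fine (fun x => Rmin (d x) (d' x)) l -> delta_fine d l /\ delta_fine d' l.
Proof.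
  intros H. split; eapply Forall_impl; try exact H; intros [[u v] t] h; cbv beta iota in h |- *;
    pose proof (Rmin_l (d t) (d' t)); pose proof (Rmin_r (d t) (d' t)); lra.
Qed.

Lemma HK_common_div f g a b I J eps : 0 < eps -> HK f a b I -> HK g a b J ->
  exists l, tagged_div a b l /\
    Rabs (riemann_sum f l - I) < eps /\ Rabs (riemann_sum g l - J) < eps.
Proof.
  intros e0 [ab HI] [_ HJ].
  destruct (HI eps e0) as [d [d0 Hd]]. destruct (HJ eps e0) as [d' [d0' Hd']].
  destruct (Cousin (fun x => Rmin (d x) (d' x)) a b ab) as [l [Hl Fl]].
  { intros x Hx. apply Rmin_glb_lt; auto. }
  apply delta_fine_min in Fl. exists l. split; [assumption|]. split; [apply Hd|apply Hd']; tauto.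
Qed.

Lemma riemann_sum_le f g a b l : (forall x, a <= x <= b -> f x <= g x) ->
  tagged_div a b l -> riemann_sum f l <= riemann_sum g l.
Proof.
  revert a. induction l as [|[[u v] t] l IH]; simpl; intros a H Hl; [lra|].
  destruct Hl as (-> & h1 & h2 & h3). pose proof (tagged_div_le _ _ _ h3).
  apply Rplus_le_compat.
  - apply Rmult_le_compat_r; [lra|]. apply H. lra.
  - apply (IH v); [|assumption]. intros x Hx. apply H. lra.
Qed.

Lemma HK_le f g a b I J : (forall x, a <= x <= b -> f x <= g x) ->
  HK f a b I -> HK g a b J -> I <= J.
Proof.
  intros H HI HJ. apply le_epsilon. intros eps e0.
  destruct (HK_common_div f g a b I J (eps / 2) ltac:(lra) HI HJ) as [l [Hl [h1 h2]]].
  pose proof (riemann_sum_le f g a b l H Hl).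
  apply Rabs_def2 in h1. apply Rabs_def2 in h2. lra.
Qed.

Lemma HK_unique f a b I J : HK f a b I -> HK f a b J -> I = J.
Proof.
  intros HI HJ. apply Rle_antisym; eapply HK_le; eauto; intros; lra.
Qed.

Lemma HKint_eq f a b I : HK f a b I -> HKint f a b = I.
Proof.
  intros H. apply (HK_unique f a b); [|assumption].
  unfold HKint. apply epsilon_spec. exists I. exact H.
Qed.

Lemma HK_ext f g a b I : (forall x, a <= x <= b -> f x = g x) -> HK f a b I -> HK g a b I.
Proof.
  intros H [ab HI]. split; [assumption|]. intros eps e0.
  destruct (HI eps e0) as [d [d0 Hd]]. exists d. split; [assumption|].
  intros l Hl Fl.
  replace (riemann_sum g l) with (riemann_sum f l); [auto|].
  apply Rle_antisym; apply (riemann_sum_le _ _ a b); auto; intros x Hx; rewrite H; auto; lra.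
Qed.

Lemma HK_scal f a b I k : HK f a b I -> HK (fun x => k * f x) a b (k * I).
Proof.
  intros [ab HI]. split; [assumption|]. intros eps e0.
  assert (k0 : 0 < Rabs k + 1) by (pose proof (Rabs_pos k); lra).
  destruct (HI (eps / (Rabs k + 1))) as [d [d0 Hd]].
  { apply Rdiv_lt_0_compat; lra. }
  exists d. split; [assumption|]. intros l Hl Fl.
  assert (E : riemann_sum (fun x => k * f x) l = k * riemann_sum f l).
  { clear. induction l as [|[[u v] t] l IH]; simpl; [ring|]. rewrite IH. ring. }
  rewrite E, <- Rmult_minus_distr_l, Rabs_mult. specialize (Hd l Hl Fl).
  apply Rle_lt_trans with ((Rabs k + 1) * Rabs (riemann_sum f l - I)).
  - apply Rmult_le_compat_r; [apply Rabs_pos|lra].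
  - apply Rmult_lt_compat_l with (r := Rabs k + 1) in Hd; [|assumption].
    replace ((Rabs k + 1) * (eps / (Rabs k + 1))) with eps in Hd by (field; lra). exact Hd.
Qed.

Lemma HK_plus f g a b I J : HK f a b I -> HK g a b J -> HK (fun x => f x + g x) a b (I + J).
Proof.
  intros [ab HI] [_ HJ]. split; [assumption|]. intros eps e0.
  destruct (HI (eps / 2) ltac:(lra)) as [d [d0 Hd]].
  destruct (HJ (eps / 2) ltac:(lra)) as [d' [d0' Hd']].
  exists (fun x => Rmin (d x) (d' x)). split.
  { intros x Hx. apply Rmin_glb_lt; auto. }
  intros l Hl Fl. apply delta_fine_min in Fl. destruct Fl as [F1 F2].
  assert (E : riemann_sum (fun x => f x + g x) l = riemann_sum f l + riemann_sum g l).
  { clear. induction l as [|[[u v] t] l IH]; simpl; [ring|]. rewrite IH. ring. }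
  rewrite E. pose proof (Hd l Hl F1) as h1. pose proof (Hd' l Hl F2) as h2.
  apply Rabs_def2 in h1. apply Rabs_def2 in h2. apply Rabs_def1; lra.
Qed.

Definition cont_on (F : R -> R) (a b : R) := forall x, a <= x <= b -> forall eps, 0 < eps ->
  exists del, 0 < del /\ forall y, a <= y <= b -> Rabs (y - x) < del -> Rabs (F y - F x) < eps.

(** The value [1/2] at the jump lets every nondegenerate interval containing [s], even as an end
    point, collect at least half of the jump. *)
Definition half_step (s x : R) := if Rlt_dec x s then 0 else if Req_EM_T x s then / 2 else 1.

Fixpoint step_sum (S : list R) (x : R) : R :=
  match S with nil => x | s :: S' => half_step s x + step_sum S' x end.

Lemma half_step_mono s u v : u <= v -> half_step s u <= half_step s v.
Proof.
  intros H. unfold half_step. repeat destruct Rlt_dec; repeat destruct Req_EM_T; lra.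
Qed.

Lemma step_sum_mono S u v : u <= v -> v - u <= step_sum S v - step_sum S u.
Proof.
  intros H. induction S as [|s S IH]; simpl; [lra|].
  pose proof (half_step_mono s u v H). lra.
Qed.

Lemma step_sum_jump S s u v : In s S -> u < v -> u <= s <= v -> / 2 <= step_sum S v - step_sum S u.
Proof.
  intros Hs uv H. induction S as [|s' S IH]; simpl in *; [tauto|].
  pose proof (half_step_mono s' u v ltac:(lra)). pose proof (step_sum_mono S u v ltac:(lra)).
  destruct Hs as [->|Hs].
  - assert (/ 2 <= half_step s v - half_step s u); [|lra].
    unfold half_step. repeat destruct Rlt_dec; repeat destruct Req_EM_T; lra.
  - specialize (IH Hs). lra.
Qed.

(* The exceptional points are absorbed by an increasing function with a jump at each of them, so that
   the straddle estimate holds at every tag. *)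
Lemma HK_FTC (F f : R -> R) (S : list R) a b : a <= b -> cont_on F a b ->
  (forall x, a <= x <= b -> ~ In x S -> is_derive F x (f x)) -> HK f a b (F b - F a).
Proof.
  intros ab HF Hf. split; [assumption|]. intros eps e0.
  set (chi := step_sum S).
  pose proof (step_sum_mono S a b ab) as cab. fold chi in cab.
  set (e := eps / (chi b - chi a + 1)).
  assert (ep : 0 < e) by (apply Rdiv_lt_0_compat; lra).
  assert (str : forall t, exists d, 0 < d /\ (a <= t <= b -> forall u v, a <= u -> v <= b -> u <= t <= v -> u < v ->
             t - d < u -> v < t + d -> Rabs (f t * (v - u) - (F v - F u)) <= e * (chi v - chi u))).
  { intros t. destruct (classic (a <= t <= b)) as [Ht|]; [|exists 1; split; [lra|tauto]].
    destruct (classic (In t S)) as [HS|HS].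
    (* Twice [e / 8] for the increment of [F] and [e / 4] for the term [f t * (v - u)] add up to
       [e / 2], which the jump at [t] pays for. *)
    - destruct (HF t Ht (e / 8) ltac:(lra)) as [d [d0 Hd]].
      assert (k0 : 0 < Rabs (f t) + 1) by (pose proof (Rabs_pos (f t)); lra).
      exists (Rmin d (e / 8 / (Rabs (f t) + 1))). split.
      { apply Rmin_glb_lt; [assumption|]. apply Rdiv_lt_0_compat; lra. }
      intros _ u v h1 h2 h3 h4 h5 h6.
      pose proof (Rmin_l d (e / 8 / (Rabs (f t) + 1))) as m1.
      pose proof (Rmin_r d (e / 8 / (Rabs (f t) + 1))) as m2.
      set (mm := Rmin d (e / 8 / (Rabs (f t) + 1))) in *.
      pose proof (step_sum_jump S t u v HS h4 h3) as J. fold chi in J.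
      assert (k1 : Rabs (F v - F t) < e / 8) by (apply Hd; [lra|]; apply Rabs_def1; lra).
      assert (k2 : Rabs (F u - F t) < e / 8) by (apply Hd; [lra|]; apply Rabs_def1; lra).
      assert (k3 : Rabs (f t * (v - u)) <= e / 4).
      { rewrite Rabs_mult, (Rabs_pos_eq (v - u)) by lra.
        apply Rle_trans with ((Rabs (f t) + 1) * (2 * (e / 8 / (Rabs (f t) + 1)))).
        - apply Rmult_le_compat; [apply Rabs_pos|lra|lra|lra].
        - right. field. lra. }
      apply Rabs_def2 in k1. apply Rabs_def2 in k2. apply Rabs_le_between in k3.
      assert (e * / 2 <= e * (chi v - chi u)) by (apply Rmult_le_compat_l; lra).
      apply Rabs_le. lra.
    - specialize (Hf t Ht HS). apply is_derive_Reals in Hf.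
      destruct (Hf e ep) as [[d d0] Hd]. simpl in Hd. exists d. split; [assumption|].
      intros _ u v h1 h2 h3 h4 h5 h6.
      assert (key : forall w, Rabs (w - t) < d -> Rabs (F w - F t - f t * (w - t)) <= e * Rabs (w - t)).
      { intros w Hw. destruct (Req_EM_T w t) as [->|ne].
        - rewrite !Rminus_diag, Rmult_0_r, Rminus_0_r, Rabs_R0. lra.
        - specialize (Hd (w - t) ltac:(lra) Hw).
          replace (t + (w - t)) with w in Hd by ring.
          replace (F w - F t - f t * (w - t)) with (((F w - F t) / (w - t) - f t) * (w - t)) by (field; lra).
          rewrite Rabs_mult. apply Rmult_le_compat_r; [apply Rabs_pos|lra]. }
      pose proof (key u ltac:(apply Rabs_def1; lra)) as k1.
      pose proof (key v ltac:(apply Rabs_def1; lra)) as k2.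
      rewrite (Rabs_left1 (u - t)) in k1 by lra. rewrite (Rabs_pos_eq (v - t)) in k2 by lra.
      pose proof (step_sum_mono S u v ltac:(lra)) as J. fold chi in J.
      assert (e * (v - u) <= e * (chi v - chi u)) by (apply Rmult_le_compat_l; lra).
      apply Rabs_le_between in k1. apply Rabs_le_between in k2. apply Rabs_le. lra. }
  pose (d := fun t => proj1_sig (constructive_indefinite_description _ (str t))).
  exists d.
  assert (dP : forall t, 0 < d t /\ (a <= t <= b -> forall u v, a <= u -> v <= b -> u <= t <= v -> u < v ->
             t - d t < u -> v < t + d t -> Rabs (f t * (v - u) - (F v - F u)) <= e * (chi v - chi u))).
  { intros t. unfold d. destruct constructive_indefinite_description; auto. }
  clearbody d. split; [intros; apply dP|].
  intros l Hl Fl.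
  assert (sum : forall a', a <= a' -> tagged_div a' b l ->
            Rabs (riemann_sum f l - (F b - F a')) <= e * (chi b - chi a')).
  { clear Hl. induction l as [|[[u v] t] l IH]; intros a' ha Hl; simpl in Hl.
    - subst a'. simpl. rewrite !Rminus_diag, Rabs_R0. lra.
    - destruct Hl as (-> & h1 & h2 & h3). pose proof (tagged_div_le _ _ _ h3) as vb.
      apply Forall_cons_iff in Fl. destruct Fl as [[p1 p2] F'].
      specialize (IH F' v ltac:(lra) h3).
      pose proof (proj2 (dP t) ltac:(lra) a' v ha vb h2 h1 p1 p2) as k.
      apply Rabs_le_between in k. apply Rabs_le_between in IH. simpl. apply Rabs_le. lra. }
  eapply Rle_lt_trans; [apply sum; [lra|assumption]|].
  assert (e * (chi b - chi a + 1) = eps) by (unfold e; field; lra). lra.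
Qed.

(** Away from [b] the gauge is at most the distance to [b], so an interval with [b] in its interior
    must have the tag [b]. It can be cut at [b] without changing the Riemann sum. *)
Lemma HK_concat f a b c I J : HK f a b I -> HK f b c J -> HK f a c (I + J).
Proof.
  intros [ab HI] [bc HJ]. split; [lra|]. intros eps e0.
  destruct (HI (eps / 2) ltac:(lra)) as [d [d0 Hd]].
  destruct (HJ (eps / 2) ltac:(lra)) as [d' [d0' Hd']].
  pose (D := fun x => if Rlt_dec x b then Rmin (d x) (b - x)
                      else if Rlt_dec b x then Rmin (d' x) (x - b) else Rmin (d x) (d' x)).
  exists D. split.
  { intros x Hx. unfold D. destruct Rlt_dec as [l1|l1]; [apply Rmin_glb_lt; [apply d0|]; lra|].
    destruct Rlt_dec as [l2|l2]; [apply Rmin_glb_lt; [apply d0'|]; lra|].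
    apply Rmin_glb_lt; [apply d0|apply d0']; lra. }
  assert (Dl : forall x, x < b -> D x <= d x /\ D x <= b - x).
  { intros x Hx. unfold D. destruct Rlt_dec; [|lra]. split; [apply Rmin_l|apply Rmin_r]. }
  assert (Dr : forall x, b < x -> D x <= d' x /\ D x <= x - b).
  { intros x Hx. unfold D. destruct Rlt_dec; [lra|]. destruct Rlt_dec; [|lra].
    split; [apply Rmin_l|apply Rmin_r]. }
  assert (Db : D b <= d b /\ D b <= d' b).
  { unfold D. destruct Rlt_dec; [lra|]. split; [apply Rmin_l|apply Rmin_r]. }
  assert (right : forall l u, b <= u -> tagged_div u c l -> delta_fine D l -> delta_fine d' l).
  { induction l as [|[[u v] t] l IH]; intros u' hu Hl Fl; [constructor|].
    simpl in Hl. destruct Hl as (-> & h1 & h2 & h3). apply Forall_cons_iff in Fl. destruct Fl as [[p1 p2] F'].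
    constructor; [|apply (IH v); auto; lra].
    destruct (Req_EM_T t b) as [->|ne]; [lra|]. pose proof (Dr t ltac:(lra)). lra. }
  assert (split_at : forall l u, u <= b -> tagged_div u c l -> delta_fine D l ->
            exists l1 l2, tagged_div u b l1 /\ delta_fine d l1 /\ tagged_div b c l2 /\ delta_fine d' l2 /\
              riemann_sum f l = riemann_sum f l1 + riemann_sum f l2).
  { induction l as [|[[u v] t] l IH]; intros u' hu Hl Fl.
    - simpl in Hl. assert (u' = b) by lra. subst u'. assert (b = c) by lra. subst c.
      exists nil, nil. simpl. repeat split; try constructor. ring.
    - pose proof Hl as Hl0. pose proof Fl as Fl0.
      simpl in Hl. destruct Hl as (-> & h1 & h2 & h3). apply Forall_cons_iff in Fl. destruct Fl as [[p1 p2] F'].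
      destruct (Rle_lt_dec v b) as [vb|vb].
      + destruct (IH v vb h3 F') as (l1 & l2 & q1 & q2 & q3 & q4 & q5).
        exists ((u', v, t) :: l1), l2. simpl. rewrite q5. repeat split; try assumption; try lra.
        constructor; [|assumption].
        destruct (Req_EM_T t b) as [->|ne]; [lra|]. pose proof (Dl t ltac:(lra)). lra.
      + destruct (Req_EM_T u' b) as [->|ne].
        { exists nil, ((b, v, t) :: l). split; [reflexivity|]. split; [constructor|].
          split; [exact Hl0|]. split; [apply (right _ b); auto|simpl; ring]. }
        assert (t = b) as ->.
        { destruct (Rtotal_order t b) as [lt|[->|gt]]; [|reflexivity|].
          - pose proof (Dl t lt). lra.
          - pose proof (Dr t gt). lra. }
        exists ((u', b, b) :: nil), ((b, v, b) :: l). simpl. repeat split; try assumption; try lra.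
        * constructor; [lra|constructor].
        * constructor; [lra|]. apply (right _ v); auto; lra. }
  intros l Hl Fl. destruct (split_at l a ab Hl Fl) as (l1 & l2 & q1 & q2 & q3 & q4 & q5).
  specialize (Hd l1 q1 q2). specialize (Hd' l2 q3 q4). rewrite q5.
  apply Rabs_def2 in Hd. apply Rabs_def2 in Hd'. apply Rabs_def1; lra.
Qed.

(** * Primitives of functions singular at the end points *)

Lemma derive_nonneg_mono (F d : R -> R) a b :
  (forall x, a < x < b -> is_derive F x (d x)) -> (forall x, a < x < b -> 0 <= d x) ->
  forall x y, a < x -> x <= y -> y < b -> F x <= F y.
Proof.
  intros HF Hd x y ax xy yb.
  destruct (MVT_gen F x y d) as [c [Hc E]].
  - intros z Hz. rewrite Rmin_left, Rmax_right in Hz by lra. apply HF. lra.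
  - intros z Hz. rewrite Rmin_left, Rmax_right in Hz by lra.
    apply continuity_pt_filterlim. apply (ex_derive_continuous F).
    exists (d z). apply HF. lra.
  - rewrite Rmin_left, Rmax_right in Hc by lra.
    assert (0 <= d c * (y - x)) by (apply Rmult_le_pos; [apply Hd|]; lra). lra.
Qed.

Lemma cont_on_mono_closed F a b : a < b -> cont_on F a b ->
  (forall x y, a < x -> x <= y -> y < b -> F x <= F y) ->
  forall x y, a <= x -> x <= y -> y <= b -> F x <= F y.
Proof.
  intros ab HF Hm.
  assert (L : forall x y, a <= x -> x <= y -> y < b -> F x <= F y).
  { intros x y ax xy yb. destruct (Rle_lt_or_eq_dec a x ax) as [lt|<-]; [auto|].
    destruct (Rle_lt_or_eq_dec a y xy) as [lt|<-]; [|lra].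
    apply le_epsilon. intros e e0. destruct (HF a ltac:(lra) e e0) as [d [d0 Hd]].
    set (z := Rmin y (a + d / 2)).
    assert (z <= y) by apply Rmin_l. assert (z <= a + d / 2) by apply Rmin_r.
    assert (a < z) by (apply Rmin_glb_lt; lra).
    specialize (Hd z ltac:(lra) ltac:(apply Rabs_def1; lra)). apply Rabs_def2 in Hd.
    pose proof (Hm z y ltac:(lra) ltac:(lra) yb). lra. }
  intros x y ax xy yb. destruct (Rle_lt_or_eq_dec y b yb) as [lt| ->]; [auto|].
  destruct (Rle_lt_or_eq_dec x b xy) as [lt| ->]; [|lra].
  apply le_epsilon. intros e e0. destruct (HF b ltac:(lra) e e0) as [d [d0 Hd]].
  set (z := Rmax x (b - d / 2)).
  assert (x <= z) by apply Rmax_l. assert (b - d / 2 <= z) by apply Rmax_r.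
  assert (z < b) by (apply Rmax_lub_lt; lra).
  specialize (Hd z ltac:(lra) ltac:(apply Rabs_def1; lra)). apply Rabs_def2 in Hd.
  pose proof (L x z ax ltac:(lra) ltac:(lra)). lra.
Qed.

(** A primitive [F0] on the open interval and the difference [G - F0] are both nondecreasing, so
    [F0] is bounded by the variation of [G] and has limits at the ends. The increments of the
    extension stay below those of [G], whence its continuity up to the ends. *)
Lemma improper_primitive (f g G : R -> R) a b : a < b ->
  (forall x, a < x < b -> continuous f x) ->
  (forall x, a < x < b -> 0 <= f x <= g x) ->
  (forall x, a < x < b -> is_derive G x (g x)) -> cont_on G a b ->
  exists F, F a = 0 /\ cont_on F a b /\ (forall x, a < x < b -> is_derive F x (f x)) /\
    (forall x y, a <= x -> x <= y -> y <= b -> 0 <= F y - F x <= G y - G x).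
Proof.
  intros ab Cf Hfg HG CG.
  set (m := (a + b) / 2).
  set (F0 := fun x => RInt f m x).
  assert (D0 : forall x, a < x < b -> is_derive F0 x (f x)).
  { intros x Hx. apply (is_derive_RInt f F0 m x); [|apply Cf; assumption].
    assert (dp : 0 < Rmin (x - a) (b - x)) by (apply Rmin_glb_lt; lra).
    exists (mkposreal _ dp). intros y Hy.
    apply (Rabs_def2 (y - x)) in Hy. simpl in Hy.
    pose proof (Rmin_l (x - a) (b - x)). pose proof (Rmin_r (x - a) (b - x)).
    apply (RInt_correct f m y). apply (ex_RInt_continuous f). intros z Hz. apply Cf.
    unfold m in *. revert Hz. unfold Rmin, Rmax. repeat destruct Rle_dec; lra. }
  assert (M1 : forall x y, a < x -> x <= y -> y < b -> F0 x <= F0 y).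
  { apply (derive_nonneg_mono F0 f); [assumption|]. intros; apply Hfg; assumption. }
  assert (M2 : forall x y, a < x -> x <= y -> y < b -> G x - F0 x <= G y - F0 y).
  { apply (derive_nonneg_mono (fun x => G x - F0 x) (fun x => g x - f x)).
    - intros x Hx. apply (is_derive_minus G F0); auto.
    - intros x Hx. specialize (Hfg x Hx). lra. }
  assert (M3 : forall x y, a <= x -> x <= y -> y <= b -> G x <= G y).
  { apply cont_on_mono_closed; auto. apply (derive_nonneg_mono G g); [assumption|].
    intros x Hx. specialize (Hfg x Hx). lra. }
  assert (mm : a < m < b) by (unfold m; lra).
  assert (lo : forall x, a < x < b -> F0 x - F0 m >= - (G b - G a)).
  { intros x Hx. destruct (Rle_dec x m).
    - pose proof (M2 x m ltac:(lra) ltac:(lra) ltac:(lra)).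
      pose proof (M3 a x ltac:(lra) ltac:(lra) ltac:(lra)).
      pose proof (M3 m b ltac:(lra) ltac:(lra) ltac:(lra)). lra.
    - pose proof (M1 m x ltac:(lra) ltac:(lra) ltac:(lra)).
      pose proof (M3 a b ltac:(lra) ltac:(lra) ltac:(lra)). lra. }
  assert (hi : forall x, a < x < b -> F0 x - F0 m <= G b - G a).
  { intros x Hx. destruct (Rle_dec x m).
    - pose proof (M1 x m ltac:(lra) ltac:(lra) ltac:(lra)).
      pose proof (M3 a b ltac:(lra) ltac:(lra) ltac:(lra)). lra.
    - pose proof (M2 m x ltac:(lra) ltac:(lra) ltac:(lra)).
      pose proof (M3 a m ltac:(lra) ltac:(lra) ltac:(lra)).
      pose proof (M3 x b ltac:(lra) ltac:(lra) ltac:(lra)). lra. }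
  (* By monotonicity the limits of [F0] at [a] and [b] are [- La] and [Lb]. *)
  destruct (completeness (fun y => exists x, a < x < b /\ y = - F0 x)) as [La [Lu Ll]].
  { exists (G b - G a - F0 m). intros y [x [Hx ->]]. specialize (lo x Hx). lra. }
  { exists (- F0 m), m. split; [lra|reflexivity]. }
  destruct (completeness (fun y => exists x, a < x < b /\ y = F0 x)) as [Lb [Lu' Ll']].
  { exists (G b - G a + F0 m). intros y [x [Hx ->]]. specialize (hi x Hx). lra. }
  { exists (F0 m), m. split; [lra|reflexivity]. }
  pose (F := fun x => if Rle_dec x a then 0 else if Rle_dec b x then Lb + La else F0 x + La).
  assert (Fa : F a = 0) by (unfold F; destruct Rle_dec; lra).
  assert (Fb : F b = Lb + La) by (unfold F; destruct Rle_dec; [lra|]; destruct Rle_dec; lra).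
  assert (Fi : forall x, a < x < b -> F x = F0 x + La).
  { intros x Hx. unfold F. destruct Rle_dec; [lra|]. destruct Rle_dec; lra. }
  assert (ba : forall x, a < x < b -> 0 <= F x - F a <= G x - G a).
  { intros x Hx. rewrite Fa, (Fi x Hx). split.
    - assert (- F0 x <= La) by (apply Lu; exists x; split; auto). lra.
    - assert (La <= G x - G a - F0 x); [|lra]. apply Ll. intros y [z [Hz ->]].
      destruct (Rle_dec z x).
      + pose proof (M2 z x ltac:(lra) ltac:(lra) ltac:(lra)).
        pose proof (M3 a z ltac:(lra) ltac:(lra) ltac:(lra)). lra.
      + pose proof (M1 x z ltac:(lra) ltac:(lra) ltac:(lra)).
        pose proof (M3 a x ltac:(lra) ltac:(lra) ltac:(lra)). lra. }
  assert (bb : forall x, a < x < b -> 0 <= F b - F x <= G b - G x).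
  { intros x Hx. rewrite Fb, (Fi x Hx). split.
    - assert (F0 x <= Lb) by (apply Lu'; exists x; split; auto). lra.
    - assert (Lb <= G b - G x + F0 x); [|lra]. apply Ll'. intros y [z [Hz ->]].
      destruct (Rle_dec x z).
      + pose proof (M2 x z ltac:(lra) ltac:(lra) ltac:(lra)).
        pose proof (M3 z b ltac:(lra) ltac:(lra) ltac:(lra)). lra.
      + pose proof (M1 z x ltac:(lra) ltac:(lra) ltac:(lra)).
        pose proof (M3 x b ltac:(lra) ltac:(lra) ltac:(lra)). lra. }
  assert (bd : forall x y, a <= x -> x <= y -> y <= b -> 0 <= F y - F x <= G y - G x).
  { intros x y ax xy yb.
    destruct (Req_EM_T x y) as [->|ne]; [lra|].
    destruct (Rle_lt_or_eq_dec a x ax) as [lx|<-]; destruct (Rle_lt_or_eq_dec y b yb) as [ly| ->].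
    - rewrite !Fi by lra. pose proof (M1 x y lx xy ly). pose proof (M2 x y lx xy ly). lra.
    - apply bb. lra.
    - apply ba. lra.
    - pose proof (ba m mm). pose proof (bb m mm). lra. }
  exists F. split; [assumption|]. split.
  - intros x Hx e e0. destruct (CG x Hx e e0) as [d [d0 Hd]]. exists d. split; [assumption|].
    intros y Hy Hyx. specialize (Hd y Hy Hyx). eapply Rle_lt_trans; [|exact Hd].
    destruct (Rle_dec x y).
    + pose proof (bd x y ltac:(lra) ltac:(lra) ltac:(lra)). rewrite !Rabs_pos_eq; lra.
    + pose proof (bd y x ltac:(lra) ltac:(lra) ltac:(lra)). rewrite !Rabs_left1; lra.
  - split; [|assumption]. intros x Hx.
    apply (is_derive_ext_loc (fun y => F0 y + La)).
    + assert (dp : 0 < Rmin (x - a) (b - x)) by (apply Rmin_glb_lt; lra).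
      exists (mkposreal _ dp). intros y Hy. symmetry. apply Fi.
      apply (Rabs_def2 (y - x)) in Hy. simpl in Hy.
      pose proof (Rmin_l (x - a) (b - x)). pose proof (Rmin_r (x - a) (b - x)). lra.
    + rewrite <- (Rplus_0_r (f x)). apply (is_derive_plus F0 (fun _ => La)); [auto|].
      apply (is_derive_const (K := R_AbsRing) (V := R_NormedModule) La).
Qed.

Lemma cont_on_sub F a b a' b' : a <= a' -> b' <= b -> cont_on F a b -> cont_on F a' b'.
Proof.
  intros ha hb H x Hx e e0. destruct (H x ltac:(lra) e e0) as [d [d0 Hd]].
  exists d. split; [assumption|]. intros y Hy. apply Hd. lra.
Qed.

Lemma HK_FTC_open F f a b x y : cont_on F a b ->
  (forall x, a < x < b -> is_derive F x (f x)) -> a <= x -> x <= y -> y <= b -> HK f x y (F y - F x).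
Proof.
  intros HF Hf ax xy yb. apply (HK_FTC F f (a :: b :: nil)); [assumption| |].
  - apply (cont_on_sub F a b); auto.
  - intros z Hz Hn. apply Hf. simpl in Hn.
    assert (z <> a) by (intros ->; apply Hn; auto).
    assert (z <> b) by (intros ->; apply Hn; auto). lra.
Qed.

(** * Powers and kernel estimates *)

Lemma HK_zero_except (n : R -> R) (S : list R) a b : a <= b ->
  (forall x, a <= x <= b -> ~ In x S -> n x = 0) -> HK n a b 0.
Proof.
  intros ab H. replace 0 with (0 - 0) by ring.
  apply (HK_FTC (fun _ => 0) n S); [assumption| |].
  - intros x _ e e0. exists 1. split; [lra|]. intros. rewrite Rminus_0_r, Rabs_R0. assumption.
  - intros x Hx Hn. rewrite (H x Hx Hn).
    apply (is_derive_const (K := R_AbsRing) (V := R_NormedModule)).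
Qed.

(** Where the comparison fails, [g] is corrected by a function supported on the finite list, whose
    integral is [0]. *)
Lemma HK_le_except f g (S : list R) a b I J :
  (forall x, a <= x <= b -> ~ In x S -> f x <= g x) -> HK f a b I -> HK g a b J -> I <= J.
Proof.
  intros H HI HJ.
  set (n := fun x => if in_dec Req_EM_T x S then f x - g x else 0).
  assert (Hn : HK n a b 0).
  { apply (HK_zero_except n S); [apply HI|]. intros x _ Hx. unfold n.
    destruct in_dec; [tauto|reflexivity]. }
  rewrite <- (Rplus_0_r J). apply (HK_le f (fun x => g x + n x) a b); [|assumption|apply HK_plus; assumption].
  intros x Hx. unfold n. destruct in_dec; [lra|]. specialize (H x Hx n0). lra.
Qed.

Lemma is_derive_eq (f : R -> R) (x l l' : R) : is_derive f x l -> l = l' -> is_derive f x l'.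
Proof. intros H <-. exact H. Qed.

(* [Rpower x a] is [1] for [x <= 0], hence not continuous at the origin. *)
Definition rp (a x : R) := if Rlt_dec 0 x then Rpower x a else 0.

Lemma rp_pos a x : 0 < x -> rp a x = Rpower x a.
Proof. intros H. unfold rp. destruct Rlt_dec; [reflexivity|lra]. Qed.

Lemma rp_npos a x : x <= 0 -> rp a x = 0.
Proof. intros H. unfold rp. destruct Rlt_dec; [lra|reflexivity]. Qed.

Lemma rp_ge0 a x : 0 <= rp a x.
Proof. unfold rp. destruct Rlt_dec; [|lra]. apply Rlt_le, exp_pos. Qed.

Lemma rp_gt0 a x : 0 < x -> 0 < rp a x.
Proof. intros H. rewrite rp_pos by assumption. apply exp_pos. Qed.

Lemma rp_plus a b x : 0 < x -> rp (a + b) x = rp a x * rp b x.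
Proof. intros H. rewrite !rp_pos by assumption. apply Rpower_plus. Qed.

Lemma rp_1 x : 0 < x -> rp 1 x = x.
Proof. intros H. rewrite rp_pos by assumption. apply Rpower_1. assumption. Qed.

Lemma rp_mult a x y : 0 < x -> 0 < y -> rp a (x * y) = rp a x * rp a y.
Proof. intros Hx Hy. rewrite !rp_pos by nra. symmetry. apply Rpower_mult_distr; assumption. Qed.

Lemma rp_mono a x y : 0 <= a -> x <= y -> rp a x <= rp a y.
Proof.
  intros Ha H. destruct (Rlt_dec 0 x) as [h|h].
  - rewrite !rp_pos by lra. apply Rle_Rpower_l; lra.
  - rewrite (rp_npos a x) by lra. apply rp_ge0.
Qed.

Lemma rp_anti a x y : a <= 0 -> 0 < x <= y -> rp a y <= rp a x.
Proof.
  intros Ha H. rewrite !rp_pos by lra.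
  unfold Rpower. destruct (Req_dec x y) as [->|ne]; [lra|].
  assert (ln x < ln y) by (apply ln_increasing; lra).
  destruct (Rle_lt_or_eq_dec (a * ln y) (a * ln x)) as [lt|e]; [nra| |].
  - apply Rlt_le, exp_increasing. assumption.
  - rewrite e. lra.
Qed.

Lemma rp_le_1 a x : 0 <= a -> x <= 1 -> rp a x <= 1.
Proof.
  intros Ha H. eapply Rle_trans; [apply (rp_mono a x 1); assumption|].
  rewrite rp_pos by lra. unfold Rpower. rewrite ln_1, Rmult_0_r, exp_0. lra.
Qed.

Lemma rp_derive a x : 0 < x -> is_derive (rp a) x (a * rp (a - 1) x).
Proof.
  intros Hx. apply (is_derive_ext_loc (fun y => Rpower y a)).
  - exists (mkposreal x Hx). intros y Hy. apply (Rabs_def2 (y - x)) in Hy. simpl in Hy.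
    rewrite rp_pos; [reflexivity|lra].
  - rewrite rp_pos by assumption. apply is_derive_Reals. apply derivable_pt_lim_power. assumption.
Qed.

Lemma rp_derive_neg a x : x < 0 -> is_derive (rp a) x 0.
Proof.
  intros Hx. apply (is_derive_ext_loc (fun y => 0)).
  - assert (h : 0 < - x) by lra. exists (mkposreal (- x) h). intros y Hy.
    apply (Rabs_def2 (y - x)) in Hy. simpl in Hy. rewrite rp_npos; [reflexivity|lra].
  - apply (is_derive_const (K := R_AbsRing) (V := R_NormedModule)).
Qed.

Lemma rp_small a eps : 0 < a -> 0 < eps -> rp a (rp (/ a) eps) = eps.
Proof.
  intros Ha He. rewrite (rp_pos (/ a)) by assumption.
  rewrite rp_pos by apply exp_pos. rewrite Rpower_mult, Rinv_l by lra. apply Rpower_1. assumption.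
Qed.

Lemma rp_continuous a x : 0 < a -> continuous (rp a) x.
Proof.
  intros Ha. destruct (Rtotal_order x 0) as [h|[->|h]].
  - apply (ex_derive_continuous (rp a)). exists 0. apply rp_derive_neg. assumption.
  - apply (filterlim_locally (rp a)). intros [eps He].
    exists (mkposreal _ (rp_gt0 (/ a) (eps / 2) ltac:(lra))). intros y Hy.
    apply (Rabs_def2 (y - 0)) in Hy. simpl in Hy.
    change (Rabs (rp a y - rp a 0) < eps). rewrite (rp_npos a 0), Rminus_0_r by lra.
    rewrite Rabs_pos_eq by apply rp_ge0.
    apply Rle_lt_trans with (rp a (rp (/ a) (eps / 2))).
    + apply rp_mono; lra.
    + rewrite rp_small; lra.
  - apply (ex_derive_continuous (rp a)). eexists. apply rp_derive. assumption.
Qed.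

Lemma rp_subadd a s t : 0 < a <= 1 -> 0 <= s -> 0 <= t -> rp a (s + t) <= rp a s + rp a t.
Proof.
  intros Ha Hs Ht.
  destruct (Req_dec s 0) as [->|s0]; [rewrite Rplus_0_l, (rp_npos a 0) by lra; lra|].
  destruct (Req_dec t 0) as [->|t0]; [rewrite Rplus_0_r, (rp_npos a 0) by lra; lra|].
  assert (E : forall x, 0 < x -> rp a x = x * rp (a - 1) x).
  { intros x Hx. replace a with (1 + (a - 1)) at 1 by ring. rewrite rp_plus, rp_1 by assumption. reflexivity. }
  rewrite !E by lra.
  pose proof (rp_anti (a - 1) s (s + t) ltac:(lra) ltac:(lra)).
  pose proof (rp_anti (a - 1) t (s + t) ltac:(lra) ltac:(lra)). nra.
Qed.

Lemma continuous_cont_on F a b : (forall x, a <= x <= b -> continuous F x) -> cont_on F a b.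
Proof.
  intros H x Hx e e0.
  destruct (proj1 (filterlim_locally F (F x)) (H x Hx) (mkposreal e e0)) as [[d d0] Hd].
  exists d. split; [assumption|]. intros y _ Hy. apply Hd. exact Hy.
Qed.

(** Decouples the singularity of the kernel on the diagonal from that of the density at the origin:
    the smaller of [x] and [y] takes the whole exponent [-7/8], which is still integrable. *)
Lemma rp_mixed x y : 0 < x -> 0 < y ->
  rp (-(1/8)) x * rp (-(3/4)) y <= rp (-(7/8)) y + rp (-(7/8)) x.
Proof.
  intros Hx Hy.
  replace (-(7/8)) with (-(1/8) + -(3/4)) by field. rewrite !rp_plus by assumption.
  pose proof (rp_gt0 (-(1/8)) x Hx). pose proof (rp_gt0 (-(1/8)) y Hy).
  pose proof (rp_gt0 (-(3/4)) x Hx). pose proof (rp_gt0 (-(3/4)) y Hy).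
  destruct (Rle_dec x y).
  - pose proof (rp_anti (-(3/4)) x y ltac:(lra) ltac:(lra)). nra.
  - pose proof (rp_anti (-(1/8)) y x ltac:(lra) ltac:(lra)). nra.
Qed.

Lemma PI_ge_3 : 3 <= PI.
Proof. pose proof PI2_3_2. lra. Qed.

(** * Integrable majorants with singularities at the origin and on the diagonal *)

Definition sing (p s : R) := rp (-(7/8)) s + rp (-(7/8)) (Rabs (s - p)).
(** Since [rp] vanishes on negative numbers, the last two terms form the odd primitive of
    [|s - p|^(-7/8)] without a case distinction. *)
Definition sing_prim (p s : R) := 8 * rp (1/8) s + 8 * rp (1/8) (s - p) - 8 * rp (1/8) (p - s).

Lemma sing_prim_continuous p s : continuous (sing_prim p) s.
Proof.
  assert (C : forall g : R -> R, continuous g s -> continuous (fun s => 8 * rp (1/8) (g s)) s).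
  { intros g Hg. apply (continuous_scal_r 8 (fun s => rp (1/8) (g s))).
    apply (continuous_comp g (rp (1/8))); [assumption|]. apply rp_continuous. lra. }
  apply (continuous_minus (fun s => 8 * rp (1/8) s + 8 * rp (1/8) (s - p)) (fun s => 8 * rp (1/8) (p - s))).
  - apply (continuous_plus (fun s => 8 * rp (1/8) s) (fun s => 8 * rp (1/8) (s - p))).
    + apply (C (fun s => s)). apply continuous_id.
    + apply (C (fun s => s - p)). apply (ex_derive_continuous (fun s => s - p)). auto_derive. exact I.
  - apply (C (fun s => p - s)). apply (ex_derive_continuous (fun s => p - s)). auto_derive. exact I.
Qed.

Lemma sing_prim_derive p s : 0 < s -> s <> p -> is_derive (sing_prim p) s (sing p s).
Proof.
  intros Hs Hp.
  assert (D1 : is_derive (fun s => 8 * rp (1/8) s) s (rp (-(7/8)) s)).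
  { replace (rp (-(7/8)) s) with (8 * (1/8 * rp (1/8 - 1) s)) by (replace (1/8 - 1) with (-(7/8)) by field; field).
    apply (is_derive_scal (rp (1/8)) s 8). apply rp_derive. assumption. }
  assert (D2 : is_derive (fun s => 8 * rp (1/8) (s - p)) s (if Rlt_dec p s then rp (-(7/8)) (s - p) else 0)).
  { apply is_derive_eq with (8 * (1 * (if Rlt_dec p s then 1/8 * rp (1/8 - 1) (s - p) else 0))).
    - apply (is_derive_scal (fun s => rp (1/8) (s - p)) s 8).
      apply (is_derive_comp (rp (1/8)) (fun s => s - p)).
      + destruct Rlt_dec; [apply rp_derive; lra|apply rp_derive_neg; lra].
      + auto_derive; [exact I|ring].
    - destruct Rlt_dec; [|ring]. replace (1/8 - 1) with (-(7/8)) by field. field. }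
  assert (D3 : is_derive (fun s => 8 * rp (1/8) (p - s)) s (if Rlt_dec p s then 0 else - rp (-(7/8)) (p - s))).
  { apply is_derive_eq with (8 * (-1 * (if Rlt_dec p s then 0 else 1/8 * rp (1/8 - 1) (p - s)))).
    - apply (is_derive_scal (fun s => rp (1/8) (p - s)) s 8).
      apply (is_derive_comp (rp (1/8)) (fun s => p - s)).
      + destruct Rlt_dec; [apply rp_derive_neg; lra|apply rp_derive; lra].
      + auto_derive; [exact I|ring].
    - destruct Rlt_dec; [ring|]. replace (1/8 - 1) with (-(7/8)) by field. field. }
  pose proof (is_derive_minus _ _ _ _ _ (is_derive_plus _ _ _ _ _ D1 D2) D3) as D.
  unfold sing_prim. unfold sing.
  eapply is_derive_eq.
  - exact D.
  - unfold minus, plus, opp; simpl. destruct Rlt_dec.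
    + rewrite Rabs_pos_eq by lra. ring.
    + rewrite Rabs_left by lra. replace (-(s - p)) with (p - s) by ring. ring.
Qed.

Lemma sing_prim_total p : 0 <= p <= PI / 2 -> 0 <= sing_prim p (PI / 2) - sing_prim p 0 <= 48.
Proof.
  intros Hp. unfold sing_prim. pose proof PI_4. pose proof PI_ge_3.
  rewrite (rp_npos _ 0), (rp_npos _ (0 - p)), (rp_npos _ (p - PI / 2)) by lra.
  assert (B : forall x, x <= 2 -> 0 <= rp (1/8) x <= 2).
  { intros x Hx. split; [apply rp_ge0|].
    eapply Rle_trans; [apply (rp_mono (1/8) x 2); lra|].
    rewrite <- (rp_1 2) at 2 by lra. rewrite !rp_pos by lra. apply Rle_Rpower; lra. }
  pose proof (B (PI / 2) ltac:(lra)). pose proof (B (PI / 2 - p) ltac:(lra)).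
  pose proof (B (p - 0) ltac:(lra)). lra.
Qed.

Lemma HK_sing p : 0 <= p <= PI / 2 -> exists I, HK (sing p) 0 (PI / 2) I /\ 0 <= I <= 48.
Proof.
  intros Hp. exists (sing_prim p (PI / 2) - sing_prim p 0). split; [|apply sing_prim_total; assumption].
  apply (HK_FTC (sing_prim p) (sing p) (0 :: p :: nil)).
  - pose proof PI_ge_3; lra.
  - apply continuous_cont_on. intros; apply sing_prim_continuous.
  - intros x Hx Hn. simpl in Hn. apply sing_prim_derive.
    + destruct (Req_dec x 0) as [->|]; [tauto|lra].
    + intros ->. tauto.
Qed.

Lemma HK_singular f p C : 0 < p < PI / 2 -> 0 <= C ->
  (forall s, 0 < s < PI / 2 -> s <> p -> continuous f s) ->
  (forall s, 0 < s < PI / 2 -> s <> p -> 0 <= f s <= C * sing p s) ->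
  exists I, HK f 0 (PI / 2) I.
Proof.
  intros Hp HC Cf Hf.
  assert (P : forall u v, 0 <= u -> u < v -> v <= PI / 2 -> ~ (u < p < v) -> exists I, HK f u v I).
  { intros u v h1 h2 h3 h4.
    destruct (improper_primitive f (fun s => C * sing p s) (fun s => C * sing_prim p s) u v h2) as [F [F0 [CF [DF _]]]].
    - intros x Hx. apply Cf; [lra|]. intros ->. tauto.
    - intros x Hx. apply Hf; [lra|]. intros ->. tauto.
    - intros x Hx. apply (is_derive_scal (sing_prim p) x C). apply sing_prim_derive; [lra|]. intros ->. tauto.
    - apply continuous_cont_on. intros x _. apply (continuous_scal_r C (sing_prim p)). apply sing_prim_continuous.
    - exists (F v - F u). apply (HK_FTC_open F f u v); auto; lra. }
  destruct (P 0 p) as [I1 H1]; try lra. destruct (P p (PI / 2)) as [I2 H2]; try lra.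
  exists (I1 + I2). apply (HK_concat f 0 p); assumption.
Qed.

(** * Size and Hoelder continuity of the kernel *)

Lemma x_cos_le_sin x : 0 <= x <= PI / 2 -> x * cos x <= sin x.
Proof.
  intros Hx. destruct (Req_dec x 0) as [->|x0]; [rewrite sin_0; lra|].
  destruct (MVT_cor2 sin cos 0 x ltac:(lra)) as [c [Hc1 Hc2]].
  { intros c _. apply derivable_pt_lim_sin. }
  rewrite sin_0 in Hc1. assert (cos x <= cos c) by (apply cos_decr_1; lra). nra.
Qed.

(** With [x = 2 y], [sin (2 y) = 2 sin y cos y >= 2 y cos^2 y], and [cos^2 y >= 1/2] for
    [y <= PI / 4]. *)
Lemma sin_ge_half x : 0 <= x <= PI / 2 -> x / 2 <= sin x.
Proof.
  intros Hx. set (y := x / 2).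
  assert (Hy : 0 <= y <= PI / 4) by (unfold y; lra). pose proof PI_ge_3.
  assert (c0 : / 2 <= (cos y) ^ 2).
  { assert (C : cos (PI / 4) <= cos y) by (apply cos_decr_1; lra).
    rewrite cos_PI4 in C. assert (S : sqrt 2 * sqrt 2 = 2) by (apply sqrt_sqrt; lra).
    assert (0 < sqrt 2) by (apply sqrt_lt_R0; lra).
    assert (E : (1 / sqrt 2) ^ 2 = / 2).
    { replace ((1 / sqrt 2) ^ 2) with (/ (sqrt 2 * sqrt 2)) by (field; lra). rewrite S. reflexivity. }
    rewrite <- E. apply pow_incr. split; [|assumption]. apply Rlt_le, Rdiv_lt_0_compat; lra. }
  pose proof (x_cos_le_sin y ltac:(lra)) as s0.
  replace x with (2 * y) by (unfold y; field). rewrite sin_2a.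
  assert (0 <= cos y) by (apply cos_ge_0; lra). simpl in c0. nra.
Qed.

Lemma sin_diff_ge s p : 0 <= s <= PI / 2 -> 0 <= p <= PI / 2 -> Rabs (s - p) / 2 <= Rabs (sin (s - p)).
Proof.
  intros Hs Hp. destruct (Rle_dec p s).
  - rewrite (Rabs_pos_eq (s - p)) by lra. eapply Rle_trans; [|apply Rle_abs]. apply sin_ge_half. lra.
  - rewrite (Rabs_left1 (s - p)) by lra. replace (s - p) with (-(p - s)) by ring.
    rewrite sin_neg, Rabs_Ropp, Ropp_involutive. eapply Rle_trans; [|apply Rle_abs]. apply sin_ge_half. lra.
Qed.

Lemma sin_diff_le_sum s p : 0 <= s <= PI / 2 -> 0 <= p <= PI / 2 -> Rabs (sin (s - p)) <= sin (s + p).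
Proof.
  intros Hs Hp. rewrite sin_plus, sin_minus.
  assert (0 <= sin s) by (apply sin_ge_0; lra). assert (0 <= sin p) by (apply sin_ge_0; lra).
  assert (0 <= cos s) by (apply cos_ge_0; lra). assert (0 <= cos p) by (apply cos_ge_0; lra).
  apply Rabs_le. nra.
Qed.

Lemma Kker_log s p : 0 <= s <= PI / 2 -> 0 <= p <= PI / 2 -> s <> p ->
  0 < Rabs (sin (s - p)) /\ Kker s p = ln (sin (s + p)) - ln (Rabs (sin (s - p))).
Proof.
  intros Hs Hp ne.
  assert (pos : 0 < Rabs (sin (s - p))).
  { pose proof (sin_diff_ge s p Hs Hp). assert (0 < Rabs (s - p)) by (apply Rabs_pos_lt; lra). lra. }
  split; [assumption|]. unfold Kker. destruct Req_EM_T; [contradiction|].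
  pose proof (sin_diff_le_sum s p Hs Hp).
  rewrite Rabs_div.
  - rewrite ln_div; [|apply Rabs_pos_lt; lra|assumption]. rewrite (Rabs_pos_eq (sin (s + p))) by lra. reflexivity.
  - intros e. rewrite e, Rabs_R0 in pos. lra.
Qed.

Lemma Kker_ge0 s p : 0 <= s <= PI / 2 -> 0 <= p <= PI / 2 -> 0 <= Kker s p.
Proof.
  intros Hs Hp. destruct (Req_EM_T s p) as [e|ne].
  - unfold Kker. destruct Req_EM_T; [lra|contradiction].
  - destruct (Kker_log s p Hs Hp ne) as [pos ->]. pose proof (sin_diff_le_sum s p Hs Hp).
    assert (ln (Rabs (sin (s - p))) <= ln (sin (s + p))) by (apply ln_le; assumption). lra.
Qed.

Lemma Kker_p0 s : Kker s 0 = 0.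
Proof.
  unfold Kker. destruct Req_EM_T; [reflexivity|]. rewrite Rplus_0_r, Rminus_0_r.
  destruct (Req_dec (sin s) 0) as [->|ne].
  (* Degenerate case: the numerator of the quotient vanishes, and [ln 0] is [0] by convention. *)
  - unfold Rdiv. rewrite Rmult_0_l, Rabs_R0. unfold ln. destruct Rlt_dec as [h|h]; [exfalso; lra|reflexivity].
  - rewrite Rdiv_diag by assumption. rewrite Rabs_R1. apply ln_1.
Qed.

Lemma Kker_pPI2 s : Kker s (PI / 2) = 0.
Proof.
  unfold Kker. destruct Req_EM_T; [reflexivity|].
  replace (sin (s + PI / 2)) with (cos s) by (rewrite sin_plus, cos_PI2, sin_PI2; ring).
  replace (sin (s - PI / 2)) with (- cos s) by (rewrite sin_minus, cos_PI2, sin_PI2; ring).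
  destruct (Req_dec (cos s) 0) as [->|ne].
  - unfold Rdiv. rewrite Rmult_0_l, Rabs_R0. unfold ln. destruct Rlt_dec as [h|h]; [exfalso; lra|reflexivity].
  - replace (cos s / - cos s) with (-1) by (field; assumption).
    rewrite Rabs_m1. apply ln_1.
Qed.

(** Let [w] be the eighth root of [(x - y) / y]. Then [x / y = 1 + w^8 <= (1 + w)^8 <= exp (8 w)].
    This one inequality gives both the singularity exponent and the Hoelder exponent of the
    kernel. *)
Lemma ln_diff_bound x y : 0 < y <= x -> ln x - ln y <= 8 * (rp (1/8) (x - y) * rp (-(1/8)) y).
Proof.
  intros H. destruct (Req_dec x y) as [->|ne].
  { rewrite !Rminus_diag, (rp_npos _ 0) by lra. lra. }
  set (w := rp (1/8) (x - y) * rp (-(1/8)) y).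
  assert (w0 : 0 < w) by (apply Rmult_lt_0_compat; apply rp_gt0; lra).
  assert (w8 : w ^ 8 = (x - y) / y).
  { unfold w. rewrite Rpow_mult_distr, !rp_pos by lra.
    rewrite <- !Rpower_pow by apply exp_pos. rewrite !Rpower_mult.
    replace (1/8 * INR 8) with 1 by (simpl; field). replace (-(1/8) * INR 8) with (Ropp 1) by (simpl; field).
    rewrite Rpower_Ropp, !Rpower_1 by lra. reflexivity. }
  rewrite <- ln_div by lra. replace (x / y) with (1 + w ^ 8) by (rewrite w8; field; lra).
  rewrite <- (ln_exp (8 * w)). apply ln_le; [pose proof (pow_lt w 8 w0); lra|].
  replace (8 * w) with (INR 8 * w) by (simpl; ring).
  assert (E : exp (INR 8 * w) = exp w ^ 8).
  { rewrite <- Rpower_pow by apply exp_pos. unfold Rpower. rewrite ln_exp. reflexivity. }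
  rewrite E. apply Rle_trans with ((1 + w) ^ 8).
  - simpl. nra.
  - apply pow_incr. split; [lra|]. apply exp_ineq1_le.
Qed.

Lemma rp_half_inv d x : 0 < d -> d / 2 <= x -> rp (-(1/8)) x <= 2 * rp (-(1/8)) d.
Proof.
  intros Hd H. eapply Rle_trans; [apply (rp_anti (-(1/8)) (d / 2) x); lra|].
  unfold Rdiv at 2. rewrite Rmult_comm, rp_mult by lra.
  apply Rmult_le_compat_r; [apply rp_ge0|]. rewrite rp_pos by lra.
  rewrite Rpower_Ropp. rewrite <- (Rinv_inv 2) at 2. apply Rinv_le_contravar; [lra|].
  rewrite <- (Rpower_1 (/ 2)) at 1 by lra. unfold Rpower.
  assert (ln (/ 2) < 0) by (rewrite <- ln_1; apply ln_increasing; lra).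
  apply Rlt_le, exp_increasing. lra.
Qed.

Lemma Kker_bound s p : 0 <= s <= PI / 2 -> 0 <= p <= PI / 2 -> s <> p ->
  Kker s p <= 16 * rp (-(1/8)) (Rabs (s - p)).
Proof.
  intros Hs Hp ne. destruct (Kker_log s p Hs Hp ne) as [pos ->].
  pose proof (sin_diff_le_sum s p Hs Hp). pose proof (sin_diff_ge s p Hs Hp).
  assert (0 < Rabs (s - p)) by (apply Rabs_pos_lt; lra).
  pose proof (ln_diff_bound (sin (s + p)) (Rabs (sin (s - p))) ltac:(lra)) as h.
  assert (h1 : rp (1/8) (sin (s + p) - Rabs (sin (s - p))) <= 1).
  { apply rp_le_1; [lra|]. pose proof (SIN_bound (s + p)). lra. }
  pose proof (rp_half_inv (Rabs (s - p)) _ ltac:(lra) H0) as h2.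
  pose proof (rp_ge0 (1/8) (sin (s + p) - Rabs (sin (s - p)))).
  pose proof (rp_ge0 (-(1/8)) (Rabs (sin (s - p)))). nra.
Qed.

Lemma ln_dist x y t d e : 0 < d -> 0 < e -> d / 2 <= x -> e / 2 <= y -> Rabs (x - y) <= t ->
  Rabs (ln x - ln y) <= 16 * rp (1/8) t * (rp (-(1/8)) d + rp (-(1/8)) e).
Proof.
  intros Hd He hx hy ht.
  assert (W : forall x y d e, 0 < d -> 0 < e -> d / 2 <= x -> e / 2 <= y -> y <= x -> x - y <= t ->
     Rabs (ln x - ln y) <= 16 * rp (1/8) t * (rp (-(1/8)) d + rp (-(1/8)) e)).
  { clear. intros x y d e Hd He hx hy xy ht.
    assert (ln y <= ln x) by (apply ln_le; lra). rewrite Rabs_pos_eq by lra.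
    pose proof (ln_diff_bound x y ltac:(lra)) as h.
    pose proof (rp_half_inv e y He hy). pose proof (rp_mono (1/8) (x - y) t ltac:(lra) ht).
    pose proof (rp_ge0 (1/8) (x - y)). pose proof (rp_ge0 (-(1/8)) y). pose proof (rp_ge0 (-(1/8)) d).
    pose proof (rp_ge0 (-(1/8)) e).
    assert (rp (1/8) (x - y) * rp (-(1/8)) y <= rp (1/8) t * (2 * rp (-(1/8)) e))
      by (apply Rmult_le_compat; lra).
    assert (0 <= rp (1/8) t * rp (-(1/8)) d) by (apply Rmult_le_pos; [apply rp_ge0|lra]). lra. }
  destruct (Rle_dec y x).
  - rewrite Rabs_pos_eq in ht by lra. apply W; auto.
  - rewrite Rabs_minus_sym. rewrite (Rplus_comm (rp _ d)). rewrite Rabs_left1 in ht by lra. apply W; auto; lra.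
Qed.

Lemma sin_lipschitz x y : Rabs (sin x - sin y) <= Rabs (x - y).
Proof.
  destruct (MVT_gen sin y x cos) as [c [_ E]].
  - intros z _. apply is_derive_Reals. apply derivable_pt_lim_sin.
  - intros z _. apply continuity_sin.
  - rewrite E, Rabs_mult. pose proof (COS_bound c).
    assert (Rabs (cos c) <= 1) by (apply Rabs_le; lra). pose proof (Rabs_pos (x - y)). nra.
Qed.

(** The arguments [sin (s + p)] and [|sin (s - p)|] of the two logarithms are 1-Lipschitz in [p] and
    at least [|s - p| / 2]. *)
Lemma Kker_holder s p q : 0 <= s <= PI / 2 -> 0 <= p <= PI / 2 -> 0 <= q <= PI / 2 -> s <> p -> s <> q ->
  Rabs (Kker s p - Kker s q) <=
  32 * rp (1/8) (Rabs (p - q)) * (rp (-(1/8)) (Rabs (s - p)) + rp (-(1/8)) (Rabs (s - q))).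
Proof.
  intros Hs Hp Hq np nq.
  destruct (Kker_log s p Hs Hp np) as [pp ->]. destruct (Kker_log s q Hs Hq nq) as [pq ->].
  pose proof (sin_diff_le_sum s p Hs Hp). pose proof (sin_diff_ge s p Hs Hp).
  pose proof (sin_diff_le_sum s q Hs Hq). pose proof (sin_diff_ge s q Hs Hq).
  assert (dp : 0 < Rabs (s - p)) by (apply Rabs_pos_lt; lra).
  assert (dq : 0 < Rabs (s - q)) by (apply Rabs_pos_lt; lra).
  assert (t1 : Rabs (sin (s + p) - sin (s + q)) <= Rabs (p - q)).
  { eapply Rle_trans; [apply sin_lipschitz|]. right. f_equal. ring. }
  assert (t2 : Rabs (Rabs (sin (s - p)) - Rabs (sin (s - q))) <= Rabs (p - q)).
  { eapply Rle_trans; [apply Rabs_triang_inv2|]. eapply Rle_trans; [apply sin_lipschitz|].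
    right. rewrite Rabs_minus_sym. f_equal. ring. }
  pose proof (ln_dist (sin (s + p)) (sin (s + q)) _ _ _ dp dq ltac:(lra) ltac:(lra) t1) as h1.
  pose proof (ln_dist (Rabs (sin (s - p))) (Rabs (sin (s - q))) _ _ _ dp dq ltac:(lra) ltac:(lra) t2) as h2.
  apply Rabs_le_between in h1. apply Rabs_le_between in h2. apply Rabs_le. lra.
Qed.

Lemma ln_sqr x : x <> 0 -> ln (x ^ 2) = 2 * ln (Rabs x).
Proof.
  intros H. rewrite <- (pow2_abs x). assert (0 < Rabs x) by (apply Rabs_pos_lt; assumption).
  simpl. rewrite Rmult_1_r, ln_mult by assumption. ring.
Qed.

Lemma Kker_continuous s p : 0 < s < PI / 2 -> 0 <= p <= PI / 2 -> s <> p -> continuous (fun s => Kker s p) s.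
Proof.
  intros Hs Hp ne.
  (* The logarithm of the square, halved, replaces the logarithm of the absolute value, so that one
     formula is differentiable on both sides of the diagonal. *)
  apply (continuous_ext_loc _ (fun s => ln (sin (s + p)) - / 2 * ln ((sin (s - p)) ^ 2))).
  - assert (h : 0 < Rmin (Rabs (s - p)) (Rmin s (PI / 2 - s))).
    { apply Rmin_glb_lt; [apply Rabs_pos_lt; lra|]. apply Rmin_glb_lt; lra. }
    exists (mkposreal _ h). intros y Hy. change (Rabs (y - s) < Rmin (Rabs (s - p)) (Rmin s (PI / 2 - s))) in Hy.
    pose proof (Rmin_l (Rabs (s - p)) (Rmin s (PI / 2 - s))).
    pose proof (Rmin_r (Rabs (s - p)) (Rmin s (PI / 2 - s))).
    pose proof (Rmin_l s (PI / 2 - s)). pose proof (Rmin_r s (PI / 2 - s)).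
    assert (y <> p). { intros ->. rewrite Rabs_minus_sym in Hy. lra. }
    apply Rabs_def2 in Hy.
    destruct (Kker_log y p ltac:(lra) Hp H3) as [pos ->].
    rewrite ln_sqr; [|intros e; rewrite e, Rabs_R0 in pos; lra]. lra.
  - destruct (Kker_log s p ltac:(lra) Hp ne) as [pos _].
    pose proof (sin_diff_le_sum s p ltac:(lra) Hp).
    apply (ex_derive_continuous (fun s => ln (sin (s + p)) - / 2 * ln ((sin (s - p)) ^ 2))).
    auto_derive. split; [lra|]. split; [|exact I].
    assert (sin (s - p) <> 0) by (intros e; rewrite e, Rabs_R0 in pos; lra).
    pose proof (pow2_gt_0 _ H0) as h. replace (s + - p) with (s - p) by ring. simpl in h. lra.
Qed.

(** * The operator [Hop] on densities with a power singularity at the origin *)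

Definition adm (M : R) (z : R -> R) := 0 <= M /\ forall s, 0 < s < PI / 2 ->
  continuous z s /\ 0 <= z s <= M * rp (-(3/4)) s.

Lemma Kker_adm M z s p : adm M z -> 0 < s < PI / 2 -> 0 <= p <= PI / 2 -> s <> p ->
  0 <= Kker s p * z s <= (16 * M) * sing p s.
Proof.
  intros [M0 Hz] Hs Hp ne. destruct (Hz s Hs) as [_ [z0 zM]].
  pose proof (Kker_ge0 s p ltac:(lra) Hp) as k0. pose proof (Kker_bound s p ltac:(lra) Hp ne) as k1.
  assert (0 < Rabs (s - p)) by (apply Rabs_pos_lt; lra).
  pose proof (rp_mixed (Rabs (s - p)) s ltac:(lra) ltac:(lra)) as m. fold (sing p s) in m.
  split; [apply Rmult_le_pos; assumption|].
  apply Rle_trans with ((16 * rp (-(1/8)) (Rabs (s - p))) * (M * rp (-(3/4)) s)).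
  - apply Rmult_le_compat; lra.
  - replace (16 * rp (-(1/8)) (Rabs (s - p)) * (M * rp (-(3/4)) s))
      with ((16 * M) * (rp (-(1/8)) (Rabs (s - p)) * rp (-(3/4)) s)) by ring.
    apply Rmult_le_compat_l; lra.
Qed.

Lemma HK_Hop M z p : adm M z -> 0 <= p <= PI / 2 ->
  HK (fun s => Kker s p * z s) 0 (PI / 2) (PI * Hop z p).
Proof.
  intros Hz Hp. pose proof PI_ge_3 as P3.
  assert (ex : exists I, HK (fun s => Kker s p * z s) 0 (PI / 2) I).
  { destruct (Req_dec p 0) as [->|p0].
    { exists 0. apply (HK_zero_except _ nil); [lra|]. intros x _ _. rewrite Kker_p0. ring. }
    destruct (Req_dec p (PI / 2)) as [->|p1].
    { exists 0. apply (HK_zero_except _ nil); [lra|]. intros x _ _. rewrite Kker_pPI2. ring. }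
    apply (HK_singular _ p (16 * M)); [lra|destruct Hz; lra| |].
    - intros s Hs ne. apply (continuous_mult (fun s => Kker s p) z).
      + apply Kker_continuous; auto; lra.
      + apply Hz. assumption.
    - intros s Hs ne. apply Kker_adm; auto; lra. }
  destruct ex as [I HI]. unfold Hop. rewrite (HKint_eq _ _ _ _ HI).
  replace (PI * (/ PI * I)) with I by (field; lra). assumption.
Qed.

Lemma Hop_bound M z p : adm M z -> 0 <= p <= PI / 2 -> 0 <= Hop z p <= 256 * M.
Proof.
  intros Hz Hp. pose proof (HK_Hop M z p Hz Hp) as H. pose proof PI_ge_3 as P3.
  destruct (HK_sing p Hp) as [J [HJ BJ]].
  assert (h0 : 0 <= PI * Hop z p).
  { apply (HK_le_except (fun _ => 0) (fun s => Kker s p * z s) (0 :: p :: PI / 2 :: nil) 0 (PI / 2)); [| |assumption].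
    - intros s Hs Hn. simpl in Hn. apply (Kker_adm M z); auto; try (intros ->; tauto).
      destruct (Req_dec s 0) as [->|]; [tauto|]. destruct (Req_dec s (PI / 2)) as [->|]; [tauto|]. lra.
    - apply (HK_zero_except _ nil); [lra|]. reflexivity. }
  assert (h1 : PI * Hop z p <= 16 * M * J).
  { apply (HK_le_except (fun s => Kker s p * z s) (fun s => 16 * M * sing p s) (0 :: p :: PI / 2 :: nil) 0 (PI / 2)); [|assumption|].
    - intros s Hs Hn. simpl in Hn. apply (Kker_adm M z); auto; try (intros ->; tauto).
      destruct (Req_dec s 0) as [->|]; [tauto|]. destruct (Req_dec s (PI / 2)) as [->|]; [tauto|]. lra.
    - apply HK_scal. assumption. }
  destruct Hz as [M0 _].
  assert (0 <= Hop z p) by (apply Rmult_le_reg_l with PI; lra).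
  split; [assumption|]. nra.
Qed.

Lemma Hop_0 z : Hop z 0 = 0.
Proof.
  unfold Hop. rewrite (HKint_eq _ _ _ 0); [ring|].
  apply (HK_zero_except _ nil); [pose proof PI_ge_3; lra|]. intros x _ _. rewrite Kker_p0. ring.
Qed.

Lemma Hop_PI2 z : Hop z (PI / 2) = 0.
Proof.
  unfold Hop. rewrite (HKint_eq _ _ _ 0); [ring|].
  apply (HK_zero_except _ nil); [pose proof PI_ge_3; lra|]. intros x _ _. rewrite Kker_pPI2. ring.
Qed.

Lemma Hop_holder M z p q : adm M z -> 0 <= p <= PI / 2 -> 0 <= q <= PI / 2 ->
  Rabs (Hop z p - Hop z q) <= 1024 * M * rp (1/8) (Rabs (p - q)).
Proof.
  intros Hz Hp Hq. pose proof PI_ge_3 as P3.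
  (* The factor [96] is twice [48], one bound for each of the two singular majorants; dividing
     [32 * 96] by [PI >= 3] leaves [1024]. *)
  assert (W : forall p q, 0 <= p <= PI / 2 -> 0 <= q <= PI / 2 ->
     PI * Hop z p <= PI * Hop z q + 32 * M * rp (1/8) (Rabs (p - q)) * 96).
  { clear p q Hp Hq. intros p q Hp Hq.
    destruct (HK_sing p Hp) as [J [HJ BJ]]. destruct (HK_sing q Hq) as [J' [HJ' BJ']].
    set (B := 32 * M * rp (1/8) (Rabs (p - q))).
    assert (B0 : 0 <= B).
    { unfold B. destruct Hz as [M0 _]. apply Rmult_le_pos; [lra|apply rp_ge0]. }
    apply Rle_trans with (PI * Hop z q + (B * J + B * J')); [|nra].
    apply (HK_le_except (fun s => Kker s p * z s)
      (fun s => Kker s q * z s + (B * sing p s + B * sing q s)) (0 :: p :: q :: PI / 2 :: nil) 0 (PI / 2)).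
    - intros s Hs Hn. simpl in Hn.
      assert (Hs' : 0 < s < PI / 2).
      { destruct (Req_dec s 0) as [->|]; [tauto|]. destruct (Req_dec s (PI / 2)) as [->|]; [tauto|]. lra. }
      assert (np : s <> p) by (intros ->; tauto). assert (nq : s <> q) by (intros ->; tauto).
      pose proof (Kker_holder s p q ltac:(lra) Hp Hq np nq) as h. apply Rabs_le_between in h.
      destruct Hz as [M0 Hz]. destruct (Hz s Hs') as [_ [z0 zM]].
      assert (dp : 0 < Rabs (s - p)) by (apply Rabs_pos_lt; lra).
      assert (dq : 0 < Rabs (s - q)) by (apply Rabs_pos_lt; lra).
      pose proof (rp_mixed (Rabs (s - p)) s dp ltac:(lra)) as m1. fold (sing p s) in m1.
      pose proof (rp_mixed (Rabs (s - q)) s dq ltac:(lra)) as m2. fold (sing q s) in m2.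
      set (X := rp (-(1/8)) (Rabs (s - p))) in *. set (Y := rp (-(1/8)) (Rabs (s - q))) in *.
      set (T := rp (1/8) (Rabs (p - q))) in *. set (Z := rp (-(3/4)) s) in *.
      assert (0 <= X) by apply rp_ge0. assert (0 <= Y) by apply rp_ge0. assert (0 <= T) by apply rp_ge0.
      assert (e1 : Kker s p * z s - Kker s q * z s <= 32 * T * (X + Y) * z s).
      { rewrite <- Rmult_minus_distr_r. apply Rmult_le_compat_r; lra. }
      assert (e2 : 32 * T * (X + Y) * z s <= 32 * T * (X + Y) * (M * Z)).
      { apply Rmult_le_compat_l; [|assumption]. apply Rmult_le_pos; lra. }
      assert (e3 : 32 * T * (X + Y) * (M * Z) = B * (X * Z) + B * (Y * Z)) by (unfold B; ring).
      assert (B * (X * Z) <= B * sing p s) by (apply Rmult_le_compat_l; assumption).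
      assert (B * (Y * Z) <= B * sing q s) by (apply Rmult_le_compat_l; assumption). lra.
    - apply (HK_Hop M); assumption.
    - apply HK_plus; [apply (HK_Hop M); assumption|]. apply HK_plus; apply HK_scal; assumption. }
  pose proof (W p q Hp Hq) as w1. pose proof (W q p Hq Hp) as w2. rewrite (Rabs_minus_sym q p) in w2.
  assert (T0 : 0 <= M * rp (1/8) (Rabs (p - q))) by (apply Rmult_le_pos; [apply Hz|apply rp_ge0]).
  apply Rabs_le. split; apply Rmult_le_reg_l with PI; nra.
Qed.

Lemma Hop_dist M z w e p : adm M z -> adm M w -> 0 <= e ->
  (forall s, 0 < s < PI / 2 -> Rabs (z s - w s) <= e * rp (-(3/4)) s) -> 0 <= p <= PI / 2 ->
  Rabs (Hop z p - Hop w p) <= 256 * e.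
Proof.
  intros Hz Hw e0 Hd Hp. pose proof PI_ge_3 as P3.
  assert (W : forall z w, adm M z -> adm M w ->
     (forall s, 0 < s < PI / 2 -> Rabs (z s - w s) <= e * rp (-(3/4)) s) ->
     PI * Hop z p <= PI * Hop w p + (16 * e) * 48).
  { clear z w Hz Hw Hd. intros z w Hz Hw Hd.
    destruct (HK_sing p Hp) as [J [HJ BJ]].
    apply Rle_trans with (PI * Hop w p + (16 * e) * J); [|nra].
    apply (HK_le_except (fun s => Kker s p * z s) (fun s => Kker s p * w s + (16 * e) * sing p s)
       (0 :: p :: PI / 2 :: nil) 0 (PI / 2)).
    - intros s Hs Hn. simpl in Hn.
      assert (Hs' : 0 < s < PI / 2).
      { destruct (Req_dec s 0) as [->|]; [tauto|]. destruct (Req_dec s (PI / 2)) as [->|]; [tauto|]. lra. }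
      assert (np : s <> p) by (intros ->; tauto).
      pose proof (Kker_ge0 s p ltac:(lra) Hp) as k0. pose proof (Kker_bound s p ltac:(lra) Hp np) as k1.
      specialize (Hd s Hs'). apply Rabs_le_between in Hd.
      assert (dp : 0 < Rabs (s - p)) by (apply Rabs_pos_lt; lra).
      pose proof (rp_mixed (Rabs (s - p)) s dp ltac:(lra)) as m1. fold (sing p s) in m1.
      set (X := rp (-(1/8)) (Rabs (s - p))) in *. set (Z := rp (-(3/4)) s) in *.
      assert (0 <= Z) by apply rp_ge0.
      assert (e1 : Kker s p * (z s - w s) <= Kker s p * (e * Z)) by (apply Rmult_le_compat_l; lra).
      assert (e2 : Kker s p * (e * Z) <= 16 * X * (e * Z)) by (apply Rmult_le_compat_r; [nra|lra]).
      assert (e * (X * Z) <= e * sing p s) by (apply Rmult_le_compat_l; assumption). nra.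
    - apply (HK_Hop M); assumption.
    - apply HK_plus; [apply (HK_Hop M); assumption|]. apply HK_scal; assumption. }
  pose proof (W z w Hz Hw Hd) as w1.
  pose proof (W w z Hw Hz ltac:(intros s Hs; rewrite Rabs_minus_sym; auto)) as w2.
  apply Rabs_le. split; apply Rmult_le_reg_l with PI; nra.
Qed.

(** * The truncated problem *)

Lemma continuous_eps (f : R -> R) x :
  (forall eps, 0 < eps -> exists del, 0 < del /\ forall y, Rabs (y - x) < del -> Rabs (f y - f x) < eps) ->
  continuous f x.
Proof.
  intros H. apply (filterlim_locally f). intros [eps e0]. destruct (H eps e0) as [d [d0 Hd]].
  exists (mkposreal d d0). intros y Hy. apply Hd. exact Hy.
Qed.

Lemma continuous_eps_inv (f : R -> R) x : continuous f x ->
  forall eps, 0 < eps -> exists del, 0 < del /\ forall y, Rabs (y - x) < del -> Rabs (f y - f x) < eps.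
Proof.
  intros H eps e0. destruct (proj1 (filterlim_locally f (f x)) H (mkposreal eps e0)) as [[d d0] Hd].
  exists d. split; [assumption|]. intros y Hy. apply Hd. exact Hy.
Qed.

Lemma Rmin_dist a b a' b' e : Rabs (a - a') <= e -> Rabs (b - b') <= e -> Rabs (Rmin a b - Rmin a' b') <= e.
Proof.
  intros h1 h2. apply Rabs_le_between in h1. apply Rabs_le_between in h2. apply Rabs_le.
  unfold Rmin. repeat destruct Rle_dec; lra.
Qed.

Lemma continuous_Rmin (f g : R -> R) x : continuous f x -> continuous g x ->
  continuous (fun y => Rmin (f y) (g y)) x.
Proof.
  intros Hf Hg. apply continuous_eps. intros eps e0.
  destruct (continuous_eps_inv f x Hf (eps / 2) ltac:(lra)) as [d [d0 Hd]].
  destruct (continuous_eps_inv g x Hg (eps / 2) ltac:(lra)) as [d' [d0' Hd']].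
  exists (Rmin d d'). split; [apply Rmin_glb_lt; assumption|]. intros y Hy.
  pose proof (Rmin_l d d'). pose proof (Rmin_r d d').
  apply Rle_lt_trans with (eps / 2); [|lra].
  apply Rmin_dist; apply Rlt_le; [apply Hd|apply Hd']; lra.
Qed.

Lemma sin_cos_pos s : 0 < s < PI / 2 -> 0 < sin s /\ 0 < cos s.
Proof. intros H. split; [apply sin_gt_0; lra|apply cos_gt_0; lra]. Qed.

Lemma tan_ge s : 0 < s < PI / 2 -> s <= tan s.
Proof.
  intros H. destruct (sin_cos_pos s H) as [h1 h2]. pose proof (x_cos_le_sin s ltac:(lra)).
  unfold tan. apply Rmult_le_reg_r with (cos s); [assumption|].
  unfold Rdiv. rewrite Rmult_assoc, Rinv_l, Rmult_1_r; lra.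
Qed.

Lemma cot_tan s : 0 < s < PI / 2 -> cos s / sin s = / tan s.
Proof.
  intros H. destruct (sin_cos_pos s H) as [h1 h2]. unfold tan. field. lra.
Qed.

Lemma tan_derive s : 0 < s < PI / 2 -> is_derive tan s (1 + (tan s) ^ 2).
Proof.
  intros H. destruct (sin_cos_pos s H) as [h1 h2].
  apply (is_derive_ext (fun s => sin s / cos s)); [reflexivity|].
  auto_derive; [lra|]. unfold tan. field. lra.
Qed.

Lemma adm_primitive M z : adm M z -> exists F, F 0 = 0 /\ cont_on F 0 (PI / 2) /\
  (forall s, 0 < s < PI / 2 -> is_derive F s (z s)) /\
  (forall s, 0 <= s <= PI / 2 -> HK z 0 s (F s)) /\
  (forall x y, 0 <= x -> x <= y -> y <= PI / 2 -> 0 <= F y - F x).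
Proof.
  intros [M0 Hz]. pose proof PI_ge_3.
  destruct (improper_primitive z (fun s => M * rp (-(3/4)) s) (fun s => M * (4 * rp (1/4) s)) 0 (PI / 2))
    as [F [F0 [CF [DF BF]]]].
  - lra.
  - intros x Hx. apply Hz. assumption.
  - intros x Hx. apply Hz. assumption.
  - intros x Hx. apply (is_derive_scal (fun s => 4 * rp (1/4) s) x M).
    apply is_derive_eq with (4 * (1/4 * rp (1/4 - 1) x)).
    + apply (is_derive_scal (rp (1/4)) x 4). apply rp_derive. lra.
    + replace (1/4 - 1) with (-(3/4)) by field. field.
  - apply continuous_cont_on. intros x _. apply (continuous_scal_r M (fun s => 4 * rp (1/4) s)).
    apply (continuous_scal_r 4 (rp (1/4))). apply rp_continuous. lra.
  - exists F. split; [assumption|]. split; [assumption|]. split; [assumption|]. split.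
    + intros s Hs. replace (F s) with (F s - F 0) by (rewrite F0; ring).
      apply (HK_FTC_open F z 0 (PI / 2)); auto; lra.
    + intros x y h1 h2 h3. apply BF; assumption.
Qed.

Lemma rp_quarter_le s : s <= 2 -> rp (1/4) s <= 2.
Proof.
  intros H. eapply Rle_trans; [apply (rp_mono (1/4) s 2); lra|].
  rewrite <- (rp_1 2) at 2 by lra. rewrite !rp_pos by lra. apply Rle_Rpower; lra.
Qed.

Lemma adm_int_dist M z w e s : adm M z -> adm M w -> 0 <= e ->
  (forall s, 0 < s < PI / 2 -> Rabs (z s - w s) <= e * rp (-(3/4)) s) -> 0 <= s <= PI / 2 ->
  Rabs (HKint z 0 s - HKint w 0 s) <= 8 * e.
Proof.
  intros Hz Hw e0 Hd Hs. pose proof PI_4.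
  assert (P : HK (fun s => e * rp (-(3/4)) s) 0 s (e * (4 * rp (1/4) s) - e * (4 * rp (1/4) 0))).
  { apply (HK_FTC (fun s => e * (4 * rp (1/4) s)) _ (0 :: nil)); [lra| |].
    - apply continuous_cont_on. intros x _. apply (continuous_scal_r e (fun s => 4 * rp (1/4) s)).
      apply (continuous_scal_r 4 (rp (1/4))). apply rp_continuous. lra.
    - intros x Hx Hn. assert (x <> 0) by (intros ->; apply Hn; left; reflexivity).
      apply (is_derive_scal (fun s => 4 * rp (1/4) s) x e).
      apply is_derive_eq with (4 * (1/4 * rp (1/4 - 1) x)).
      + apply (is_derive_scal (rp (1/4)) x 4). apply rp_derive. lra.
      + replace (1/4 - 1) with (-(3/4)) by field. field. }
  rewrite (rp_npos _ 0) in P by lra.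
  assert (B : e * (4 * rp (1/4) s) - e * (4 * 0) <= 8 * e).
  { pose proof (rp_quarter_le s ltac:(lra)). nra. }
  assert (W : forall z w, adm M z -> adm M w ->
     (forall s, 0 < s < PI / 2 -> Rabs (z s - w s) <= e * rp (-(3/4)) s) ->
     HKint z 0 s <= HKint w 0 s + 8 * e).
  { clear z w Hz Hw Hd. intros z w Hz Hw Hd.
    destruct (adm_primitive M z Hz) as [F [_ [_ [_ [HF _]]]]].
    destruct (adm_primitive M w Hw) as [G [_ [_ [_ [HG _]]]]].
    specialize (HF s Hs). specialize (HG s Hs).
    rewrite (HKint_eq _ _ _ _ HF), (HKint_eq _ _ _ _ HG).
    eapply Rle_trans; [|apply Rplus_le_compat_l; exact B].
    apply (HK_le_except z (fun s => w s + e * rp (-(3/4)) s) (0 :: PI / 2 :: nil) 0 s); [|assumption|apply HK_plus; assumption].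
    intros x Hx Hn. simpl in Hn.
    assert (Hx' : 0 < x < PI / 2).
    { destruct (Req_dec x 0) as [->|]; [tauto|]. destruct (Req_dec x (PI / 2)) as [->|]; [tauto|]. lra. }
    specialize (Hd x Hx'). apply Rabs_le_between in Hd. lra. }
  pose proof (W z w Hz Hw Hd). pose proof (W w z Hw Hz ltac:(intros x Hx; rewrite Rabs_minus_sym; auto)).
  apply Rabs_le. lra.
Qed.

(** * Truncation of the sine and the truncated operator *)

Definition clampsin (t : R) := sin (Rmax 0 (Rmin PI t)).

Lemma clampsin_range t : 0 <= clampsin t <= 1.
Proof.
  unfold clampsin. pose proof PI_ge_3. split; [|apply SIN_bound].
  apply sin_ge_0; [apply Rmax_l|]. apply Rmax_lub; [lra|apply Rmin_l].
Qed.

Lemma clampsin_lipschitz x y : Rabs (clampsin x - clampsin y) <= Rabs (x - y).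
Proof.
  unfold clampsin. eapply Rle_trans; [apply sin_lipschitz|].
  pose proof PI_ge_3. unfold Rmax, Rmin, Rabs.
  repeat destruct Rle_dec; repeat destruct Rcase_abs; lra.
Qed.

Lemma clampsin_eq t : 0 <= t <= PI -> clampsin t = sin t.
Proof. intros H. unfold clampsin. rewrite Rmin_right, Rmax_right by lra. reflexivity. Qed.

Lemma clampsin_big t : PI <= t -> clampsin t = 0.
Proof. intros H. unfold clampsin. pose proof PI_ge_3. rewrite Rmin_left, Rmax_right by lra. apply sin_PI. Qed.

(* The a priori bound of the angle [s + Hop zeta s / 3]: the exponent [9/16] lies above [1/2], which
   makes [zeta] square integrable, and the factor [4] keeps the norm below [9 sqrt PI / 2]. *)
Definition thb (s : R) := rp (9/16) (4 * tan s).

Definition pz (h : R -> R) (s : R) := Rmin (clampsin (s + / 3 * h s)) (thb s) * (cos s / sin s).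

Definition Ez (c : R) (h : R -> R) (s : R) := 1 + c * HKint (pz h) 0 s.

(* The truncated [Phi], with [c = 3 / (alpha PI)].  Since [Ez' = c pz = zt Ez], the denominator [Ez] is
   the exponential of the primitive of [zt]. *)
Definition zt (c : R) (h : R -> R) (s : R) := c * pz h s / Ez c h s.

Lemma pz_pre_range h s : 0 < s < PI / 2 ->
  0 <= Rmin (clampsin (s + / 3 * h s)) (thb s) /\
  Rmin (clampsin (s + / 3 * h s)) (thb s) <= 1 /\ Rmin (clampsin (s + / 3 * h s)) (thb s) <= thb s.
Proof.
  intros Hs. pose proof (clampsin_range (s + / 3 * h s)). split; [|split].
  - apply Rmin_glb; [lra|apply rp_ge0].
  - eapply Rle_trans; [apply Rmin_l|lra].
  - apply Rmin_r.
Qed.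

(* [4 tan s >= s] turns powers of the tangent into powers of [s]. *)
Lemma rp_tan_cot a b s : 0 < s < PI / 2 -> 1 <= a + b -> a <= 1 -> b <= 1 -> 0 <= b ->
  rp a (4 * tan s) * (cos s / sin s) <= 8 * rp (- b) s.
Proof.
  intros Hs Hab Ha Hb b0. rewrite cot_tan by assumption. pose proof (tan_ge s Hs). pose proof PI_4.
  set (x := 4 * tan s). assert (x0 : 0 < x) by (unfold x; lra).
  replace (/ tan s) with (4 * / x) by (unfold x; field; lra).
  assert (E : rp a x = x * rp (a - 1) x).
  { replace a with (1 + (a - 1)) at 1 by ring. rewrite rp_plus, rp_1 by assumption. reflexivity. }
  rewrite E. replace (x * rp (a - 1) x * (4 * / x)) with (4 * rp (a - 1) x) by (field; lra).
  pose proof (rp_anti (a - 1) s x ltac:(lra) ltac:(unfold x; lra)) as h1.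
  replace (a - 1) with (- b + (a - 1 + b)) in h1 at 2 by ring. rewrite rp_plus in h1 by lra.
  assert (h2 : rp (a - 1 + b) s <= 2).
  { eapply Rle_trans; [apply (rp_mono (a - 1 + b) s 2); lra|].
    rewrite <- (rp_1 2) at 2 by lra. rewrite !rp_pos by lra. apply Rle_Rpower; lra. }
  pose proof (rp_ge0 (- b) s). nra.
Qed.

Lemma pz_le h s b : 7/16 <= b <= 1 -> 0 < s < PI / 2 -> 0 <= pz h s <= 8 * rp (- b) s.
Proof.
  intros Hb Hs. destruct (sin_cos_pos s Hs) as [h1 h2].
  destruct (pz_pre_range h s Hs) as [r1 [r2 r3]]. unfold pz.
  assert (0 < cos s / sin s) by (apply Rdiv_lt_0_compat; assumption).
  split; [apply Rmult_le_pos; lra|].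
  eapply Rle_trans; [apply Rmult_le_compat_r; [lra|exact r3]|].
  apply rp_tan_cot; lra.
Qed.

Lemma thb_continuous s : 0 < s < PI / 2 -> continuous thb s.
Proof.
  intros Hs. apply (continuous_comp (fun s => 4 * tan s) (rp (9/16))); [|apply rp_continuous; lra].
  apply (continuous_scal_r 4 tan). apply (ex_derive_continuous tan). eexists. apply tan_derive. assumption.
Qed.

Lemma clampsin_continuous x : continuous clampsin x.
Proof.
  apply continuous_eps. intros eps e0. exists eps. split; [assumption|]. intros y Hy.
  eapply Rle_lt_trans; [apply clampsin_lipschitz|assumption].
Qed.

Lemma pz_continuous h s : continuous h s -> 0 < s < PI / 2 -> continuous (pz h) s.
Proof.
  intros Hh Hs. apply (continuous_mult (fun s => Rmin (clampsin (s + / 3 * h s)) (thb s)) (fun s => cos s / sin s)).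
  - apply continuous_Rmin; [|apply thb_continuous; assumption].
    apply (continuous_comp (fun s => s + / 3 * h s) clampsin); [|apply clampsin_continuous].
    apply (continuous_plus (fun s => s) (fun s => / 3 * h s)); [apply continuous_id|].
    apply (continuous_scal_r (/ 3) h). assumption.
  - apply (ex_derive_continuous (fun s => cos s / sin s)). auto_derive.
    destruct (sin_cos_pos s Hs). lra.
Qed.

Lemma pz_adm h : (forall s, 0 < s < PI / 2 -> continuous h s) -> adm 8 (pz h).
Proof.
  intros Hh. split; [lra|]. intros s Hs. split; [apply pz_continuous; auto|].
  apply pz_le; lra.
Qed.

Section Fixed.
Variable c : R.
Hypothesis c0 : 0 < c.

Lemma Ez_props h : (forall s, 0 < s < PI / 2 -> continuous h s) ->
  exists E, E 0 = 1 /\ cont_on E 0 (PI / 2) /\ (forall s, 0 < s < PI / 2 -> is_derive E s (c * pz h s)) /\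
    (forall s, 0 <= s <= PI / 2 -> Ez c h s = E s /\ 1 <= E s).
Proof.
  intros Hh. destruct (adm_primitive 8 (pz h) (pz_adm h Hh)) as [F [F0 [CF [DF [HF MF]]]]].
  exists (fun s => 1 + c * F s). split; [rewrite F0; ring|]. split; [|split].
  - intros x Hx e e0. destruct (CF x Hx (e / c)) as [d [d0 Hd]]; [apply Rdiv_lt_0_compat; assumption|].
    exists d. split; [assumption|]. intros y Hy Hyx. specialize (Hd y Hy Hyx).
    replace (1 + c * F y - (1 + c * F x)) with (c * (F y - F x)) by ring.
    rewrite Rabs_mult, (Rabs_pos_eq c) by lra.
    apply Rmult_lt_compat_l with (r := c) in Hd; [|assumption].
    replace (c * (e / c)) with e in Hd by (field; lra). assumption.
  - intros s Hs. apply is_derive_eq with (0 + c * pz h s); [|ring].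
    apply (is_derive_plus (fun _ => 1) (fun s => c * F s)).
    + apply (is_derive_const (K := R_AbsRing) (V := R_NormedModule)).
    + apply (is_derive_scal F s c). apply DF. assumption.
  - intros s Hs. unfold Ez. rewrite (HKint_eq _ _ _ _ (HF s Hs)). split; [reflexivity|].
    pose proof (MF 0 s ltac:(lra) ltac:(lra) ltac:(lra)). nra.
Qed.

Lemma zt_le h s : (forall s, 0 < s < PI / 2 -> continuous h s) -> 0 < s < PI / 2 ->
  0 <= zt c h s <= c * pz h s.
Proof.
  intros Hh Hs. destruct (Ez_props h Hh) as [E [_ [_ [_ HE]]]].
  destruct (HE s ltac:(lra)) as [e1 e2]. unfold zt. rewrite e1.
  destruct (pz_le h s 1 ltac:(lra) Hs) as [p0 _].
  assert (0 <= c * pz h s) by (apply Rmult_le_pos; lra).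
  split; [apply Rdiv_le_0_compat; lra|].
  apply Rmult_le_reg_r with (E s); [lra|]. unfold Rdiv. rewrite Rmult_assoc, Rinv_l by lra. nra.
Qed.

Lemma zt_continuous h s : (forall s, 0 < s < PI / 2 -> continuous h s) -> 0 < s < PI / 2 -> continuous (zt c h) s.
Proof.
  intros Hh Hs. destruct (Ez_props h Hh) as [E [_ [_ [DE HE]]]].
  apply (continuous_ext_loc _ (fun s => c * pz h s * / E s)).
  - assert (dp : 0 < Rmin s (PI / 2 - s)) by (apply Rmin_glb_lt; lra).
    exists (mkposreal _ dp). intros y Hy. change (Rabs (y - s) < Rmin s (PI / 2 - s)) in Hy.
    apply Rabs_def2 in Hy. pose proof (Rmin_l s (PI / 2 - s)). pose proof (Rmin_r s (PI / 2 - s)).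
    unfold zt. destruct (HE y ltac:(lra)) as [-> _]. reflexivity.
  - apply (continuous_mult (fun s => c * pz h s) (fun s => / E s)).
    + apply (continuous_scal_r c (pz h)). apply pz_continuous; auto.
    + apply (continuous_comp E Rinv).
      * apply (ex_derive_continuous E). eexists. apply DE. assumption.
      * apply (ex_derive_continuous Rinv). auto_derive. destruct (HE s ltac:(lra)). lra.
Qed.

Lemma zt_adm h : (forall s, 0 < s < PI / 2 -> continuous h s) -> adm (8 * c) (zt c h).
Proof.
  intros Hh. split; [lra|]. intros s Hs. split; [apply zt_continuous; auto|].
  pose proof (zt_le h s Hh Hs). pose proof (pz_le h s (3/4) ltac:(lra) Hs). nra.
Qed.

(** A uniform bound [del] on the numerators is useless against the nonintegrable cotangent. Their
    difference is at most [del] and at most [thb s], hence at most the geometric mean of the two;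
    half of the exponent [9/16] still tames the cotangent to [s^(-3/4)], at the price of mere
    Hoelder-1/2 dependence on [del]. *)
Lemma pz_dist h k del s : 0 < del -> 0 < s < PI / 2 -> Rabs (h s - k s) <= del ->
  Rabs (pz h s - pz k s) <= 8 * rp (1/2) del * rp (-(3/4)) s.
Proof.
  intros d0 Hs Hd. destruct (sin_cos_pos s Hs) as [h1 h2].
  destruct (pz_pre_range h s Hs) as [r1 [r2 r3]]. destruct (pz_pre_range k s Hs) as [q1 [q2 q3]].
  assert (co : 0 < cos s / sin s) by (apply Rdiv_lt_0_compat; assumption).
  unfold pz. rewrite <- Rmult_minus_distr_r, Rabs_mult, (Rabs_pos_eq (cos s / sin s)) by lra.
  set (m := Rabs (Rmin (clampsin (s + / 3 * h s)) (thb s) - Rmin (clampsin (s + / 3 * k s)) (thb s))).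
  assert (m0 : 0 <= m) by apply Rabs_pos.
  assert (m1 : m <= del).
  { apply Rmin_dist; [|rewrite Rminus_diag, Rabs_R0; lra].
    eapply Rle_trans; [apply clampsin_lipschitz|].
    replace (s + / 3 * h s - (s + / 3 * k s)) with (/ 3 * (h s - k s)) by ring.
    rewrite Rabs_mult, (Rabs_pos_eq (/ 3)) by lra. pose proof (Rabs_pos (h s - k s)). lra. }
  assert (m2 : m <= thb s) by (apply Rabs_le; lra).
  pose proof (tan_ge s Hs).
  assert (m3 : m <= rp (1/2) del * rp (9/32) (4 * tan s)).
  { destruct (Req_dec m 0) as [->|mn]; [apply Rmult_le_pos; apply rp_ge0|].
    replace m with (rp (1/2) m * rp (1/2) m).
    - replace (rp (9/32) (4 * tan s)) with (rp (1/2) (thb s)).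
      + apply Rmult_le_compat; try apply rp_ge0; apply rp_mono; lra.
      + unfold thb. rewrite (rp_pos (9/16)) by lra. rewrite (rp_pos (1/2)) by apply exp_pos.
        rewrite Rpower_mult, rp_pos by lra. f_equal. field.
    - rewrite <- rp_plus by lra. replace (1/2 + 1/2) with 1 by field. apply rp_1. lra. }
  pose proof (rp_tan_cot (9/32) (3/4) s Hs ltac:(lra) ltac:(lra) ltac:(lra) ltac:(lra)) as m4.
  pose proof (rp_ge0 (1/2) del).
  apply Rle_trans with (rp (1/2) del * (rp (9/32) (4 * tan s) * (cos s / sin s))).
  - rewrite <- Rmult_assoc. apply Rmult_le_compat_r; lra.
  - apply Rle_trans with (rp (1/2) del * (8 * rp (-(3/4)) s)); [apply Rmult_le_compat_l; assumption|lra].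
Qed.

Lemma zt_dist h k del : (forall s, 0 < s < PI / 2 -> continuous h s) -> (forall s, 0 < s < PI / 2 -> continuous k s) ->
  0 < del -> (forall s, 0 < s < PI / 2 -> Rabs (h s - k s) <= del) ->
  forall s, 0 < s < PI / 2 -> Rabs (zt c h s - zt c k s) <= (8 * c + 512 * c ^ 2) * rp (1/2) del * rp (-(3/4)) s.
Proof.
  intros Hh Hk d0 Hd s Hs.
  pose proof (pz_dist h k del s d0 Hs (Hd s Hs)) as b1.
  assert (b2 : Rabs (HKint (pz h) 0 s - HKint (pz k) 0 s) <= 8 * (8 * rp (1/2) del)).
  { apply (adm_int_dist 8); [apply pz_adm; auto|apply pz_adm; auto|pose proof (rp_ge0 (1/2) del); lra| |lra].
    intros t Ht. apply pz_dist; auto. }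
  destruct (Ez_props h Hh) as [E [_ [_ [_ HE]]]]. destruct (Ez_props k Hk) as [G [_ [_ [_ HG]]]].
  destruct (HE s ltac:(lra)) as [e1 e2]. destruct (HG s ltac:(lra)) as [g1 g2].
  assert (b3 : Rabs (G s - E s) <= 64 * c * rp (1/2) del).
  { rewrite <- e1, <- g1. unfold Ez.
    replace (1 + c * HKint (pz k) 0 s - (1 + c * HKint (pz h) 0 s))
      with (c * (HKint (pz k) 0 s - HKint (pz h) 0 s)) by ring.
    rewrite Rabs_mult, (Rabs_pos_eq c), Rabs_minus_sym by lra. nra. }
  unfold zt. rewrite e1, g1.
  destruct (pz_le k s (3/4) ltac:(lra) Hs) as [p1 p2].
  set (D := rp (1/2) del) in *. set (Z := rp (-(3/4)) s) in *.
  assert (D0 : 0 <= D) by apply rp_ge0. assert (Z0 : 0 <= Z) by apply rp_ge0.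
  (* The first term is the change of the numerator, giving [8 c]; the second that of the
     denominator, giving [8 c * 64 c], since both denominators are at least [1]. *)
  replace (c * pz h s / E s - c * pz k s / G s)
    with (c * (pz h s - pz k s) * / E s + c * pz k s * (G s - E s) * (/ E s * / G s)) by (field; lra).
  assert (i1 : 0 < / E s <= 1).
  { split; [apply Rinv_0_lt_compat; lra|]. rewrite <- Rinv_1. apply Rinv_le_contravar; lra. }
  assert (i2 : 0 < / G s <= 1).
  { split; [apply Rinv_0_lt_compat; lra|]. rewrite <- Rinv_1. apply Rinv_le_contravar; lra. }
  assert (i3 : 0 < / E s * / G s <= 1) by nra.
  eapply Rle_trans; [apply Rabs_triang|].
  rewrite !Rabs_mult, (Rabs_pos_eq c), (Rabs_pos_eq (/ E s)), (Rabs_pos_eq (/ G s)), (Rabs_pos_eq (pz k s)) by lra.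
  assert (t1 : c * Rabs (pz h s - pz k s) * / E s <= c * (8 * D * Z)).
  { rewrite <- (Rmult_1_r (c * (8 * D * Z))). pose proof (Rabs_pos (pz h s - pz k s)).
    apply Rmult_le_compat; [apply Rmult_le_pos; lra|lra|apply Rmult_le_compat_l; lra|lra]. }
  assert (t2 : c * pz k s * Rabs (G s - E s) * (/ E s * / G s) <= c * (8 * Z) * (64 * c * D)).
  { rewrite <- (Rmult_1_r (c * (8 * Z) * (64 * c * D))). pose proof (Rabs_pos (G s - E s)).
    assert (0 <= c * pz k s) by (apply Rmult_le_pos; lra).
    apply Rmult_le_compat; [apply Rmult_le_pos; lra|lra| |lra].
    apply Rmult_le_compat; [lra|lra|apply Rmult_le_compat_l; lra|lra]. }
  lra.
Qed.

Lemma fixed_point_exists : exists h, (forall x, continuous h x) /\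
  forall x, 0 <= x <= PI / 2 -> h x = Hop (zt c h) x.
Proof.
  set (A := 1024 * (8 * c)). assert (A0 : 0 < A) by (unfold A; lra).
  set (om := fun t => A * rp (1/8) t). pose proof PI_ge_3.
  assert (om_lim : forall eps, 0 < eps -> exists del, 0 < del /\ om del <= eps).
  { intros eps e0. exists (rp (/ (1/8)) (eps / A)).
    assert (0 < eps / A) by (apply Rdiv_lt_0_compat; lra).
    split; [apply rp_gt0; assumption|]. unfold om. rewrite rp_small by lra. right. field. lra. }
  assert (om_mono : forall s t, 0 <= s <= t -> om s <= om t).
  { intros s t Hst. apply Rmult_le_compat_l; [lra|]. apply rp_mono; lra. }
  assert (modc : forall h, modulus om h -> forall x, continuous h x).
  { intros h Hm x. apply continuous_eps. intros eps e0.
    destruct (om_lim (eps / 2) ltac:(lra)) as [d [d0 Hd]]. exists d. split; [assumption|].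
    intros y Hy. apply Rle_lt_trans with (om d); [|lra].
    eapply Rle_trans; [apply Hm|]. apply om_mono. split; [apply Rabs_pos|lra]. }
  destruct (Schauder_fixed_point 0 (PI / 2) (256 * (8 * c)) om (fun h => Hop (zt c h))) as [h [Hm Hh]].
  - lra.
  - lra.
  - intros t _. apply Rmult_le_pos; [lra|apply rp_ge0].
  - exact om_mono.
  - intros s t hs ht. unfold om. rewrite <- Rmult_plus_distr_l. apply Rmult_le_compat_l; [lra|].
    apply rp_subadd; lra.
  - exact om_lim.
  - intros h Hm x Hx. apply (Hop_bound (8 * c)); [|assumption]. apply zt_adm. intros; apply modc; assumption.
  - intros h Hm x y Hx Hy. apply (Hop_holder (8 * c)); try assumption. apply zt_adm. intros; apply modc; assumption.
  (* The dependence on [h] has modulus [L del^(1/2)]; [del] is chosen to make this equal to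
     [eps]. *)
  - intros eps e0. set (L := 256 * (8 * c + 512 * c ^ 2)).
    assert (L0 : 0 < L) by (unfold L; nra).
    exists (rp (/ (1/2)) (eps / L)). assert (q : 0 < eps / L) by (apply Rdiv_lt_0_compat; lra).
    split; [apply rp_gt0; assumption|]. intros h k mh mk Hd x Hx.
    eapply Rle_trans.
    + apply (Hop_dist (8 * c) (zt c h) (zt c k) ((8 * c + 512 * c ^ 2) * rp (1/2) (rp (/ (1/2)) (eps / L)))).
      * apply zt_adm. intros; apply modc; assumption.
      * apply zt_adm. intros; apply modc; assumption.
      * apply Rmult_le_pos; [nra|apply rp_ge0].
      * apply zt_dist; try (intros; apply modc; assumption).
        -- apply rp_gt0; assumption.
        -- intros s Hs. apply Hd. lra.
      * assumption.
    + rewrite rp_small by lra. right. unfold L. field. nra.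
  - exists h. split; [apply modc; assumption|exact Hh].
Qed.
End Fixed.

(** * A power majorant of the angle near the origin *)

(** The function [z ln |z|], written with [z^2] so that it differentiates on both sides of [0]; its
    value at [0] is the limit. *)
Definition zlnz (z : R) := z * (/ 2 * ln (z ^ 2)).

Lemma zlnz_continuous z : continuous zlnz z.
Proof.
  destruct (Req_dec z 0) as [->|ne].
  - apply continuous_eps. intros eps e0.
    set (d := rp (/ (7/8)) (eps / 16)). assert (d0 : 0 < d) by (apply rp_gt0; lra).
    exists (Rmin 1 d). split; [apply Rmin_glb_lt; lra|]. intros y Hy. rewrite Rminus_0_r in Hy.
    replace (zlnz 0) with 0 by (unfold zlnz; ring). rewrite Rminus_0_r.
    pose proof (Rmin_l 1 d). pose proof (Rmin_r 1 d).
    destruct (Req_dec y 0) as [->|yn].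
    { replace (zlnz 0) with 0 by (unfold zlnz; ring). rewrite Rabs_R0. assumption. }
    assert (a0 : 0 < Rabs y) by (apply Rabs_pos_lt; assumption).
    unfold zlnz. rewrite ln_sqr by assumption. replace (/ 2 * (2 * ln (Rabs y))) with (ln (Rabs y)) by field.
    rewrite Rabs_mult.
    assert (l0 : ln (Rabs y) <= 0) by (rewrite <- ln_1; apply ln_le; lra).
    rewrite (Rabs_left1 (ln (Rabs y))) by assumption.
    pose proof (ln_diff_bound 1 (Rabs y) ltac:(lra)) as h. rewrite ln_1 in h.
    pose proof (rp_le_1 (1/8) (1 - Rabs y) ltac:(lra) ltac:(lra)) as h1.
    pose proof (rp_ge0 (-(1/8)) (Rabs y)) as h2.
    assert (h3 : - ln (Rabs y) <= 8 * rp (-(1/8)) (Rabs y)) by nra.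
    assert (E : Rabs y * rp (-(1/8)) (Rabs y) = rp (7/8) (Rabs y)).
    { rewrite <- (rp_1 (Rabs y)) at 1 by assumption. rewrite <- rp_plus by assumption. f_equal. field. }
    apply Rle_lt_trans with (8 * rp (7/8) (Rabs y)).
    + rewrite <- E. nra.
    + pose proof (rp_mono (7/8) (Rabs y) d ltac:(lra) ltac:(lra)) as h4.
      unfold d in h4. rewrite rp_small in h4 by lra. lra.
  - apply (ex_derive_continuous zlnz). unfold zlnz. auto_derive.
    pose proof (pow2_gt_0 z ne) as h. simpl in h. lra.
Qed.

(* The logarithm [ln |(1 + r^4) / (1 - r^4)|], split so that the singular factor is isolated. *)
Definition Lr (r : R) := ln (1 + r ^ 4) - / 2 * ln ((r - 1) ^ 2) - ln (1 + r) - ln (1 + r ^ 2).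

(** The primitive of [r^2 / (1 + r^4)] obtained from the factors [r^2 - sqrt 2 r + 1] and
    [r^2 + sqrt 2 r + 1] by partial fractions. *)
Definition Jr (r : R) := / (4 * sqrt 2) * (ln (r ^ 2 - sqrt 2 * r + 1) - ln (r ^ 2 + sqrt 2 * r + 1))
  + / (2 * sqrt 2) * (atan (sqrt 2 * r + 1) + atan (sqrt 2 * r - 1)).

(** A primitive of [Lr r * (3 r + r^2)] by integration by parts. Against [ln |r - 1|], the primitive
    of the weight is normalized as [3/2 (r^2 - 1) + (r^3 - 1) / 3]; it vanishes at [1], and
    factoring out [r - 1] leaves [zlnz (r - 1)], which is continuous there. *)
Definition Pr (r : R) :=
  - (3/2 * (r + 1) + (r ^ 2 + r + 1) / 3) * zlnz (r - 1)
  + (3/2 * r ^ 2 + r ^ 3 / 3) * (ln (1 + r ^ 4) - ln (1 + r) - ln (1 + r ^ 2))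
  - 3/2 * (ln (1 + r ^ 2) - ln (1 + r)) - / 3 * ln (1 + r)
  + 3 * atan (r ^ 2) + 2/3 * atan r + 4/3 * Jr r.

Lemma sqrt2_props : sqrt 2 * sqrt 2 = 2 /\ 1.41 < sqrt 2.
Proof.
  split; [apply sqrt_sqrt; lra|].
  rewrite <- (sqrt_Rsqr 1.41) by lra. apply sqrt_lt_1; unfold Rsqr; lra.
Qed.

Lemma Jr_quad r : 0 < r ^ 2 - sqrt 2 * r + 1 /\ 0 < r ^ 2 + sqrt 2 * r + 1.
Proof.
  destruct sqrt2_props as [q2 q1]. split; simpl; nra.
Qed.

Lemma Jr_derive r : is_derive Jr r (r ^ 2 / (1 + r ^ 4)).
Proof.
  destruct sqrt2_props as [q2 q1]. destruct (Jr_quad r) as [a b].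
  unfold Jr. set (q := sqrt 2) in *.
  auto_derive.
  - simpl in a, b. repeat split; lra.
  - assert (c1 : 1 + (q * r + 1) ^ 2 = 2 * (r ^ 2 + q * r + 1)) by (simpl; nra).
    assert (c2 : 1 + (q * r + -1) ^ 2 = 2 * (r ^ 2 - q * r + 1)) by (simpl; nra).
    assert (c3 : 1 + r ^ 4 = (r ^ 2 - q * r + 1) * (r ^ 2 + q * r + 1)).
    { replace ((r ^ 2 - q * r + 1) * (r ^ 2 + q * r + 1)) with ((r ^ 2 + 1) ^ 2 - (q * q) * r ^ 2) by ring.
      rewrite q2. ring. }
    rewrite c3. clear c3. simpl in *.
    replace (1 + (q * r + - (1)) * ((q * r + - (1)) * 1)) with (2 * (r * (r * 1) - q * r + 1)) by (rewrite <- c2; ring).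
    rewrite c1. field. repeat split; lra.
Qed.

Lemma Pr_continuous r : 0 <= r -> continuous Pr r.
Proof.
  intros H.
  set (A := fun r => - (3/2 * (r + 1) + (r ^ 2 + r + 1) / 3)).
  set (B := fun r => (3/2 * r ^ 2 + r ^ 3 / 3) * (ln (1 + r ^ 4) - ln (1 + r) - ln (1 + r ^ 2))
  - 3/2 * (ln (1 + r ^ 2) - ln (1 + r)) - / 3 * ln (1 + r)
  + 3 * atan (r ^ 2) + 2/3 * atan r).
  assert (p2 : 0 <= r ^ 2) by (apply pow_le; assumption). assert (p4 : 0 <= r ^ 4) by (apply pow_le; assumption).
  simpl in p2, p4.
  apply (continuous_ext (fun r => A r * zlnz (r - 1) + (B r + 4/3 * Jr r))).
  { intros y. unfold A, B, Pr. match goal with |- @eq _ ?a ?b => change (@eq R a b) end. ring. }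
  apply (continuous_plus (fun r => A r * zlnz (r - 1)) (fun r => B r + 4/3 * Jr r)).
  - apply (continuous_mult A (fun r => zlnz (r - 1))).
    + apply (ex_derive_continuous A). unfold A. auto_derive. exact I.
    + apply (continuous_comp (fun r => r - 1) zlnz); [|apply zlnz_continuous].
      apply (ex_derive_continuous (fun r => r - 1)). auto_derive. exact I.
  - apply (continuous_plus B (fun r => 4/3 * Jr r)).
    + apply (ex_derive_continuous B). unfold B. auto_derive. repeat split; lra.
    + apply (continuous_scal_r (4/3) Jr). apply (ex_derive_continuous Jr). eexists. apply Jr_derive.
Qed.

Lemma Pr_derive r : 0 < r -> r <> 1 -> is_derive Pr r (Lr r * (3 * r + r ^ 2)).
Proof.
  intros H ne.
  set (B := fun r => - (3/2 * (r + 1) + (r ^ 2 + r + 1) / 3) * ((r - 1) * (/ 2 * ln ((r - 1) ^ 2)))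
  + (3/2 * r ^ 2 + r ^ 3 / 3) * (ln (1 + r ^ 4) - ln (1 + r) - ln (1 + r ^ 2))
  - 3/2 * (ln (1 + r ^ 2) - ln (1 + r)) - / 3 * ln (1 + r)
  + 3 * atan (r ^ 2) + 2/3 * atan r).
  assert (p2 : 0 < r ^ 2) by (apply pow_lt; assumption). assert (p4 : 0 < r ^ 4) by (apply pow_lt; assumption).
  assert (p1 : 0 < (r - 1) ^ 2) by (apply pow2_gt_0; lra).
  apply (is_derive_ext (fun r => B r + 4/3 * Jr r)).
  { intros y. unfold B, Pr, zlnz. reflexivity. }
  eapply is_derive_eq.
  - apply (is_derive_plus B (fun r => 4/3 * Jr r)).
    + unfold B. auto_derive; [|reflexivity]. simpl in p1, p2, p4. repeat split; lra.
    + apply (is_derive_scal Jr r (4/3)). apply Jr_derive.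
  - unfold plus; simpl. unfold Lr. replace (r + - (1)) with (r - 1) by ring.
    simpl in *. set (l1 := ln ((r - 1) * ((r - 1) * 1))). set (l2 := ln (1 + r * (r * (r * (r * 1))))).
    set (l3 := ln (1 + r)). set (l4 := ln (1 + r * (r * 1))).
    field. repeat split; try lra; try nra.
Qed.

Lemma Pr_0 : Pr 0 = 0.
Proof.
  unfold Pr, zlnz, Jr.
  replace ((0 - 1) ^ 2) with 1 by ring. replace (1 + 0 ^ 4) with 1 by ring. replace (1 + 0) with 1 by ring.
  replace (1 + 0 ^ 2) with 1 by ring. replace (0 ^ 2 - sqrt 2 * 0 + 1) with 1 by ring.
  replace (0 ^ 2 + sqrt 2 * 0 + 1) with 1 by ring. replace (sqrt 2 * 0 + 1) with 1 by ring.
  replace (sqrt 2 * 0 - 1) with (- (1)) by ring. replace (0 ^ 2) with 0 by ring.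
  rewrite ln_1, atan_0, atan_opp. ring.
Qed.

(** The limit at infinity is [(11/6 + sqrt 2 / 3) PI], about [2.305 PI], slightly below [7 PI / 3].
    The slack covers the one positive logarithmic term, at most [1/100] here; the other logarithmic
    terms are nonpositive. *)
Lemma Pr_large r : 100 <= r -> Pr r <= 7/3 * PI.
Proof.
  intros Hr. destruct sqrt2_props as [q2 q1]. pose proof PI_ge_3 as P3.
  assert (p2 : 10000 <= r ^ 2) by (simpl; nra).
  assert (p3 : r ^ 3 = r * r ^ 2) by ring. assert (p4 : r ^ 4 = r ^ 2 * r ^ 2) by ring.
  assert (l1 : / 2 * ln ((r - 1) ^ 2) = ln (r - 1)).
  { rewrite ln_sqr by lra. rewrite Rabs_pos_eq by lra. field. }
  assert (E : Pr r = (3/2 * r ^ 2 + r ^ 3 / 3) * (ln (1 + r ^ 4) - ln (r - 1) - ln (1 + r) - ln (1 + r ^ 2))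
    - 3/2 * (ln (1 + r ^ 2) - ln (r - 1) - ln (1 + r)) - / 3 * (ln (1 + r) - ln (r - 1))
    + 3 * atan (r ^ 2) + 2/3 * atan r + 4/3 * Jr r).
  { unfold Pr, zlnz. rewrite l1. field. }
  rewrite E. clear E l1.
  assert (k1 : ln (1 + r ^ 4) - ln (r - 1) - ln (1 + r) - ln (1 + r ^ 2) <= 2 / (r ^ 4 - 1)).
  { replace (ln (1 + r ^ 4) - ln (r - 1) - ln (1 + r) - ln (1 + r ^ 2))
      with (ln ((1 + r ^ 4) / (r ^ 4 - 1))).
    - replace ((1 + r ^ 4) / (r ^ 4 - 1)) with (1 + 2 / (r ^ 4 - 1)) by (field; nra).
      assert (0 < 2 / (r ^ 4 - 1)) by (apply Rdiv_lt_0_compat; nra).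
      rewrite <- (ln_exp (2 / (r ^ 4 - 1))) at 2. apply ln_le; [lra|]. apply exp_ineq1_le.
    - rewrite ln_div by nra. replace (r ^ 4 - 1) with ((r - 1) * (1 + r) * (1 + r ^ 2)) by ring.
      rewrite !ln_mult by nra. ring. }
  assert (k2 : (3/2 * r ^ 2 + r ^ 3 / 3) * (2 / (r ^ 4 - 1)) <= 1 / 100).
  { apply Rmult_le_reg_r with (r ^ 4 - 1); [nra|].
    replace ((3/2 * r ^ 2 + r ^ 3 / 3) * (2 / (r ^ 4 - 1)) * (r ^ 4 - 1)) with (3 * r ^ 2 + 2/3 * r ^ 3) by (field; nra).
    rewrite p3, p4. set (u := r ^ 2) in *. assert (eu : u = r * r) by (unfold u; ring).
    assert (100 * u * r <= u * u) by (rewrite eu at 3; nra). nra. }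
  assert (c0 : 0 <= 3/2 * r ^ 2 + r ^ 3 / 3) by nra.
  pose proof (Rmult_le_compat_l _ _ _ c0 k1) as k3.
  assert (k4 : 0 <= ln (1 + r ^ 2) - ln (r - 1) - ln (1 + r)).
  { assert (ln ((r - 1) * (1 + r)) <= ln (1 + r ^ 2)) by (apply ln_le; nra).
    rewrite ln_mult in H by lra. lra. }
  assert (k5 : 0 <= ln (1 + r) - ln (r - 1)) by (assert (ln (r - 1) <= ln (1 + r)) by (apply ln_le; lra); lra).
  pose proof (atan_bound (r ^ 2)). pose proof (atan_bound r).
  pose proof (atan_bound (sqrt 2 * r + 1)). pose proof (atan_bound (sqrt 2 * r - 1)).
  destruct (Jr_quad r) as [ja jb].
  assert (k6 : Jr r <= / (2 * sqrt 2) * PI).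
  { unfold Jr. assert (ln (r ^ 2 - sqrt 2 * r + 1) <= ln (r ^ 2 + sqrt 2 * r + 1)) by (apply ln_le; nra).
    assert (0 < / (4 * sqrt 2)) by (apply Rinv_0_lt_compat; lra).
    assert (0 < / (2 * sqrt 2)) by (apply Rinv_0_lt_compat; lra). nra. }
  assert (k7 : / (2 * sqrt 2) <= 0.355).
  { apply Rmult_le_reg_r with (2 * sqrt 2); [lra|]. rewrite Rinv_l by lra. lra. }
  nra.
Qed.

(** * The kernel in the tangent variable *)

Lemma tan_lt s p : 0 < s -> s < p -> p < PI / 2 -> tan s < tan p.
Proof. intros. apply tan_increasing; lra. Qed.

(** Dividing [sin (s + p)] and [sin (s - p)] by [cos s cos p tan p] leaves [tan s / tan p] plus or
    minus [1], so the kernel depends on this ratio only. Its fourth root turns the powers [1/2] and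
    [3/4] into integer powers. *)
Lemma Kker_tan s p : 0 < s < PI / 2 -> 0 < p < PI / 2 -> s <> p ->
  exists r, r = rp (1/4) (tan s / tan p) /\ 0 < r /\ r <> 1 /\ r ^ 4 = tan s / tan p /\ Kker s p = Lr r.
Proof.
  intros Hs Hp ne. exists (rp (1/4) (tan s / tan p)).
  pose proof (tan_ge s Hs) as ts. pose proof (tan_ge p Hp) as tp.
  assert (q0 : 0 < tan s / tan p) by (apply Rdiv_lt_0_compat; lra).
  set (r := rp (1/4) (tan s / tan p)).
  assert (r0 : 0 < r) by (apply rp_gt0; assumption).
  assert (r4 : r ^ 4 = tan s / tan p).
  { unfold r. rewrite rp_pos by assumption. rewrite <- Rpower_pow by apply exp_pos. rewrite Rpower_mult.
    replace (1/4 * INR 4) with 1 by (simpl; field). apply Rpower_1. assumption. }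
  assert (nt : tan s <> tan p).
  { destruct (Rtotal_order s p) as [h|[h|h]]; [|contradiction|].
    - pose proof (tan_lt s p ltac:(lra) h ltac:(lra)). lra.
    - pose proof (tan_lt p s ltac:(lra) h ltac:(lra)). lra. }
  assert (r1 : r <> 1).
  { intros e. rewrite e, pow1 in r4. apply nt. apply Rmult_eq_reg_r with (/ tan p).
    - rewrite Rinv_r by lra. unfold Rdiv in r4. lra.
    - apply Rinv_neq_0_compat. lra. }
  split; [reflexivity|]. split; [assumption|]. split; [assumption|]. split; [assumption|].
  destruct (Kker_log s p ltac:(lra) ltac:(lra) ne) as [pos ->].
  destruct (sin_cos_pos s Hs) as [ss cs]. destruct (sin_cos_pos p Hp) as [sp cp].
  assert (e1 : sin (s + p) = cos s * cos p * tan p * (1 + r ^ 4)).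
  { rewrite r4, sin_plus. unfold tan. field. lra. }
  assert (e2 : sin (s - p) = cos s * cos p * tan p * ((r - 1) * ((1 + r) * (1 + r ^ 2)))).
  { replace ((r - 1) * ((1 + r) * (1 + r ^ 2))) with (r ^ 4 - 1) by ring. rewrite r4, sin_minus. unfold tan. field. lra. }
  assert (k0 : 0 < cos s * cos p * tan p) by (apply Rmult_lt_0_compat; [nra|lra]).
  assert (p2 : 0 < r ^ 2) by (apply pow_lt; assumption). assert (p4 : 0 < r ^ 4) by (apply pow_lt; assumption).
  assert (a1 : 0 < Rabs (r - 1)) by (apply Rabs_pos_lt; lra).
  assert (m : 0 < (1 + r) * (1 + r ^ 2)) by nra.
  rewrite e1, e2, !Rabs_mult, (Rabs_pos_eq (1 + r)), (Rabs_pos_eq (1 + r ^ 2)) by lra.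
  rewrite (Rabs_pos_eq (cos s)), (Rabs_pos_eq (cos p)), (Rabs_pos_eq (tan p)) by lra.
  rewrite (ln_mult _ (1 + r ^ 4)) by lra. rewrite (ln_mult _ (Rabs (r - 1) * _)) by nra.
  rewrite (ln_mult (Rabs (r - 1))) by lra. rewrite (ln_mult (1 + r)) by lra.
  unfold Lr. rewrite ln_sqr by lra. field.
Qed.

(** With [z = tan p / tan s] the kernel is [ln ((1 + z) / (1 - z))], and
    [ln ((1 + z) / (1 - z)) - 2 z] is nondecreasing. *)
Lemma Kker_lower s p : 0 < p < s -> s < PI / 2 -> 2 * (tan p / tan s) <= Kker s p.
Proof.
  intros Hps Hs. pose proof (tan_ge s ltac:(lra)) as ts. pose proof (tan_ge p ltac:(lra)) as tp.
  pose proof (tan_lt p s ltac:(lra) ltac:(lra) Hs) as lt.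
  set (z := tan p / tan s).
  assert (z0 : 0 < z) by (apply Rdiv_lt_0_compat; lra).
  assert (z1 : z < 1).
  { apply Rmult_lt_reg_r with (tan s); [lra|]. unfold z, Rdiv. rewrite Rmult_assoc, Rinv_l; lra. }
  destruct (Kker_log s p ltac:(lra) ltac:(lra) ltac:(lra)) as [pos ->].
  destruct (sin_cos_pos s ltac:(lra)) as [ss cs]. destruct (sin_cos_pos p ltac:(lra)) as [sp cp].
  assert (e1 : sin (s + p) = cos s * cos p * tan s * (1 + z)).
  { unfold z. rewrite sin_plus. unfold tan. field. lra. }
  assert (e2 : sin (s - p) = cos s * cos p * tan s * (1 - z)).
  { unfold z. rewrite sin_minus. unfold tan. field. lra. }
  assert (k0 : 0 < cos s * cos p * tan s) by (apply Rmult_lt_0_compat; [nra|lra]).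
  rewrite e1, e2, Rabs_pos_eq by nra. rewrite (ln_mult _ (1 + z)), (ln_mult _ (1 - z)) by lra.
  assert (mono : ln (1 + 0) - ln (1 - 0) - 2 * 0 <= ln (1 + z) - ln (1 - z) - 2 * z).
  { apply (derive_nonneg_mono (fun z => ln (1 + z) - ln (1 - z) - 2 * z) (fun z => / (1 + z) + / (1 - z) - 2) (-1) 1); try lra.
    - intros x Hx. auto_derive; [lra|]. field. lra.
    - intros x Hx. replace (/ (1 + x) + / (1 - x) - 2) with (2 * x ^ 2 / ((1 + x) * (1 - x))) by (field; lra).
      apply Rdiv_le_0_compat; [|nra]. pose proof (pow2_ge_0 x). lra. }
  replace (1 + 0) with 1 in mono by ring. replace (1 - 0) with 1 in mono by ring. lra.
Qed.

(** The majorant used for the angle has a primitive written in [tan s], which breaks down at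
    [PI / 2]. The comparison is therefore made on [[0, b]], up to an arbitrarily small remainder. *)
Lemma HK_singular_cut f p C I b0 eps : 0 < p < PI / 2 -> 0 <= C ->
  (forall s, 0 < s < PI / 2 -> s <> p -> continuous f s) ->
  (forall s, 0 < s < PI / 2 -> s <> p -> 0 <= f s <= C * sing p s) ->
  HK f 0 (PI / 2) I -> b0 < PI / 2 -> 0 < eps ->
  exists b J, b0 <= b < PI / 2 /\ p < b /\ HK f 0 b J /\ I <= J + eps.
Proof.
  intros Hp HC Cf Hf HI Hb e0.
  assert (P : forall u v, 0 <= u -> u < v -> v <= PI / 2 -> ~ (u < p < v) ->
     exists F, (forall x y, u <= x -> x <= y -> y <= v -> HK f x y (F y - F x)) /\ cont_on F u v).
  { intros u v h1 h2 h3 h4.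
    destruct (improper_primitive f (fun s => C * sing p s) (fun s => C * sing_prim p s) u v h2) as [F [F0 [CF [DF _]]]].
    - intros x Hx. apply Cf; [lra|]. intros ->. tauto.
    - intros x Hx. apply Hf; [lra|]. intros ->. tauto.
    - intros x Hx. apply (is_derive_scal (sing_prim p) x C). apply sing_prim_derive; [lra|]. intros ->. tauto.
    - apply continuous_cont_on. intros x _. apply (continuous_scal_r C (sing_prim p)). apply sing_prim_continuous.
    - exists F. split; [|assumption]. intros x y k1 k2 k3. apply (HK_FTC_open F f u v); auto. }
  destruct (P 0 p) as [F [HF _]]; try lra. destruct (P p (PI / 2)) as [G [HG CG]]; try lra.
  destruct (CG (PI / 2) ltac:(lra) eps e0) as [d [d0 Hd]].
  set (b := Rmax b0 (Rmax ((p + PI / 2) / 2) (PI / 2 - d / 2))).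
  assert (b1 : b0 <= b) by apply Rmax_l.
  assert (b2 : (p + PI / 2) / 2 <= b) by (eapply Rle_trans; [apply Rmax_l|apply Rmax_r]).
  assert (b3 : PI / 2 - d / 2 <= b) by (eapply Rle_trans; [apply Rmax_r|apply Rmax_r]).
  assert (b4 : b < PI / 2) by (repeat apply Rmax_lub_lt; lra).
  exists b, ((F p - F 0) + (G b - G p)). split; [lra|]. split; [lra|]. split.
  - apply (HK_concat f 0 p b); [apply HF; lra|apply HG; lra].
  - assert (I = (F p - F 0) + (G (PI / 2) - G p)).
    { apply (HK_unique f 0 (PI / 2)); [assumption|]. apply (HK_concat f 0 p); [apply HF; lra|apply HG; lra]. }
    specialize (Hd b ltac:(lra) ltac:(apply Rabs_def1; lra)). apply Rabs_def2 in Hd. lra.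
Qed.

Lemma Rmax_continuous a x : continuous (fun y => Rmax y a) x.
Proof.
  apply continuous_eps. intros eps e0. exists eps. split; [assumption|]. intros y Hy.
  eapply Rle_lt_trans; [|exact Hy]. unfold Rmax, Rabs. repeat destruct Rle_dec; repeat destruct Rcase_abs; lra.
Qed.

(* Up to the factor [2 x], the integral of [((4 y)^(9/16) - 1) / y^2] over [1/4 <= y], with [w = 4 y]. *)
Definition gain (w : R) := 64/7 * (1 - rp (-(7/16)) (Rmax w 1)) - 4 + 4 / Rmax w 1.

Lemma gain_low w : w <= 1 -> gain w = 0.
Proof.
  intros H. unfold gain. rewrite Rmax_right by lra. rewrite rp_pos by lra. unfold Rpower.
  rewrite ln_1, Rmult_0_r, exp_0. field.
Qed.

Lemma gain_continuous w : continuous gain w.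
Proof.
  assert (m : 1 <= Rmax w 1) by apply Rmax_r.
  apply (continuous_comp (fun w => Rmax w 1) (fun m => 64/7 * (1 - rp (-(7/16)) m) - 4 + 4 / m)).
  - apply Rmax_continuous.
  - apply (ex_derive_continuous (fun m => 64/7 * (1 - rp (-(7/16)) m) - 4 + 4 / m)).
    pose proof (rp_derive (-(7/16)) (Rmax w 1) ltac:(lra)) as D.
    assert (ex_derive (rp (-(7/16))) (Rmax w 1)) by (eexists; exact D).
    auto_derive. repeat split; [assumption|lra].
Qed.

Lemma gain_derive w : w <> 1 -> is_derive gain w (if Rle_dec w 1 then 0 else 4 * (rp (9/16) w - 1) / w ^ 2).
Proof.
  intros ne. destruct Rle_dec as [h|h].
  - apply (is_derive_ext_loc (fun _ => 0)).
    + assert (d0 : 0 < 1 - w) by lra. exists (mkposreal _ d0). intros y Hy.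
      change (Rabs (y - w) < 1 - w) in Hy. apply Rabs_def2 in Hy. symmetry. apply gain_low. lra.
    + apply (is_derive_const (K := R_AbsRing) (V := R_NormedModule)).
  - apply (is_derive_ext_loc (fun m => 64/7 * (1 - rp (-(7/16)) m) - 4 + 4 / m)).
    + assert (d0 : 0 < w - 1) by lra. exists (mkposreal _ d0). intros y Hy.
      change (Rabs (y - w) < w - 1) in Hy. apply Rabs_def2 in Hy. unfold gain. rewrite Rmax_left by lra. reflexivity.
    + pose proof (rp_derive (-(7/16)) w ltac:(lra)) as D.
      assert (ex : ex_derive (rp (-(7/16))) w) by (eexists; exact D).
      auto_derive; [repeat split; [assumption|lra]|].
      rewrite (is_derive_unique (fun x : R => rp (-(7/16)) x) w _ D).
      replace (rp (9/16) w) with (w * w * rp (-(7/16) - 1) w).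
      * field. lra.
      * rewrite <- (rp_1 w) at 1 2 by lra. rewrite <- !rp_plus by lra. f_equal. field.
Qed.

(** The limit at infinity is [64/7 - 4 = 72/14]. For [w >= 2^16] the power is at most [2^(-7)],
    which costs [1/14]. *)
Lemma gain_large w : 100000000 <= w -> 71/14 <= gain w.
Proof.
  intros Hw. unfold gain. rewrite Rmax_left by lra.
  assert (h : rp (-(7/16)) w <= / 128).
  { eapply Rle_trans; [apply (rp_anti (-(7/16)) (2 ^ 16) w); [lra|]; split; [apply pow_lt; lra|]|].
    - simpl. lra.
    - rewrite rp_pos by (apply pow_lt; lra). rewrite <- (Rpower_pow 16) by lra. rewrite Rpower_mult.
      replace (INR 16 * -(7/16)) with (- (INR 7)) by (simpl; field).
      rewrite Rpower_Ropp, Rpower_pow by lra. right. f_equal. simpl. ring. }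
  assert (0 < 4 / w) by (apply Rdiv_lt_0_compat; lra). lra.
Qed.

Lemma rp_mix r : 0 < r -> rp (9/4) r <= 3/4 * r ^ 2 + / 4 * r ^ 3.
Proof.
  intros Hr. set (q := rp (1/4) r). assert (q0 : 0 < q) by (apply rp_gt0; assumption).
  assert (q4 : q ^ 4 = r).
  { unfold q. rewrite rp_pos by assumption. rewrite <- Rpower_pow by apply exp_pos. rewrite Rpower_mult.
    replace (1/4 * INR 4) with 1 by (simpl; field). apply Rpower_1. assumption. }
  assert (E : rp (9/4) r = r ^ 2 * q).
  { unfold q. replace (9/4) with (INR 2 + 1/4) by (simpl; field). rewrite rp_plus by assumption. f_equal.
    rewrite rp_pos by assumption. apply Rpower_pow. assumption. }
  rewrite E. replace (3/4 * r ^ 2 + / 4 * r ^ 3) with (r ^ 2 * ((3 + r) / 4)) by field.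
  apply Rmult_le_compat_l; [apply pow2_ge_0|]. rewrite <- q4.
  (* The AM-GM inequality is the factorization [q^4 - 4 q + 3 = (q - 1)^2 (q^2 + 2 q + 3)]. *)
  assert (0 <= (q - 1) ^ 2 * (q ^ 2 + 2 * q + 3)) by (apply Rmult_le_pos; [apply pow2_ge_0|nra]).
  replace ((3 + q ^ 4) / 4) with (q + (q - 1) ^ 2 * (q ^ 2 + 2 * q + 3) / 4) by field. lra.
Qed.

Section Theta.
Variables (c M : R) (z : R -> R) (p : R).
Hypothesis c0 : 0 < c.
Hypothesis c1 : c <= 9/7.
Hypothesis Hz : adm M z.
Hypothesis zle : forall s, 0 < s < PI / 2 -> z s <= c * (Rmin 1 (thb s) * (cos s / sin s)).
Hypothesis Hp : 0 < p < PI / 2.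
Hypothesis tp : tan p <= / 4.

Let x := tan p.
Let r (s : R) := rp (1/4) (tan s / x).

(* With [y = tan s] and [r = (y / x)^(1/4)], weighted AM-GM gives [r^(9/4) <= (3 r^2 + r^3) / 4], after
   which the logarithm has the elementary primitive [Pr]; the second term records that [thb] may be
   replaced by [1] where [y > 1/4]. *)
Definition maj (s : R) := c * (thb p * (Lr (r s) * (3 * (r s) + (r s) ^ 2) * (r s / (4 * tan s) * (1 + tan s ^ 2)))
  - 2 * x * ((if Rle_dec (4 * tan s) 1 then 0 else 4 * (rp (9/16) (4 * tan s) - 1) / (4 * tan s) ^ 2) * (4 * (1 + tan s ^ 2)))).

Definition maj_prim (s : R) := c * (thb p * Pr (r s) - 2 * x * gain (4 * tan s)).

Lemma x_pos : 0 < x.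
Proof. unfold x. pose proof (tan_ge p Hp). lra. Qed.

Lemma maj_prim_derive s : 0 < s < PI / 2 -> s <> p -> 4 * tan s <> 1 -> is_derive maj_prim s (maj s).
Proof.
  intros Hs ne n1. pose proof x_pos as x0. pose proof (tan_ge s Hs) as ts.
  destruct (Kker_tan s p Hs Hp ne) as [r' [er [r0 [r1 [r4 _]]]]]. fold x in er, r4.
  fold (r s) in er. subst r'.
  pose proof (tan_derive s Hs) as Dt.
  assert (Dr : is_derive r s (r s / (4 * tan s) * (1 + tan s ^ 2))).
  { assert (q0 : 0 < tan s / x) by (apply Rdiv_lt_0_compat; lra).
    apply is_derive_eq with (((1 + tan s ^ 2) * / x) * (1/4 * rp (1/4 - 1) (tan s / x))).
    - apply (is_derive_comp (rp (1/4)) (fun s => tan s / x)); [apply rp_derive; assumption|].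
      apply (is_derive_ext (fun s => / x * tan s)); [intros t; apply Rmult_comm|].
      apply is_derive_eq with (/ x * (1 + tan s ^ 2)); [|ring].
      apply (is_derive_scal tan s (/ x)). exact Dt.
    - unfold r. replace (rp (1/4) (tan s / x)) with ((tan s / x) * rp (1/4 - 1) (tan s / x)).
      + field. lra.
      + rewrite <- (rp_1 (tan s / x)) at 1 by assumption. rewrite <- rp_plus by assumption. f_equal. field. }
  unfold maj_prim, maj. apply (is_derive_scal (fun s => thb p * Pr (r s) - 2 * x * gain (4 * tan s)) s c).
  apply (is_derive_minus (fun s => thb p * Pr (r s)) (fun s => 2 * x * gain (4 * tan s))).
  - apply (is_derive_scal (fun s => Pr (r s)) s (thb p)).
    eapply is_derive_eq.
    + apply (is_derive_comp Pr r); [apply Pr_derive; assumption|exact Dr].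
    + unfold scal; simpl; unfold mult; simpl. ring.
  - apply (is_derive_scal (fun s => gain (4 * tan s)) s (2 * x)).
    eapply is_derive_eq.
    + apply (is_derive_comp gain (fun s => 4 * tan s)); [apply gain_derive; assumption|].
      apply (is_derive_scal tan s 4). exact Dt.
    + unfold scal; simpl; unfold mult; simpl. ring.
Qed.

Lemma maj_prim_continuous s : 0 <= s < PI / 2 -> continuous maj_prim s.
Proof.
  intros Hs. pose proof x_pos as x0.
  assert (ct : continuous tan s).
  { apply (continuous_ext (fun s => sin s / cos s)); [reflexivity|].
    apply (ex_derive_continuous (fun s => sin s / cos s)). auto_derive.
    assert (0 < cos s) by (apply cos_gt_0; lra). lra. }
  assert (cr : continuous r s).
  { apply (continuous_comp (fun s => tan s / x) (rp (1/4))); [|apply rp_continuous; lra].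
    apply (continuous_ext (fun s => / x * tan s)); [intros t; apply Rmult_comm|].
    apply (continuous_scal_r (/ x) tan). assumption. }
  apply (continuous_scal_r c (fun s => thb p * Pr (r s) - 2 * x * gain (4 * tan s))).
  apply (continuous_minus (fun s => thb p * Pr (r s)) (fun s => 2 * x * gain (4 * tan s))).
  - apply (continuous_scal_r (thb p) (fun s => Pr (r s))). apply (continuous_comp r Pr); [assumption|].
    apply Pr_continuous. apply rp_ge0.
  - apply (continuous_scal_r (2 * x) (fun s => gain (4 * tan s))).
    apply (continuous_comp (fun s => 4 * tan s) gain); [|apply gain_continuous].
    apply (continuous_scal_r 4 tan). assumption.
Qed.

(** Replacing [ds] by [dy = (1 + y^2) ds], with [y = tan s], only increases a nonnegative majorant.
    Where [4 y > 1], the density uses [1] instead of [thb s], and the lower bound [2 x / y] of the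
    kernel turns this saving into the second term of [maj]; it applies because [tan p <= 1/4] forces
    [p < s] there. *)
Lemma maj_ge s : 0 < s < PI / 2 -> s <> p -> Kker s p * z s <= maj s.
Proof.
  intros Hs ne. pose proof x_pos as x0. pose proof (tan_ge s Hs) as ts.
  destruct (Kker_tan s p Hs Hp ne) as [r' [er [r0 [r1 [r4 EK]]]]]. fold x in er, r4.
  fold (r s) in er. subst r'.
  pose proof (Kker_ge0 s p ltac:(lra) ltac:(lra)) as K0.
  pose proof (zle s Hs) as zs. rewrite cot_tan in zs by assumption.
  set (K := Kker s p) in *. set (y := tan s) in *.
  assert (y0 : 0 < y) by lra. assert (iy : 0 < / y) by (apply Rinv_0_lt_compat; lra).
  assert (X : thb s <= thb p * (3/4 * r s ^ 2 + / 4 * r s ^ 3)).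
  { assert (E : thb s = thb p * rp (9/4) (r s)).
    { unfold thb. fold x y. replace (4 * y) with ((4 * x) * (y / x)) by (field; lra).
      rewrite rp_mult by (try apply Rdiv_lt_0_compat; lra). f_equal.
      unfold r. fold y. rewrite (rp_pos (1/4)) by (apply Rdiv_lt_0_compat; lra).
      rewrite (rp_pos (9/4)) by apply exp_pos. rewrite Rpower_mult, rp_pos by (apply Rdiv_lt_0_compat; lra).
      f_equal. field. }
    rewrite E. apply Rmult_le_compat_l; [apply rp_ge0|]. apply rp_mix. assumption. }
  set (B := thb p * (3/4 * r s ^ 2 + / 4 * r s ^ 3)) in *.
  assert (EM : maj s = c * (1 + y ^ 2) * (K * B * / y - 2 * x * (if Rle_dec (4 * y) 1 then 0 else (thb s - 1) / y ^ 2))).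
  { unfold maj. fold y. rewrite EK. unfold B. unfold thb at 3. fold y. destruct Rle_dec; field; lra. }
  rewrite EM.
  assert (Y : K * z s <= c * (K * (Rmin 1 (thb s) * / y))).
  { apply Rle_trans with (K * (c * (Rmin 1 (thb s) * / y))); [apply Rmult_le_compat_l; assumption|lra]. }
  assert (key : K * (Rmin 1 (thb s) * / y) <= K * B * / y - 2 * x * (if Rle_dec (4 * y) 1 then 0 else (thb s - 1) / y ^ 2)).
  { destruct Rle_dec as [h|h].
    - assert (Rmin 1 (thb s) <= B) by (eapply Rle_trans; [apply Rmin_r|exact X]).
      assert (K * (Rmin 1 (thb s) * / y) <= K * (B * / y)).
      { apply Rmult_le_compat_l; [assumption|]. apply Rmult_le_compat_r; lra. }
      lra.
    - assert (t1 : 1 <= thb s).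
      { unfold thb. fold y. assert (1 = rp (9/16) 1) as ->.
        { rewrite rp_pos by lra. unfold Rpower. rewrite ln_1, Rmult_0_r, exp_0. reflexivity. }
        apply rp_mono; lra. }
      rewrite Rmin_left by assumption.
      assert (ps : p < s).
      { destruct (Rtotal_order s p) as [k|[k|k]]; [|contradiction|assumption].
        pose proof (tan_lt s p ltac:(lra) k ltac:(lra)) as k'. fold x y in k'. fold x in tp. lra. }
      pose proof (Kker_lower s p ltac:(lra) ltac:(lra)) as KL. fold K x y in KL.
      assert (w1 : K * thb s * / y <= K * B * / y).
      { apply Rmult_le_compat_r; [lra|]. apply Rmult_le_compat_l; assumption. }
      assert (w2 : 0 <= (thb s - 1) * / y * (K - 2 * (x / y))).
      { apply Rmult_le_pos; [apply Rmult_le_pos; lra|lra]. }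
      replace (2 * x * ((thb s - 1) / y ^ 2)) with ((thb s - 1) * / y * (2 * (x / y))) by (field; lra). lra. }
  assert (0 <= K * (Rmin 1 (thb s) * / y)).
  { apply Rmult_le_pos; [assumption|]. apply Rmult_le_pos; [|lra]. apply Rmin_glb; [lra|apply rp_ge0]. }
  set (D := K * B * / y - 2 * x * (if Rle_dec (4 * y) 1 then 0 else (thb s - 1) / y ^ 2)) in *.
  assert (c * (K * (Rmin 1 (thb s) * / y)) <= c * D) by (apply Rmult_le_compat_l; lra).
  pose proof (pow2_ge_0 y). assert (0 <= c * D * y ^ 2) by (apply Rmult_le_pos; [apply Rmult_le_pos; lra|assumption]).
  lra.
Qed.

(** For [c = 9/7] the first term of the bound of [PI * Hop z p] is exactly [3 PI thb p]. The gain is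
    [(9/7) (71/7) x], and a third of it exceeds [4 x >= PI p], which pays for the linear term
    [p]. *)
Lemma theta_le_thb : p + / 3 * Hop z p <= thb p.
Proof.
  pose proof x_pos as x0. pose proof PI_ge_3 as P3. pose proof PI_4 as P4.
  pose proof (HK_Hop M z p Hz ltac:(lra)) as HI.
  (* Beyond [b0] the ratio [tan b / x] exceeds [100^4], as [x <= 1/4], and [4 tan b] is large enough
     for the estimate of [gain]. *)
  set (b0 := atan 100000000).
  assert (B0 : b0 < PI / 2) by apply atan_bound.
  assert (b0p : 0 < b0) by (unfold b0; rewrite <- atan_0; apply atan_increasing; lra).
  assert (X4 : 4 * x <= thb p).
  { unfold thb. fold x. rewrite <- (rp_1 (4 * x)) at 1 by lra.
    rewrite !rp_pos by lra. unfold Rpower.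
    assert (ln (4 * x) <= 0) by (rewrite <- ln_1; apply ln_le; fold x in tp; lra).
    destruct (Req_dec (ln (4 * x)) 0) as [e|e]; [rewrite e, !Rmult_0_r; lra|].
    apply Rlt_le, exp_increasing. lra. }
  assert (bd : PI * Hop z p <= c * (thb p * (7/3 * PI) - 2 * x * (71/14))).
  { apply le_epsilon. intros eps e0.
    destruct (HK_singular_cut (fun s => Kker s p * z s) p (16 * M) (PI * Hop z p) b0 eps Hp) as [b [J [Hb [pb [HJ IJ]]]]]; auto.
    - destruct Hz. lra.
    - intros s Hs ne. apply (continuous_mult (fun s => Kker s p) z).
      + apply Kker_continuous; auto; lra.
      + apply Hz. assumption.
    - intros s Hs ne. apply Kker_adm; auto; lra.
    - assert (HM : HK maj 0 b (maj_prim b - maj_prim 0)).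
      { apply (HK_FTC maj_prim maj (0 :: p :: atan (/ 4) :: nil)); [lra| |].
        - apply continuous_cont_on. intros s Hs. apply maj_prim_continuous. lra.
        - intros s Hs Hn. simpl in Hn. assert (s <> 0) by (intros ->; tauto). apply maj_prim_derive.
          + lra.
          + intros ->. tauto.
          + intros e. apply Hn. right. right. left.
            replace (/ 4) with (tan s) by lra. apply atan_tan. lra. }
      assert (J <= maj_prim b - maj_prim 0).
      { apply (HK_le_except (fun s => Kker s p * z s) maj (0 :: p :: nil) 0 b); [|assumption|assumption].
        intros s Hs Hn. simpl in Hn. assert (s <> 0) by (intros ->; tauto).
        apply maj_ge; [lra|]. intros ->. tauto. }
      assert (m0 : maj_prim 0 = 0).
      { unfold maj_prim, r. rewrite tan_0. unfold Rdiv. rewrite Rmult_0_l, rp_npos, Pr_0, Rmult_0_r, gain_low by lra. ring. }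
      assert (tb : 100000000 <= tan b).
      { replace 100000000 with (tan b0) by (unfold b0; apply tan_atan).
        destruct (Req_dec b0 b) as [->|nb]; [lra|]. apply Rlt_le, tan_lt; lra. }
      assert (rb : 100 <= r b).
      { unfold r. replace 100 with (rp (1/4) (100 ^ 4)).
        - apply rp_mono; [lra|]. apply Rle_trans with (tan b); [simpl; lra|].
          apply Rmult_le_reg_r with x; [lra|]. unfold Rdiv. rewrite Rmult_assoc, Rinv_l by lra.
          fold x in tp. nra.
        - rewrite rp_pos by (apply pow_lt; lra). rewrite <- (Rpower_pow 4) by lra. rewrite Rpower_mult.
          replace (INR 4 * (1/4)) with 1 by (simpl; field). apply Rpower_1. lra. }
      pose proof (Pr_large (r b) rb) as k1. pose proof (gain_large (4 * tan b) ltac:(lra)) as k2.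
      assert (maj_prim b <= c * (thb p * (7/3 * PI) - 2 * x * (71/14))).
      { apply Rmult_le_compat_l; [lra|].
        assert (thb p * Pr (r b) <= thb p * (7/3 * PI)) by (apply Rmult_le_compat_l; [apply rp_ge0|assumption]).
        assert (2 * x * (71/14) <= 2 * x * gain (4 * tan b)) by (apply Rmult_le_compat_l; lra). lra. }
      lra. }
  pose proof (tan_ge p Hp) as px. fold x in px.
  set (Q := thb p * (7/3 * PI) - 2 * x * (71/14)) in *.
  (* The sign is needed to replace [c] by [9/7]; it follows from [4 x <= thb p], valid since
     [4 x <= 1]. *)
  assert (Q0 : 0 <= Q) by (unfold Q; nra).
  assert (bd2 : PI * Hop z p <= 9/7 * Q) by nra.
  assert (PI * (p + / 3 * Hop z p) <= PI * thb p).
  { unfold Q in bd2. nra. }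
  apply Rmult_le_reg_l with PI; lra.
Qed.
End Theta.

(** * Removing the truncation *)

Lemma last_crossing (f : R -> R) a m L : (forall x, continuous f x) -> a <= m -> f a <= L -> L < f m ->
  exists p, a <= p < m /\ f p = L /\ forall s, p < s <= m -> L < f s.
Proof.
  intros Cf am fa fm.
  destruct (completeness (fun s => a <= s <= m /\ f s <= L)) as [p [Hu Hl]].
  { exists m. intros s [Hs _]. lra. }
  { exists a. split; [lra|assumption]. }
  assert (ap : a <= p) by (apply Hu; split; [lra|assumption]).
  assert (pm : p <= m) by (apply Hl; intros s [Hs _]; lra).
  assert (above : forall s, p < s <= m -> L < f s).
  { intros s Hs. apply Rnot_le_lt. intros h. assert (s <= p) by (apply Hu; split; [lra|assumption]). lra. }
  assert (le : f p <= L).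
  { apply Rnot_lt_le. intros h.
    destruct (continuous_eps_inv f p (Cf p) (f p - L) ltac:(lra)) as [d [d0 Hd]].
    assert (p <= p - d); [|lra]. apply Hl. intros s [Hs fs].
    apply Rnot_lt_le. intros hs. assert (s <= p) by (apply Hu; split; assumption).
    specialize (Hd s ltac:(apply Rabs_def1; lra)). apply Rabs_def2 in Hd. lra. }
  assert (pm' : p < m).
  { destruct (Rle_lt_or_eq_dec p m pm) as [h| ->]; [assumption|lra]. }
  exists p. split; [lra|]. split; [|assumption]. apply Rle_antisym; [assumption|].
  apply Rnot_lt_le. intros h.
  destruct (continuous_eps_inv f p (Cf p) (L - f p) ltac:(lra)) as [d [d0 Hd]].
  set (s := Rmin m (p + d / 2)).
  assert (s <= m) by apply Rmin_l. assert (s <= p + d / 2) by apply Rmin_r.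
  assert (p < s) by (apply Rmin_glb_lt; lra).
  specialize (Hd s ltac:(apply Rabs_def1; lra)). apply Rabs_def2 in Hd. pose proof (above s ltac:(lra)). lra.
Qed.

Lemma convex_chord (f d : R -> R) p q m : p < m < q ->
  (forall x, p <= x <= q -> is_derive f x (d x)) ->
  (forall x y, p <= x -> x <= y -> y <= q -> d x <= d y) ->
  (q - p) * f m <= (q - m) * f p + (m - p) * f q.
Proof.
  intros Hm Df Md.
  assert (V : forall u v, p <= u -> u < v -> v <= q -> exists t, u <= t <= v /\ f v - f u = d t * (v - u)).
  { intros u v h1 h2 h3. destruct (MVT_gen f u v d) as [t [Ht E]].
    - intros x Hx. rewrite Rmin_left, Rmax_right in Hx by lra. apply Df. lra.
    - intros x Hx. rewrite Rmin_left, Rmax_right in Hx by lra.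
      apply continuity_pt_filterlim. apply (ex_derive_continuous f). eexists. apply Df. lra.
    - rewrite Rmin_left, Rmax_right in Ht by lra. exists t. split; assumption. }
  destruct (V p m) as [t [Ht Et]]; try lra. destruct (V m q) as [t' [Ht' Et']]; try lra.
  pose proof (Md t t' ltac:(lra) ltac:(lra) ltac:(lra)) as h.
  assert (0 <= (d t' - d t) * ((m - p) * (q - m))) by (apply Rmult_le_pos; [lra|]; apply Rmult_le_pos; lra).
  nra.
Qed.

(* Away from the diagonal the kernel is convex in its second variable, since
   its derivative is [sin (2 s) / (sin^2 s - sin^2 t)]. *)
Lemma Kker_chord s p q m : 0 < s < PI / 2 -> 0 < p -> p < m < q -> q < PI / 2 -> s < p \/ q < s ->
  (q - p) * Kker s m <= (q - m) * Kker s p + (m - p) * Kker s q.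
Proof.
  intros Hs Hp Hm Hq Hout.
  set (f := fun t => ln (sin (s + t)) - / 2 * ln ((sin (s - t)) ^ 2)).
  assert (Ef : forall t, p <= t <= q -> Kker s t = f t).
  { intros t Ht. destruct (Kker_log s t ltac:(lra) ltac:(lra) ltac:(lra)) as [pos ->]. unfold f.
    rewrite ln_sqr; [field|]. intros e. rewrite e, Rabs_R0 in pos. lra. }
  rewrite !Ef by lra.
  assert (prod : forall t, sin (s + t) * sin (s - t) = sin s ^ 2 - sin t ^ 2).
  { intros t. rewrite sin_plus, sin_minus. pose proof (sin2_cos2 s) as a. pose proof (sin2_cos2 t) as b. unfold Rsqr in a, b.
    transitivity ((sin s * sin s) * (cos t * cos t) - (cos s * cos s) * (sin t * sin t)); [ring|].
    replace (cos t * cos t) with (1 - sin t * sin t) by lra. replace (cos s * cos s) with (1 - sin s * sin s) by lra. ring. }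
  assert (smono : forall x y, 0 < x -> x < y -> y < PI / 2 -> sin x ^ 2 < sin y ^ 2).
  { intros x y h1 h2 h3. assert (sin x < sin y) by (apply sin_increasing_1; lra).
    assert (0 < sin x) by (apply sin_gt_0; lra). simpl. nra. }
  assert (S2 : 0 <= sin (2 * s)) by (apply sin_ge_0; lra).
  apply (convex_chord f (fun t => sin (2 * s) * / (sin s ^ 2 - sin t ^ 2))); [assumption| |].
  - intros t Ht. destruct (Kker_log s t ltac:(lra) ltac:(lra) ltac:(lra)) as [pos _].
    pose proof (sin_diff_le_sum s t ltac:(lra) ltac:(lra)).
    assert (n1 : sin (s - t) <> 0) by (intros e; rewrite e, Rabs_R0 in pos; lra).
    rewrite <- prod. unfold f. auto_derive.
    + split; [lra|]. split; [|exact I]. pose proof (pow2_gt_0 _ n1) as h. replace (s + - t) with (s - t) by ring. simpl in h. lra.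
    + replace (s + - t) with (s - t) by ring. replace (2 * s) with ((s + t) + (s - t)) by ring.
      rewrite (sin_plus (s + t) (s - t)). field. repeat split; first [assumption | lra].
  - intros x y h1 h2 h3. apply Rmult_le_compat_l; [assumption|].
    destruct (Req_dec x y) as [->|ne]; [lra|]. pose proof (smono x y ltac:(lra) ltac:(lra) ltac:(lra)).
    destruct Hout as [ho|ho].
    + pose proof (smono s x ltac:(lra) ltac:(lra) ltac:(lra)).
      pose proof (smono s y ltac:(lra) ltac:(lra) ltac:(lra)).
      apply Ropp_le_cancel. rewrite <- !Rinv_opp. apply Rinv_le_contravar; lra.
    + pose proof (smono y s ltac:(lra) ltac:(lra) ltac:(lra)). apply Rinv_le_contravar; lra.
Qed.

(* On a component of [{s + h/3 > PI}] the function [z] vanishes, so [Hop z] is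
   convex there and stays below the chord joining the end points. *)
Lemma theta_le_PI M z h : adm M z -> (forall x, continuous h x) ->
  (forall x, 0 <= x <= PI / 2 -> h x = Hop z x) ->
  (forall s, 0 < s < PI / 2 -> PI <= s + / 3 * h s -> z s = 0) ->
  forall s, 0 <= s <= PI / 2 -> s + / 3 * h s <= PI.
Proof.
  intros Hz Ch Eh Zh m Hm. pose proof PI_ge_3 as P3. apply Rnot_lt_le. intros big.
  set (th := fun s => s + / 3 * h s). fold (th m) in big.
  assert (Cth : forall x, continuous th x).
  { intros x. apply (continuous_plus (fun s => s) (fun s => / 3 * h s)); [apply continuous_id|].
    apply (continuous_scal_r (/ 3) h). apply Ch. }
  assert (t0 : th 0 = 0) by (unfold th; rewrite Eh, Hop_0 by lra; ring).
  assert (t1 : th (PI / 2) = PI / 2) by (unfold th; rewrite Eh, Hop_PI2 by lra; ring).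
  destruct (last_crossing th 0 m PI Cth ltac:(lra) ltac:(lra) big) as [p [Hp [Ep Ap]]].
  (* Reflecting the line turns the last crossing before [m] into the first return to [PI] after
     [m]. *)
  destruct (last_crossing (fun x => th (- x)) (- (PI / 2)) (- m) PI) as [q' [Hq [Eq Aq]]].
  { intros x. apply (continuous_comp Ropp th); [|apply Cth]. apply (ex_derive_continuous Ropp). auto_derive. exact I. }
  { lra. }
  { rewrite Ropp_involutive. lra. }
  { rewrite Ropp_involutive. assumption. }
  set (q := - q'). fold q in Eq.
  assert (Bq : forall s, m <= s < q -> PI < th s).
  { intros s Hs. rewrite <- (Ropp_involutive s). apply Aq. unfold q in Hs. lra. }
  assert (p0 : p <> 0) by (intros e; rewrite e in Ep; lra).
  assert (q1 : q <> PI / 2) by (intros e; rewrite e in Eq; lra).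
  assert (Hpq : 0 < p /\ p < m < q /\ q < PI / 2) by (unfold q in *; lra).
  destruct Hpq as [hp [hm hq]].
  assert (ge : forall s, p <= s <= q -> PI <= th s).
  { intros s Hs. destruct (Req_dec s p) as [->|]; [lra|]. destruct (Req_dec s q) as [->|]; [lra|].
    destruct (Rle_dec s m); apply Rlt_le; [apply Ap; lra|apply Bq; lra]. }
  assert (ineq : (q - p) * (PI * Hop z m) <= (q - m) * (PI * Hop z p) + (m - p) * (PI * Hop z q)).
  { apply (HK_le_except (fun s => (q - p) * (Kker s m * z s))
      (fun s => (q - m) * (Kker s p * z s) + (m - p) * (Kker s q * z s)) (0 :: PI / 2 :: nil) 0 (PI / 2)).
    - intros s Hs Hn. simpl in Hn.
      assert (Hs' : 0 < s < PI / 2).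
      { destruct (Req_dec s 0) as [->|]; [tauto|]. destruct (Req_dec s (PI / 2)) as [->|]; [tauto|]. lra. }
      destruct (Rle_dec p s) as [ps|ps]; [destruct (Rle_dec s q) as [sq|sq]|].
      + rewrite (Zh s Hs') by (apply ge; lra). lra.
      + pose proof (Kker_chord s p q m Hs' hp hm hq ltac:(lra)) as k.
        destruct Hz as [_ Hz]. destruct (Hz s Hs') as [_ [z0 _]].
        apply Rmult_le_compat_r with (r := z s) in k; [lra|assumption].
      + pose proof (Kker_chord s p q m Hs' hp hm hq ltac:(lra)) as k.
        destruct Hz as [_ Hz]. destruct (Hz s Hs') as [_ [z0 _]].
        apply Rmult_le_compat_r with (r := z s) in k; [lra|assumption].
    - apply HK_scal. apply (HK_Hop M); [assumption|lra].
    - apply HK_plus; apply HK_scal; apply (HK_Hop M); try assumption; lra. }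
  assert (ineq2 : (q - p) * h m <= (q - m) * h p + (m - p) * h q).
  { rewrite !Eh by lra. apply Rmult_le_reg_l with PI; [lra|]. lra. }
  unfold th in *. cbv beta in *. fold q in Eq. nra.
Qed.

(** * The square norm and the return to the original equation *)

Lemma HK_ext_except f g (S : list R) a b I :
  (forall x, a <= x <= b -> ~ In x S -> f x = g x) -> HK f a b I -> HK g a b I.
Proof.
  intros H HI. rewrite <- (Rplus_0_r I).
  apply (HK_ext (fun x => f x + (g x - f x))); [intros; ring|].
  apply HK_plus; [assumption|]. apply (HK_zero_except _ S); [apply HI|].
  intros x Hx Hn. rewrite (H x Hx Hn). ring.
Qed.

Lemma ln_lipschitz x y : 1 <= x -> 1 <= y -> Rabs (ln x - ln y) <= Rabs (x - y).
Proof.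
  assert (W : forall x y, 1 <= y -> y <= x -> Rabs (ln x - ln y) <= Rabs (x - y)).
  { clear. intros x y hy hxy. assert (ln y <= ln x) by (apply ln_le; lra). rewrite !Rabs_pos_eq by lra.
    rewrite <- ln_div by lra. rewrite <- (ln_exp (x - y)). apply ln_le; [apply Rdiv_lt_0_compat; lra|].
    eapply Rle_trans; [|apply exp_ineq1_le]. apply Rmult_le_reg_r with y; [lra|].
    unfold Rdiv. rewrite Rmult_assoc, Rinv_l by lra. nra. }
  intros hx hy. destruct (Rle_dec y x); [apply W; lra|].
  rewrite (Rabs_minus_sym (ln x)), (Rabs_minus_sym x). apply W; lra.
Qed.

Lemma ae_on_all a b (P : R -> Prop) : (forall x, a < x < b -> P x) -> ae_on a b P.
Proof.
  intros H. exists (fun _ => False). split; [|auto].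
  intros eps e0. exists (fun _ => 0), (fun _ => 0). split; [intros; lra|]. split; [intros; tauto|].
  intros n. rewrite (sum_eq _ (fun _ => 0)); [|intros; ring]. rewrite sum_cte. lra.
Qed.

(** The interval is split where the cap reaches [1], at [tan s = 1/4]. Below, in the variable
    [y = tan s], the square is at most [16 c^2 (4 y)^(-7/8)], with integral [32 c^2]; above, it is
    at most [c^2 / sin^2 s], with integral [c^2] times the cotangent [4] of the splitting point. *)
Lemma HK_square_bound c z F : 0 < c -> (forall s, 0 < s < PI / 2 -> 0 <= z s <= c * (Rmin 1 (thb s) * (cos s / sin s))) ->
  (forall x y, 0 <= x -> x <= y -> y <= PI / 2 -> HK (fun s => z s ^ 2) x y (F y - F x)) ->
  F (PI / 2) - F 0 <= 36 * c ^ 2.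
Proof.
  intros c0 Hz HF. pose proof PI_ge_3 as P3. pose proof (pow2_ge_0 c) as cc.
  set (s0 := atan (/ 4)).
  assert (s0b : 0 < s0 < PI / 2).
  { split; [unfold s0; rewrite <- atan_0; apply atan_increasing; lra|apply atan_bound]. }
  assert (ts0 : tan s0 = / 4) by apply tan_atan.
  assert (A : F s0 - F 0 <= c ^ 2 * (32 * rp (1/8) (4 * tan s0)) - c ^ 2 * (32 * rp (1/8) (4 * tan 0))).
  { apply (HK_le_except (fun s => z s ^ 2) (fun s => c ^ 2 * (32 * (1/8 * rp (1/8 - 1) (4 * tan s) * (4 * (1 + tan s ^ 2)))))
      (0 :: nil) 0 s0); [|apply HF; lra|].
    - intros s Hs Hn. assert (s <> 0) by (intros ->; apply Hn; left; reflexivity).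
      assert (Hs' : 0 < s < PI / 2) by lra. destruct (Hz s Hs') as [z0 z1]. pose proof (tan_ge s Hs') as ts.
      rewrite cot_tan in z1 by assumption. set (y := tan s) in *.
      assert (iy : 0 < / y) by (apply Rinv_0_lt_compat; lra).
      assert (z2 : z s <= c * (thb s * / y)).
      { eapply Rle_trans; [exact z1|]. apply Rmult_le_compat_l; [lra|]. apply Rmult_le_compat_r; [lra|apply Rmin_r]. }
      assert (z3 : z s ^ 2 <= (c * (thb s * / y)) ^ 2) by (apply pow_incr; lra).
      eapply Rle_trans; [exact z3|].
      replace ((c * (thb s * / y)) ^ 2) with (c ^ 2 * (16 * rp (1/8 - 1) (4 * y))).
      + apply Rmult_le_compat_l; [assumption|]. pose proof (rp_ge0 (1/8 - 1) (4 * y)) as g. pose proof (pow2_ge_0 y).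
        assert (0 <= rp (1/8 - 1) (4 * y) * y ^ 2) by (apply Rmult_le_pos; assumption). lra.
      + unfold thb. fold y.
        assert (E : rp (9/16) (4 * y) * rp (9/16) (4 * y) = (4 * y) * (4 * y) * rp (1/8 - 1) (4 * y)).
        { rewrite <- (rp_1 (4 * y)) at 3 4 by lra. rewrite <- !rp_plus by lra. f_equal. field. }
        replace ((c * (rp (9/16) (4 * y) * / y)) ^ 2) with (c ^ 2 * (rp (9/16) (4 * y) * rp (9/16) (4 * y)) * (/ y * / y)) by ring.
        rewrite E. field. lra.
    - apply (HK_FTC (fun s => c ^ 2 * (32 * rp (1/8) (4 * tan s))) _ (0 :: nil)); [lra| |].
      + apply continuous_cont_on. intros s Hs. apply (continuous_scal_r (c ^ 2) (fun s => 32 * rp (1/8) (4 * tan s))).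
        apply (continuous_scal_r 32 (fun s => rp (1/8) (4 * tan s))).
        apply (continuous_comp (fun s => 4 * tan s) (rp (1/8))); [|apply rp_continuous; lra].
        apply (continuous_scal_r 4 tan). apply (continuous_ext (fun s => sin s / cos s)); [reflexivity|].
        apply (ex_derive_continuous (fun s => sin s / cos s)). auto_derive.
        assert (0 < cos s) by (apply cos_gt_0; lra). lra.
      + intros s Hs Hn. assert (s <> 0) by (intros ->; apply Hn; left; reflexivity).
        assert (Hs' : 0 < s < PI / 2) by lra. pose proof (tan_ge s Hs').
        apply (is_derive_scal (fun s => 32 * rp (1/8) (4 * tan s)) s (c ^ 2)).
        apply (is_derive_scal (fun s => rp (1/8) (4 * tan s)) s 32).
        apply is_derive_eq with ((4 * (1 + tan s ^ 2)) * (1/8 * rp (1/8 - 1) (4 * tan s))); [|ring].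
        apply (is_derive_comp (rp (1/8)) (fun s => 4 * tan s)); [apply rp_derive; lra|].
        apply (is_derive_scal tan s 4). apply tan_derive. assumption. }
  rewrite ts0, tan_0, (rp_npos _ (4 * 0)) in A by lra. replace (4 * / 4) with 1 in A by field.
  assert (one : rp (1/8) 1 = 1) by (rewrite rp_pos by lra; unfold Rpower; rewrite ln_1, Rmult_0_r, exp_0; reflexivity).
  rewrite one in A.
  assert (B : F (PI / 2) - F s0 <= c ^ 2 * - (cos (PI / 2) / sin (PI / 2)) - c ^ 2 * - (cos s0 / sin s0)).
  { apply (HK_le_except (fun s => z s ^ 2) (fun s => c ^ 2 * / (sin s ^ 2)) (PI / 2 :: nil) s0 (PI / 2)); [|apply HF; lra|].
    - intros s Hs Hn. assert (s <> PI / 2) by (intros ->; apply Hn; left; reflexivity).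
      assert (Hs' : 0 < s < PI / 2) by lra. destruct (Hz s Hs') as [z0 z1]. destruct (sin_cos_pos s Hs') as [h1 h2].
      assert (co : 0 < cos s / sin s) by (apply Rdiv_lt_0_compat; assumption).
      assert (z2 : z s <= c * (1 * (cos s / sin s))).
      { eapply Rle_trans; [exact z1|]. apply Rmult_le_compat_l; [lra|]. apply Rmult_le_compat_r; [lra|apply Rmin_l]. }
      assert (z3 : z s ^ 2 <= (c * (1 * (cos s / sin s))) ^ 2) by (apply pow_incr; lra).
      eapply Rle_trans; [exact z3|].
      replace ((c * (1 * (cos s / sin s))) ^ 2) with (c ^ 2 * (cos s ^ 2 * / (sin s ^ 2))) by (field; lra).
      apply Rmult_le_compat_l; [assumption|].
      assert (0 < / (sin s ^ 2)) by (apply Rinv_0_lt_compat; apply pow_lt; assumption).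
      assert (cos s ^ 2 <= 1) by (pose proof (COS_bound s); simpl; nra). nra.
    - apply (HK_FTC (fun s => c ^ 2 * - (cos s / sin s)) _ nil); [lra| |].
      + apply continuous_cont_on. intros s Hs.
        apply (ex_derive_continuous (fun s => c ^ 2 * - (cos s / sin s))). auto_derive.
        assert (0 < sin s) by (apply sin_gt_0; lra). lra.
      + intros s Hs _. assert (0 < sin s) by (apply sin_gt_0; lra).
        apply (is_derive_scal (fun s => - (cos s / sin s)) s (c ^ 2)).
        auto_derive; [lra|]. pose proof (sin2_cos2 s) as e. unfold Rsqr in e.
        replace (/ (sin s ^ 2)) with ((sin s * sin s + cos s * cos s) * / (sin s ^ 2)) by (rewrite e; ring).
        field. lra. }
  rewrite cos_PI2 in B.
  replace (cos s0 / sin s0) with 4 in B by (rewrite cot_tan, ts0 by assumption; field).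
  lra.
Qed.

Theorem theorem3p7 :
  forall alpha : R,
    2 / PI * (1 + 1 / (3 * sqrt PI)) <= alpha ->
    exists zeta : R -> R,
      L2 zeta /\
      ae_on 0 (PI / 2) (fun s => 0 <= zeta s) /\
      ae_on 0 (PI / 2) (fun s => zeta s = Phi alpha zeta s) /\
      ae_on 0 (PI / 2) (fun s => 0 <= s + / 3 * Hop zeta s <= PI) /\
      L2norm zeta <= 9 * sqrt PI / 2.
Proof.
  intros alpha Ha. pose proof PI_ge_3 as P3. pose proof PI_4 as P4.
  assert (sP : 0 < sqrt PI <= 2).
  { split; [apply sqrt_lt_R0; lra|]. rewrite <- (sqrt_Rsqr 2) by lra. apply sqrt_le_1; unfold Rsqr; lra. }
  assert (aP : 7/3 <= alpha * PI).
  { apply Rmult_le_compat_r with (r := PI) in Ha; [|lra].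
    replace (2 / PI * (1 + 1 / (3 * sqrt PI)) * PI) with (2 * (1 + 1 / (3 * sqrt PI))) in Ha by (field; lra).
    assert (1 / 6 <= 1 / (3 * sqrt PI)).
    { unfold Rdiv. rewrite !Rmult_1_l. apply Rinv_le_contravar; lra. }
    lra. }
  set (c := 3 / (alpha * PI)).
  assert (c0 : 0 < c) by (apply Rdiv_lt_0_compat; lra).
  assert (c1 : c <= 9/7).
  { apply Rmult_le_reg_r with (alpha * PI); [lra|]. unfold c, Rdiv at 1. rewrite Rmult_assoc, Rinv_l; lra. }
  destruct (fixed_point_exists c c0) as [h [Ch Eh]].
  assert (Ch' : forall s, 0 < s < PI / 2 -> continuous h s) by (intros; apply Ch).
  set (z := zt c h) in *.
  pose proof (zt_adm c c0 h Ch') as Az. fold z in Az.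
  assert (h0 : forall s, 0 <= s <= PI / 2 -> 0 <= h s).
  { intros s Hs. rewrite Eh by assumption. apply (Hop_bound (8 * c)); assumption. }
  assert (zb : forall s, 0 < s < PI / 2 -> 0 <= z s <= c * (Rmin 1 (thb s) * (cos s / sin s))).
  { intros s Hs. destruct (zt_le c c0 h s Ch' Hs) as [z0 z1]. split; [assumption|].
    eapply Rle_trans; [exact z1|]. apply Rmult_le_compat_l; [lra|]. unfold pz.
    destruct (sin_cos_pos s Hs). apply Rmult_le_compat_r; [apply Rlt_le, Rdiv_lt_0_compat; assumption|].
    apply Rmin_glb; [eapply Rle_trans; [apply Rmin_l|apply clampsin_range]|apply Rmin_r]. }
  assert (pe : forall s, 0 < s < PI / 2 -> pz h s = clampsin (s + / 3 * h s) * (cos s / sin s)).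
  { intros s Hs. unfold pz. rewrite Rmin_left; [reflexivity|].
    (* For [tan s <= 1/4] the truncated sine is at most the angle, hence at most [thb s]; elsewhere
       [thb s] is at least [1]. *)
    destruct (Rle_dec (tan s) (/ 4)) as [t|t].
    - apply Rle_trans with (s + / 3 * h s).
      + pose proof (h0 s ltac:(lra)). unfold clampsin.
        set (u := Rmax 0 (Rmin PI (s + / 3 * h s))).
        assert (0 <= u) by apply Rmax_l.
        assert (u <= s + / 3 * h s) by (apply Rmax_lub; [lra|apply Rmin_r]).
        destruct (Req_dec u 0) as [->|]; [rewrite sin_0; lra|]. pose proof (sin_lt_x u ltac:(lra)). lra.
      + rewrite Eh by lra. apply (theta_le_thb c (8 * c)); auto. intros r Hr. apply zb. assumption.
    - eapply Rle_trans; [apply clampsin_range|].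
      assert (1 = rp (9/16) 1) as ->.
      { rewrite rp_pos by lra. unfold Rpower. rewrite ln_1, Rmult_0_r, exp_0. reflexivity. }
      apply rp_mono; lra. }
  assert (th : forall s, 0 <= s <= PI / 2 -> s + / 3 * h s <= PI).
  { apply (theta_le_PI (8 * c) z); auto. intros s Hs big. unfold z, zt.
    rewrite (pe s Hs), clampsin_big by assumption. unfold Rdiv. ring. }
  destruct (Ez_props c c0 h Ch') as [E [E0 [CE [DE HE]]]].
  assert (HL : forall s, 0 <= s <= PI / 2 -> HKint z 0 s = ln (E s)).
  { intros s Hs. apply HKint_eq. replace (ln (E s)) with (ln (E s) - ln (E 0)) by (rewrite E0, ln_1; ring).
    apply (HK_FTC_open (fun s => ln (E s)) z 0 (PI / 2)); try lra.
    - intros x Hx e e0. destruct (CE x Hx e e0) as [d [d0 Hd]]. exists d. split; [assumption|].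
      intros y Hy Hyx. specialize (Hd y Hy Hyx). eapply Rle_lt_trans; [|exact Hd].
      apply ln_lipschitz; apply HE; lra.
    - intros x Hx. destruct (HE x ltac:(lra)) as [e1 e2].
      apply is_derive_eq with ((c * pz h x) * / E x).
      + apply (is_derive_comp ln E); [|apply DE; assumption].
        apply is_derive_Reals. apply derivable_pt_lim_ln. lra.
      + unfold z, zt. rewrite e1. reflexivity. }
  assert (sq : exists F, forall x y, 0 <= x -> x <= y -> y <= PI / 2 -> HK (fun s => z s ^ 2) x y (F y - F x)).
  { destruct (improper_primitive (fun s => z s ^ 2) (fun s => (8 * c) ^ 2 * rp (-(7/8)) s)
      (fun s => (8 * c) ^ 2 * (8 * rp (1/8) s)) 0 (PI / 2)) as [F [_ [CF [DF _]]]].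
    - lra.
    - intros x Hx. apply (continuous_ext (fun s => z s * z s)); [intros; simpl; ring|].
      apply (continuous_mult z z); apply Az; assumption.
    - intros x Hx. split; [apply pow2_ge_0|].
      destruct (zt_le c c0 h x Ch' Hx) as [z0 z1].
      destruct (pz_le h x (7/16) ltac:(lra) Hx) as [_ p1].
      assert (z2 : z x <= 8 * c * rp (-(7/16)) x) by (fold z in z1; nra).
      replace (-(7/8)) with (-(7/16) + -(7/16)) by field. rewrite rp_plus by lra.
      replace ((8 * c) ^ 2 * (rp (-(7/16)) x * rp (-(7/16)) x)) with ((8 * c * rp (-(7/16)) x) ^ 2) by ring.
      apply pow_incr. split; assumption.
    - intros x Hx. apply (is_derive_scal (fun s => 8 * rp (1/8) s) x ((8 * c) ^ 2)).
      apply is_derive_eq with (8 * (1/8 * rp (1/8 - 1) x)).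
      + apply (is_derive_scal (rp (1/8)) x 8). apply rp_derive. lra.
      + replace (1/8 - 1) with (-(7/8)) by field. field.
    - apply continuous_cont_on. intros x _. apply (continuous_scal_r ((8 * c) ^ 2) (fun s => 8 * rp (1/8) s)).
      apply (continuous_scal_r 8 (rp (1/8))). apply rp_continuous. lra.
    - exists F. intros x y h1 h2 h3. apply (HK_FTC_open F (fun s => z s ^ 2) 0 (PI / 2)); auto. }
  destruct sq as [F HF].
  destruct (adm_primitive (8 * c) z Az) as [G [_ [_ [_ [HG _]]]]].
  exists z. split; [|split; [|split; [|split]]].
  - split; [split|].
    + exists (G (PI / 2)). apply HG. lra.
    + exists (G (PI / 2)). apply (HK_ext_except z _ (0 :: PI / 2 :: nil)); [|apply HG; lra].
      intros x Hx Hn. simpl in Hn. rewrite Rabs_pos_eq; [reflexivity|]. apply zb.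
      destruct (Req_dec x 0) as [->|]; [tauto|]. destruct (Req_dec x (PI / 2)) as [->|]; [tauto|]. lra.
    + exists (F (PI / 2) - F 0). apply HF; lra.
  - apply ae_on_all. intros s Hs. apply zb. assumption.
  - apply ae_on_all. intros s Hs. unfold Phi. rewrite HL by lra. destruct (HE s ltac:(lra)) as [e1 e2].
    rewrite exp_ln by lra. rewrite <- Eh by lra. unfold z at 1. unfold zt. rewrite e1, pe by assumption.
    rewrite clampsin_eq; [reflexivity|]. pose proof (h0 s ltac:(lra)). pose proof (th s ltac:(lra)). lra.
  - apply ae_on_all. intros s Hs. rewrite <- Eh by lra. pose proof (h0 s ltac:(lra)). pose proof (th s ltac:(lra)). lra.
  - unfold L2norm. rewrite (HKint_eq _ _ _ _ (HF 0 (PI / 2) ltac:(lra) ltac:(lra) ltac:(lra))).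
    pose proof (HK_square_bound c z F c0 zb HF) as nb.
    replace (9 * sqrt PI / 2) with (sqrt (81/4 * PI)).
    (* Numerically [36 (9/7)^2 < 60], while [81/4 * PI > 60] already from [PI >= 3]. *)
    + apply sqrt_le_1_alt. assert (c ^ 2 <= (9/7) ^ 2) by (apply pow_incr; lra). simpl in *. lra.
    + rewrite sqrt_mult by lra. replace (81/4) with (9/2 * (9/2)) by field. rewrite sqrt_square by lra. field.
Qed.
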